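(* Let $A,N_1,\dots,N_q\in\mathbb R^{n\times n}$, $B\in\mathbb R^{n\times m}$, $C\in\mathbb R^{p\times n}$ be such that $(A,B,N_i)$ is stabilizable and $(A,C,N_i)$ is observable. Let $P>0$ satisfy $$A^\top P^{-1}+P^{-1}A+\sum_{i,j=1}^q N_i^\top P^{-1}N_jk_{ij}-C^\top C+P^{-1}BB^\top P^{-1}\le 0,$$ and let $Q>0$ be the stabilizing solution of $$A^\top Q+QA+\sum_{i,j=1}^q N_i^\top QN_jk_{ij}+C^\top C-QBB^\top Q=0.$$ Let $1\le r<n$, let $\sigma_1\ge\dots\ge\sigma_n>0$ be the square roots of the eigenvalues of $PQ$, and let $(A_r,B_r,C_r,N_{i,r})$ be the coefficients of the reduced system obtained by LQG balanced truncation. Let $T>0$ and $u\in L^2_T$, let $y=y(\cdot,0,u)$ be the output of the full system and $y_r=y_r(\cdot,0,u)$ the output of the reduced system, both with zero initial state and the same control $u$. Then $$\left(\mathbb E\int_0^Te^{-\beta t}\|y(t)-y_r(t)\|_2^2\,dt\right)^{1/2}\le 2\sum_{k=r+1}^n\sigma_k\left(\mathbb E\int_0^Te^{-\beta t}\|u(t)\|_2^2\,dt\right)^{1/2},$$ where $\beta=\max\{\|B^\top Q^{1/2}\|_2^2,\ \|CP^{1/2}\|_2^2\}$.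
   Context: Probability setting: $(\Omega,\mathcal F,(\mathcal F_t)_{t\ge0},\mathbb P)$ is a filtered probability space with right-continuous complete filtration; $W=(W_1,\dots,W_q)^\top$ is an adapted $\mathbb R^q$-valued mean-zero Wiener process with covariance matrix $K=(k_{ij})$, i.e. $\mathbb E[W(t)W(t)^\top]=Kt$, whose increments $W(t+h)-W(t)$ are independent of $\mathcal F_t$. $L^2_T$ is the set of adapted processes $v$ with $\mathbb E\int_0^T\|v(s)\|_2^2ds<\infty$; $L^2$ denotes the case $T=\infty$. $\|\cdot\|_2$ is the Euclidean norm of vectors and the induced spectral norm of matrices. Full system: $dx(t)=[Ax(t)+Bu(t)]dt+\sum_{i=1}^qN_ix(t)dW_i(t)$, $x(0)=x_0\in\mathbb R^n$, $y(t)=Cx(t)$. Its state and output are written $x(\cdot,x_0,u)$, $y(\cdot,x_0,u)$. Definitions: $(A,N_i)$ is stable (mean square asymptotically) if there are $M\ge1$, $c>0$ with $\mathbb E\|x(t,x_0,0)\|_2^2\le Me^{-ct}\|x_0\|_2^2$ for all $x_0$, $t\ge0$. $(A,B,N_i)$ is stabilizable if for every $x_0$ there is $u\in L^2$ with $x(\cdot,x_0,u)\in L^2$. $(A,C,N_i)$ is observable if $y(t,x_0,0)=0$ a.s. for all $t\ge0$ implies $x_0=0$. A solution $Q$ of the Riccati equation is stabilizing if $(A-BB^\top Q,N_i)$ is stable; under the assumptions of the claim a stabilizing solution exists and is positive definite. LQG balanced truncation: choose a nonsingular $S_b\in\mathbb R^{n\times n}$ with $S_bPS_b^\top=S_b^{-\top}QS_b^{-1}=\Sigma_n=\operatorname{diag}(\sigma_1,\dots,\sigma_n)$,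 and put $(A_n,N_{i,n},B_n,C_n)=(S_bAS_b^{-1},S_bN_iS_b^{-1},S_bB,CS_b^{-1})$. Then $A_r,N_{i,r}$ are the upper-left $r\times r$ blocks of $A_n,N_{i,n}$, $B_r$ consists of the first $r$ rows of $B_n$, and $C_r$ of the first $r$ columns of $C_n$. The reduced system with control $u$ is $dx_r(t)=[A_rx_r(t)+B_ru(t)]dt+\sum_{i=1}^qN_{i,r}x_r(t)dW_i(t)$, $x_r(0)=x_{0,r}$, $y_r(t)=C_rx_r(t)$, with output written $y_r(\cdot,x_{0,r},u)$. *)

(* Defs.v *)
From HB Require Import structures.
From mathcomp Require Import all_boot all_order all_algebra.
From mathcomp Require Import all_classical all_reals all_analysis.

Set Implicit Arguments.
Unset Strict Implicit.
Unset Printing Implicit Defensive.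

Import Order.TTheory GRing.Theory Num.Theory.
Import numFieldNormedType.Exports.

Local Open Scope classical_set_scope.
Local Open Scope ring_scope.

Section Matrices.
Variable R : realType.

(* The norm MathComp-Analysis puts on matrices is the max norm. *)
Definition enorm (n : nat) (v : 'cV[R]_n) : R :=
  Num.sqrt (\sum_(i < n) v i 0 ^+ 2).

Definition specnorm (m n : nat) (M : 'M[R]_(m, n)) : R :=
  sup [set enorm (M *m v) | v in [set v : 'cV[R]_n | enorm v <= 1]].

Definition posdefmx (n : nat) (M : 'M[R]_n) : Prop :=
  M^T = M /\ forall v : 'cV[R]_n, v != 0 -> 0 < (v^T *m M *m v) 0 0.

Definition psdmx (n : nat) (M : 'M[R]_n) : Prop :=
  M^T = M /\ forall v : 'cV[R]_n, 0 <= (v^T *m M *m v) 0 0.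

Definition nsdmx (n : nat) (M : 'M[R]_n) : Prop := psdmx (- M).

(* X is the (unique) positive semidefinite square root of M. *)
Definition is_sqrtmx (n : nat) (M X : 'M[R]_n) : Prop :=
  psdmx X /\ X *m X = M.

Definition truncsq (n r : nat) (h : (r <= n)%N) (M : 'M[R]_n) : 'M[R]_r :=
  mxsub (widen_ord h) (widen_ord h) M.
Definition truncrow (n r m : nat) (h : (r <= n)%N) (M : 'M[R]_(n, m)) :
  'M[R]_(r, m) := rowsub (widen_ord h) M.
Definition trunccol (n r p : nat) (h : (r <= n)%N) (M : 'M[R]_(p, n)) :
  'M[R]_(p, r) := colsub (widen_ord h) M.

End Matrices.

Section StochasticBasis.
Context {R : realType} {d : measure_display} {Omega : measurableType d}.
Variables (Pr : probability Omega R) (Ft : R -> set_system Omega).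

Local Notation leb := (@lebesgue_measure R).

Definition usual_filtration : Prop :=
  [/\ forall t : R, 0 <= t -> sigma_algebra setT (Ft t),
      forall t : R, 0 <= t -> Ft t `<=` measurable,
      forall s t : R, 0 <= s -> s <= t -> Ft s `<=` Ft t,
      forall t : R, 0 <= t -> \bigcap_(s in [set s : R | t < s]) Ft s `<=` Ft t
    & forall (t : R) E, 0 <= t -> Pr.-negligible E -> Ft t E].

Definition measurable_wrt (G : set_system Omega) (X : Omega -> R) : Prop :=
  forall Y : set R, measurable Y -> G (X @^-1` Y).

Definition adapted (J : set R) (n : nat) (v : R -> Omega -> 'cV[R]_n) : Prop :=
  forall t, J t -> 0 <= t ->
  forall i, measurable_wrt (Ft t) (fun w => v t w i 0).

(* Besides adaptedness, joint measurability in time and chance is part of the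
   notion of process, so that E int_J |v(s)|^2 ds makes sense. *)
Definition L2process (J : set R) (n : nat) (v : R -> Omega -> 'cV[R]_n) :
    Prop :=
  [/\ adapted J v,
      forall i, measurable_fun (J `*` [set: Omega])
                  (fun z : R * Omega => v z.1 z.2 i 0)
    & (\int[Pr]_w \int[leb]_(s in J) (enorm (v s w) ^+ 2)%:E < +oo)%E].

(* The normal law on R with mean 0 and variance v, a Dirac mass if v = 0
   (normal_prob 0 0 is not that Dirac mass). *)
Definition gaussian0 (v : R) (Y : set R) : \bar R :=
  if v == 0 then \d_(0 : R) Y else normal_prob 0 (Num.sqrt v) Y.

Definition wiener (q : nat) (K : 'M[R]_q) (W : R -> Omega -> 'cV[R]_q) : Prop :=
  [/\ adapted `[0, +oo[ W,
      {ae Pr, forall w, W 0 w = 0},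
      {ae Pr, forall w, {within `[0, +oo[, continuous (fun t => W t w)}},
      (forall (t : R) i, 0 <= t -> ('E_Pr[fun w => (W t w i 0)%R] = 0)%E) /\
      (forall (t : R) i j, 0 <= t ->
        ('E_Pr[fun w => (W t w i 0 * W t w j 0)%R] = (K i j * t)%:E)%E)
    & forall s t : R, 0 <= s -> s <= t ->
      (* a Gaussian vector is one all of whose linear forms are Gaussian *)
      (forall (a : 'cV[R]_q) (Y : set R), measurable Y ->
        Pr ((fun w => (a^T *m (W t w - W s w)) 0 0) @^-1` Y) =
        gaussian0 ((t - s) * (a^T *m K *m a) 0 0) Y) /\
      (forall E F : set Omega, Ft s E ->
        g_sigma_preimage (fun (i : 'I_q) w => (W t w - W s w) i 0) F ->
        Pr (E `&` F) = (Pr E * Pr F)%E)].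

(* The process sum_(j < sp_len) sp_coef j * 1_(sp_time j, sp_time j.+1]. *)
Record simple_process := SimpleProcess {
  sp_len : nat;
  sp_time : nat -> R;
  sp_coef : nat -> Omega -> R }.

Definition simple_adapted (H : simple_process) : Prop :=
  0 <= sp_time H 0%N /\
  forall j, (j < sp_len H)%N ->
    [/\ sp_time H j <= sp_time H j.+1,
        measurable_wrt (Ft (sp_time H j)) (sp_coef H j)
      & exists c : R, forall w, `|sp_coef H j w| <= c].

Definition simple_eval (H : simple_process) (t : R) (w : Omega) : R :=
  \sum_(j < sp_len H)
    sp_coef H j w * ((sp_time H j < t) && (t <= sp_time H j.+1))%:R.

Definition simple_integral (b : R -> Omega -> R) (H : simple_process) (t : R)
    (w : Omega) : R :=
  \sum_(j < sp_len H) sp_coef H j w *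
    (b (Num.min t (sp_time H j.+1)) w - b (Num.min t (sp_time H j)) w).

(* Z is (a version of) the Ito integral of v against the scalar Brownian motion
   b over [0, t]: the L^2 limit of the integrals of simple processes that
   approximate v in L^2([0, t] x Omega). *)
Definition ito_integral (b v : R -> Omega -> R) (t : R) (Z : Omega -> R) :
    Prop :=
  measurable_fun [set: Omega] Z /\
  exists H : nat -> simple_process,
    [/\ forall k, simple_adapted (H k),
        (\int[Pr]_w \int[leb]_(s in `[0%R, t])
           ((simple_eval (H k) s w - v s w) ^+ 2)%:E)%E @[k --> \oo] --> 0%E
      & (\int[Pr]_w ((simple_integral b (H k) t w - Z w) ^+ 2)%:E)%E
           @[k --> \oo] --> 0%E].

Section SDE.
Variables (q : nat) (W : R -> Omega -> 'cV[R]_q).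

(* x solves dx = [A x + f] dt + sum_i N_i x dW_i, x(0) = x0, on [0, T]; it is
   unique up to indistinguishability when f is square integrable. *)
Definition sde_solution (T : R) (n : nat) (A : 'M[R]_n) (N : 'I_q -> 'M[R]_n)
    (f : R -> Omega -> 'cV[R]_n) (x0 : 'cV[R]_n) (x : R -> Omega -> 'cV[R]_n) :
    Prop :=
  [/\ L2process `[0, T] x,
      {ae Pr, forall w, {within `[0, T], continuous (fun t => x t w)}}
    & forall t : R, 0 <= t <= T -> exists Z : 'I_q -> Omega -> 'cV[R]_n,
      (forall i l, ito_integral (fun s w => W s w i 0)
                     (fun s w => (N i *m x s w) l 0) t (fun w => Z i w l 0)) /\
      {ae Pr, forall w, x t w =
        x0 + (\col_l \int[leb]_(s in `[0, t]) (A *m x s w + f s w) l 0)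
           + \sum_(i < q) Z i w}].

Definition state (T : R) (n m : nat) (A : 'M[R]_n) (B : 'M[R]_(n, m))
    (N : 'I_q -> 'M[R]_n) (x0 : 'cV[R]_n) (u : R -> Omega -> 'cV[R]_m)
    (x : R -> Omega -> 'cV[R]_n) : Prop :=
  sde_solution T A N (fun t w => B *m u t w) x0 x.

Definition free_state_global (n : nat) (A : 'M[R]_n) (N : 'I_q -> 'M[R]_n)
    (x0 : 'cV[R]_n) (x : R -> Omega -> 'cV[R]_n) : Prop :=
  forall T : R, 0 < T -> sde_solution T A N (fun _ _ => 0) x0 x.

Definition ms_stable (n : nat) (A : 'M[R]_n) (N : 'I_q -> 'M[R]_n) : Prop :=
  exists M c : R, [/\ 1 <= M, 0 < c &
    forall x0 x, free_state_global A N x0 x -> forall t : R, 0 <= t ->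
      ('E_Pr[fun w => (enorm (x t w) ^+ 2)%R] <=
         (M * expR (- (c * t)) * enorm x0 ^+ 2)%:E)%E].

Definition stabilizable (n m : nat) (A : 'M[R]_n) (B : 'M[R]_(n, m))
    (N : 'I_q -> 'M[R]_n) : Prop :=
  forall x0 : 'cV[R]_n, exists (u : R -> Omega -> 'cV[R]_m) x,
    [/\ L2process `[0, +oo[ u,
        forall T : R, 0 < T -> state T A B N x0 u x
      & L2process `[0, +oo[ x].

Definition observable (n p : nat) (A : 'M[R]_n) (C : 'M[R]_(p, n))
    (N : 'I_q -> 'M[R]_n) : Prop :=
  forall x0 x, free_state_global A N x0 x ->
    (forall t : R, 0 <= t -> {ae Pr, forall w, C *m x t w = 0}) -> x0 = 0.

End SDE.

(* (E int_0^T e^(- beta t) |v(t)|_2^2 dt)^(1/2) *)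
Definition weighted_L2norm (beta T : R) (n : nat)
    (v : R -> Omega -> 'cV[R]_n) : \bar R :=
  ((\int[Pr]_w \int[leb]_(t in `[0%R, T])
      (expR (- (beta * t)) * enorm (v t w) ^+ 2)%:E) `^ 2^-1)%E.

End StochasticBasis.

(* Main.v *)
(** Write Sigma = diag(sigma_1, ..., sigma_n).  In balanced coordinates the two
    matrix (in)equalities say that v^T Sigma v and v^T Sigma^-1 v grow along the
    dynamics at rate at most beta, up to an output term for the first and an
    input term for the second.  Let xi and eta be the states of the systems
    truncated to the first k + 1 and the first k coordinates, both seen in R^n,
    and s the weight of the coordinate that is dropped.  Then
      V = E[(xi - eta)^T Sigma (xi - eta) + s^2 (xi + eta)^T Sigma^-1 (xi + eta)]
    satisfies V' <= beta V - E|C (xi - eta)|^2 + 4 s^2 E|u|^2: in the dropped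
    row the two halves of V carry the same weight s, so the cross terms that the
    truncation produces cancel.  Hence each truncation costs 2 s, and the
    triangle inequality adds up the costs.

    Only the full and the reduced state are given, so the argument is carried
    out for Euler schemes of step h driven by the integrals of u over the grid
    cells.  The energy balance then holds up to O(sqrt h), and the schemes for
    the two given systems converge to their states by the Ito isometry and a
    discrete Gronwall lemma. *)

Require Import Defs.
From HB Require Import structures.
From mathcomp Require Import all_boot all_order all_algebra.
From mathcomp Require Import all_classical all_reals all_analysis.
From mathcomp Require Import measurable_realfun ring lra.
Set Implicit Arguments.
Unset Strict Implicit.
Unset Printing Implicit Defensive.
Import Order.TTheory GRing.Theory Num.Theory.
Import numFieldNormedType.Exports.
Local Open Scope classical_set_scope.
Local Open Scope ring_scope.

(** * Square-integrable functions *)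

(** Ito's formula would give the energy balance at once, but it needs the states of all intermediate
    truncated systems; Euler schemes exist without an existence theorem. As [u] has no point values,
    a scheme receives its exact integral over each cell. By Cauchy-Schwarz the second moment of that
    integral is at most h times the energy of [u] on the cell. The integral is known only at the end
    of the step and may correlate with the noise of the step; bounding this correlation causes the
    loss of order sqrt h. That these integrals are adapted is read off from the state equation: the
    integrated drift is the state minus its stochastic integrals. The rate beta absorbs the two
    terms of unfavourable sign: Q B B^T Q is at most |B^T Q^(1/2)|^2 Q, and C^T C is at most |C
    P^(1/2)|^2 P^-1. The factor 4 s^2 comes from completing a square in the input. The costs are
    added on squared norms, by Cauchy-Schwarz with weights sigma_k. *)

Section SquareIntegrable.
Context d (T : measurableType d) (R : realType).
Variable mu : {measure set T -> \bar R}.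
Implicit Types f g : T -> R.

Definition sqint f : Prop :=
  measurable_fun setT f /\ (\int[mu]_x (f x ^+ 2)%:E < +oo)%E.

(** This is the squared norm, without the root. Since [fine] sends an infinite integral to 0, the
    value is meaningful for functions satisfying [sqint]. *)
Definition sqnorm f : R := fine (\int[mu]_x (f x ^+ 2)%:E).

Definition sqip f g : R := \int[mu]_x (f x * g x).

Let mEsq f : measurable_fun setT f ->
  measurable_fun setT ((fun x => (f x ^+ 2)%:E) : T -> \bar R).
Proof. by move=> mf; apply/measurable_EFinP; exact: measurable_funX. Qed.

Lemma L2_meas f : sqint f -> measurable_fun setT f. Proof. by case. Qed.

Lemma n2_ge0 f : 0 <= sqnorm f.
Proof. by apply: fine_ge0; apply: integral_ge0 => x _; rewrite lee_fin sqr_ge0. Qed.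

Lemma n2E f : sqint f -> (\int[mu]_x (f x ^+ 2)%:E)%E = (sqnorm f)%:E.
Proof.
move=> [mf f2]; rewrite /sqnorm fineK// ge0_fin_numE//.
by apply: integral_ge0 => x _; rewrite lee_fin sqr_ge0.
Qed.

Lemma L2_le f c : measurable_fun setT f ->
  (\int[mu]_x (f x ^+ 2)%:E <= c%:E)%E -> sqint f /\ sqnorm f <= c.
Proof.
move=> mf fc; have Lf : sqint f by split=> //; rewrite (le_lt_trans fc)// ltry.
by split=> //; rewrite -lee_fin -n2E.
Qed.

Lemma L2_int_sq f : sqint f -> mu.-integrable setT (EFin \o (fun x => f x ^+ 2)).
Proof.
move=> [mf f2]; apply/integrableP; split; first exact: mEsq.
by under eq_integral do rewrite /= ger0_norm ?sqr_ge0//.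
Qed.

Lemma L2_mul_int f g : sqint f -> sqint g ->
  mu.-integrable setT (EFin \o (fun x => f x * g x)).
Proof.
move=> Lf Lg; apply: (@le_integrable _ _ _ mu _ measurableT _
    (EFin \o (fun x => f x ^+ 2 + g x ^+ 2))).
- by apply/measurable_EFinP; apply: measurable_funM; [case: Lf|case: Lg].
- move=> x _ /=; rewrite lee_fin normrM.
  rewrite [leRHS]ger0_norm ?addr_ge0 ?sqr_ge0//.
  rewrite -(real_normK (num_real (f x))) -(real_normK (num_real (g x))).
  have := sqr_ge0 (`|f x| - `|g x|); have := sqr_ge0 (`|f x| + `|g x|).
  nra.
- exact: (integrableD measurableT (L2_int_sq Lf) (L2_int_sq Lg)).
Qed.

Lemma n2_ip f : sqnorm f = sqip f f.
Proof. by rewrite /sqnorm /sqip /Rintegral; under eq_integral do rewrite expr2. Qed.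

Lemma ipC f g : sqip f g = sqip g f.
Proof. by rewrite /sqip; under eq_Rintegral do rewrite mulrC. Qed.

Lemma ipDl f g h : sqint f -> sqint g -> sqint h ->
  sqip (fun x => f x + g x) h = sqip f h + sqip g h.
Proof.
move=> Lf Lg Lh; rewrite /sqip; under eq_Rintegral do rewrite mulrDl.
by rewrite RintegralD//; exact: L2_mul_int.
Qed.

Lemma ipZl a f h : sqint f -> sqint h -> sqip (fun x => a * f x) h = a * sqip f h.
Proof.
move=> Lf Lh; rewrite /sqip; under eq_Rintegral do rewrite -mulrA.
by rewrite RintegralZl//; exact: L2_mul_int.
Qed.

Lemma L2_0 : sqint (fun=> 0).
Proof.
split=> //; under eq_integral do rewrite expr0n/=.
by rewrite integral0 ltry.
Qed.

Lemma L2Z a f : sqint f -> sqint (fun x => a * f x).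
Proof.
move=> Lf; split; first by apply: measurable_funM => //; case: Lf.
under eq_integral do rewrite exprMn EFinM.
rewrite ge0_integralZl//=; first by rewrite n2E// -EFinM ltry.
- by apply: mEsq; case: Lf.
- by move=> x _; rewrite lee_fin sqr_ge0.
- by rewrite lee_fin sqr_ge0.
Qed.

Lemma L2D f g : sqint f -> sqint g -> sqint (fun x => f x + g x).
Proof.
move=> Lf Lg; have [mf _] := Lf; have [mg _] := Lg; split.
  exact: measurable_funD.
apply: (@le_lt_trans _ _ (\int[mu]_x ((2 * f x ^+ 2)%:E + (2 * g x ^+ 2)%:E))%E).
  apply: ge0_le_integral => //.
  - by move=> x _; rewrite lee_fin sqr_ge0.
  - by apply: mEsq; exact: measurable_funD.
  - by apply: emeasurable_funD; apply/measurable_EFinP;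
      apply: measurable_funM => //; exact: measurable_funX.
  - move=> x _; rewrite -EFinD lee_fin; have := sqr_ge0 (f x - g x); nra.
have L2' h : sqint h -> (\int[mu]_x (2 * h x ^+ 2)%:E < +oo)%E.
  move=> Lh; under eq_integral do rewrite EFinM.
  rewrite ge0_integralZl//=; first by rewrite n2E// -EFinM ltry.
  - by apply: mEsq; case: Lh.
  - by move=> x _; rewrite lee_fin sqr_ge0.
rewrite ge0_integralD//=.
- by rewrite lte_add_pinfty// L2'.
- by move=> x _; rewrite lee_fin mulr_ge0 ?sqr_ge0.
- by apply/measurable_EFinP; apply: measurable_funM => //; exact: measurable_funX.
- by move=> x _; rewrite lee_fin mulr_ge0 ?sqr_ge0.
- by apply/measurable_EFinP; apply: measurable_funM => //; exact: measurable_funX.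
Qed.

Lemma L2N f : sqint f -> sqint (fun x => - f x).
Proof. by move=> /(L2Z (-1)); under eq_fun do rewrite mulN1r. Qed.

Lemma L2B f g : sqint f -> sqint g -> sqint (fun x => f x - g x).
Proof. by move=> Lf Lg; apply: L2D => //; exact: L2N. Qed.

Lemma L2_sum (I : Type) (s : seq I) (F : I -> T -> R) :
  (forall i, sqint (F i)) -> sqint (fun x => \sum_(i <- s) F i x).
Proof.
move=> LF; elim: s => [|i s ih].
  by under eq_fun do rewrite big_nil; exact: L2_0.
by under eq_fun do rewrite big_cons; exact: L2D.
Qed.

Lemma ipDr f g h : sqint f -> sqint g -> sqint h ->
  sqip h (fun x => f x + g x) = sqip h f + sqip h g.
Proof. by move=> *; rewrite ipC ipDl// ![sqip h _]ipC. Qed.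

Lemma ipZr a f h : sqint f -> sqint h -> sqip h (fun x => a * f x) = a * sqip h f.
Proof. by move=> *; rewrite ipC ipZl// ![sqip h _]ipC. Qed.

Lemma ip0l h : sqip (fun=> 0) h = 0.
Proof.
rewrite /sqip; under eq_Rintegral do rewrite mul0r.
by rewrite /Rintegral integral0.
Qed.

Lemma ip_suml (I : Type) (s : seq I) (F : I -> T -> R) h :
  (forall i, sqint (F i)) -> sqint h ->
  sqip (fun x => \sum_(i <- s) F i x) h = \sum_(i <- s) sqip (F i) h.
Proof.
move=> LF Lh; elim: s => [|i s ih].
  by rewrite big_nil; under eq_fun do rewrite big_nil; exact: ip0l.
rewrite big_cons -ih; under eq_fun do rewrite big_cons.
by rewrite ipDl//; exact: L2_sum.
Qed.

Lemma ip_sumr (I : Type) (s : seq I) (F : I -> T -> R) h :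
  (forall i, sqint (F i)) -> sqint h ->
  sqip h (fun x => \sum_(i <- s) F i x) = \sum_(i <- s) sqip h (F i).
Proof. by move=> *; rewrite ipC ip_suml//; apply: eq_bigr => i _; rewrite ipC. Qed.

Lemma n2D f g : sqint f -> sqint g ->
  sqnorm (fun x => f x + g x) = sqnorm f + 2 * sqip f g + sqnorm g.
Proof.
move=> Lf Lg; rewrite !n2_ip ipDl//; last exact: L2D.
rewrite !ipDr// (ipC g f); ring.
Qed.

Lemma n2Z a f : sqint f -> sqnorm (fun x => a * f x) = a ^+ 2 * sqnorm f.
Proof. by move=> Lf; rewrite !n2_ip ipZl ?ipZr//; [ring|exact: L2Z]. Qed.

Lemma n2N f : sqnorm (fun x => - f x) = sqnorm f.
Proof. by rewrite /sqnorm; under eq_integral do rewrite sqrrN. Qed.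

Lemma n2B f g : sqint f -> sqint g ->
  sqnorm (fun x => f x - g x) = sqnorm f - 2 * sqip f g + sqnorm g.
Proof.
move=> Lf Lg; rewrite n2D//; last exact: L2N.
have -> : sqip f (fun x => - g x) = - sqip f g.
  by rewrite -mulN1r -ipZr//; congr sqip; apply/funext => x; rewrite mulN1r.
rewrite n2N; ring.
Qed.

Lemma n20 : sqnorm (fun=> 0) = 0.
Proof. by rewrite n2_ip ip0l. Qed.

(** Young's inequality. The weight [c] stays free because later choices of it, such as h or 1 / sqrt
    h, decide which of the two terms is of lower order. *)
Lemma ip_le_eps c f g : 0 < c -> sqint f -> sqint g ->
  2 * sqip f g <= c * sqnorm f + c^-1 * sqnorm g.
Proof.
move=> c0 Lf Lg; rewrite -subr_ge0.
have -> : c * sqnorm f + c^-1 * sqnorm g - 2 * sqip f g =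
  c^-1 * sqnorm (fun x => c * f x - g x).
  rewrite n2B ?n2Z ?ipZl//; last exact: L2Z.
  by field; rewrite gt_eqF.
by rewrite mulr_ge0 ?n2_ge0// invr_ge0 ltW.
Qed.

Lemma n2D_eps c f g : 0 < c -> sqint f -> sqint g ->
  sqnorm (fun x => f x + g x) <= (1 + c) * sqnorm f + (1 + c^-1) * sqnorm g.
Proof. by move=> c0 Lf Lg; rewrite n2D//; have := ip_le_eps c0 Lf Lg; nra. Qed.

Lemma n2D_le f g : sqint f -> sqint g ->
  sqnorm (fun x => f x + g x) <= 2 * sqnorm f + 2 * sqnorm g.
Proof. by move=> Lf Lg; have := n2D_eps ltr01 Lf Lg; rewrite invr1. Qed.

Lemma n2B_le f g : sqint f -> sqint g ->
  sqnorm (fun x => f x - g x) <= 2 * sqnorm f + 2 * sqnorm g.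
Proof. by move=> Lf Lg; rewrite -(n2N g); apply: n2D_le => //; exact: L2N. Qed.

Lemma n2_sum_le (I : finType) (F : I -> T -> R) :
  (forall i, sqint (F i)) ->
  sqnorm (fun x => \sum_i F i x) <= #|I|%:R * \sum_i sqnorm (F i).
Proof.
move=> LF; rewrite n2_ip ip_suml//; last exact: L2_sum.
(* Written as a double sum, the right-hand side can be compared with the inner products term by
   term. *)
have -> : #|I|%:R * \sum_i sqnorm (F i) =
  \sum_i \sum_j (2^-1 * sqnorm (F i) + 2^-1 * sqnorm (F j)).
  rewrite [RHS](eq_bigr (fun i => 2^-1 * (#|I|%:R * sqnorm (F i)) +
      2^-1 * \sum_j sqnorm (F j))); last first.
    by move=> i _; rewrite big_split/= sumr_const -mulr_sumr -(mulr_natl _ #|I|) mulrCA.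
  rewrite big_split/= sumr_const -!mulr_sumr -(mulr_natl _ #|I|).
  by field.
apply: ler_sum => i _; rewrite ip_sumr//; apply: ler_sum => j _.
have := ip_le_eps ltr01 (LF i) (LF j); rewrite invr1; lra.
Qed.

Lemma n2_le f g : sqint f -> sqint g -> (forall x, f x ^+ 2 <= g x ^+ 2) ->
  sqnorm f <= sqnorm g.
Proof.
move=> Lf Lg fg; rewrite -lee_fin -!n2E//; apply: ge0_le_integral => //.
- by move=> x _; rewrite lee_fin sqr_ge0.
- by apply: mEsq; case: Lf.
- by apply: mEsq; case: Lg.
- by move=> x _; rewrite lee_fin.
Qed.

Lemma L2_ae f g : measurable_fun setT g -> {ae mu, forall x, f x = g x} ->
  sqint f -> sqint g /\ sqnorm g = sqnorm f.
Proof.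
move=> mg fg Lf; have [mf f2] := Lf.
have E : (\int[mu]_x (f x ^+ 2)%:E = \int[mu]_x (g x ^+ 2)%:E)%E.
  apply: ge0_ae_eq_integral => //.
  - exact: mEsq.
  - exact: mEsq.
  - by move=> x _; rewrite lee_fin sqr_ge0.
  - by move=> x _; rewrite lee_fin sqr_ge0.
  - by apply: filterS fg => x -> _.
by split; [split=> //; rewrite -E|rewrite /sqnorm E].
Qed.

End SquareIntegrable.

(** * Wiener increments and integrals of elementary processes *)

Section Independence.
Context d (T : measurableType d) (R : realType) (Pr : probability T R).

(** Independence is given on events. It says that the joint law agrees with the product of the
    marginal laws on rectangles, hence everywhere, and Fubini's theorem then factors the mean. *)
Lemma indep_mul (X Y : T -> R) :
  measurable_fun setT X -> measurable_fun setT Y ->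
  (forall A B, measurable A -> measurable B ->
    Pr (X @^-1` A `&` Y @^-1` B) = (Pr (X @^-1` A) * Pr (Y @^-1` B))%E) ->
  Pr.-integrable setT (EFin \o X) -> Pr.-integrable setT (EFin \o Y) ->
  Pr.-integrable setT (EFin \o (fun w => X w * Y w)) /\
  \int[Pr]_w (X w * Y w) = \int[Pr]_w X w * \int[Pr]_w Y w.
Proof.
move=> mX mY XY iX iY.
pose Xm : {mfun T >-> R} := HB.pack X (isMeasurableFun.Build _ _ _ _ X mX).
pose Ym : {mfun T >-> R} := HB.pack Y (isMeasurableFun.Build _ _ _ _ Y mY).
pose Z := (fun w => (X w, Y w)) : T -> R * R.
have mZ : measurable_fun setT Z by exact: measurable_fun_pair.
pose Zm : {mfun T >-> (R * R)%type} :=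
  HB.pack Z (isMeasurableFun.Build _ _ _ _ Z mZ).
pose m1 := distribution Pr Xm.
pose m2 := distribution Pr Ym.
pose mm := distribution Pr Zm.
have mmE A : measurable A -> (m1 \x m2)%E A = mm A.
  move=> mA; apply: product_measure_unique => //= B C mB mC.
pose f := (fun z : R * R => (z.1 * z.2)%:E).
have mf : measurable_fun setT (f : R * R -> \bar R).
  by apply/measurable_EFinP; apply: measurable_funM.
have im1 : m1.-integrable setT (EFin : R -> \bar R).
  exact: integrable_pushforward.
have im2 : m2.-integrable setT (EFin : R -> \bar R).
  exact: integrable_pushforward.
have a1 : (\int[m1]_x `|x%:E| = (\int[m1]_x `|x|)%:E)%E.
  by rewrite /Rintegral fineK//; apply: integrable_fin_num => //; exact: integrable_norm.
have a2 : (\int[m2]_x `|x%:E| = (\int[m2]_x `|x|)%:E)%E.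
  by rewrite /Rintegral fineK//; apply: integrable_fin_num => //; exact: integrable_norm.
have if12 : (m1 \x m2)%E.-integrable setT f.
  apply/integrable12ltyP => //.
  rewrite (eq_integral (fun x : R => (\int[m2]_y `|y|)%:E * `|x%:E|)%E); last first.
    move=> x _; rewrite -a2 muleC -ge0_integralZl//=.
      by apply: eq_integral => y _; rewrite /f/= -EFinM normrM.
    exact: measurableT_comp.
  rewrite ge0_integralZl//=; first by rewrite a1 -EFinM ltry.
    exact: measurableT_comp.
  by rewrite lee_fin Rintegral_ge0.
have ifm : mm.-integrable setT f.
  have /integrableP[_ h] := if12; apply/integrableP; split => //.
  rewrite (eq_measure_integral (m1 \x m2)%E)// => A mA _; exact/esym/mmE.
have iXY : Pr.-integrable setT (EFin \o (fun w => X w * Y w)).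
  have /integrableP[_ h] := ifm; apply/integrableP; split.
    by apply/measurable_EFinP; exact: measurable_funM.
  move: h; rewrite ge0_integral_pushforward//=.
  by apply/measurable_EFinP; apply: measurableT_comp => //; exact: measurable_funM.
split=> //.
have E1 : (\int[mm]_z f z = \int[Pr]_w (X w * Y w)%:E)%E.
  by rewrite integral_pushforward.
have E2 : (\int[mm]_z f z = \int[m1 \x m2]_z f z)%E.
  apply: eq_measure_integral => A mA _; exact/esym/mmE.
have E3 : (\int[m1]_x x%:E = \int[Pr]_w (X w)%:E)%E.
  by rewrite integral_pushforward.
have E4 : (\int[m2]_x x%:E = \int[Pr]_w (Y w)%:E)%E.
  by rewrite integral_pushforward.
rewrite /Rintegral -E1 E2 -integral12_prod_meas1// /fubini_F /f/=.
rewrite -E3 -E4 -fineM ?integrable_fin_num//; congr fine.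
under eq_integral => x _.
  under eq_integral do rewrite EFinM.
  rewrite integralZl//; over.
rewrite -(fineK (integrable_fin_num measurableT im2)) muleC -integralZl//.
by apply: eq_integral => x _; rewrite muleC.
Qed.

End Independence.

Section MeasurableWrt.
Context d (Omega : measurableType d) (R : realType).
Implicit Types (G : set_system Omega) (X Y : Omega -> R).

(** Transfers the closure properties of measurable functions, which are stated for measurable types,
    to a bare sigma-algebra [G]. *)
Lemma mwrtP G X : sigma_algebra setT G ->
  measurable_wrt G X <->
  measurable_fun setT (X : g_sigma_algebraType G -> R).
Proof.
move=> sG; split => [h _ Y mY|h Y mY].
  by rewrite setTI; apply: sub_sigma_algebra; exact: h.
by have := h measurableT Y mY; rewrite setTI /measurable/= sigma_algebra_id.
Qed.

Lemma mwrtD G X Y : sigma_algebra setT G ->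
  measurable_wrt G X -> measurable_wrt G Y ->
  measurable_wrt G (fun w => X w + Y w).
Proof.
by move=> sG /(mwrtP _ sG) hX /(mwrtP _ sG) hY; apply/mwrtP => //; exact: measurable_funD.
Qed.

Lemma mwrtM G X Y : sigma_algebra setT G ->
  measurable_wrt G X -> measurable_wrt G Y ->
  measurable_wrt G (fun w => X w * Y w).
Proof.
by move=> sG /(mwrtP _ sG) hX /(mwrtP _ sG) hY; apply/mwrtP => //; exact: measurable_funM.
Qed.

Lemma mwrt_cst G (c : R) : sigma_algebra setT G -> measurable_wrt G (fun=> c).
Proof. by move=> sG; apply/mwrtP => //; exact: measurable_cst. Qed.

Lemma mwrtZ G (c : R) X : sigma_algebra setT G ->
  measurable_wrt G X -> measurable_wrt G (fun w => c * X w).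
Proof. by move=> sG hX; apply: mwrtM => //; exact: mwrt_cst. Qed.

Lemma mwrtB G X Y : sigma_algebra setT G ->
  measurable_wrt G X -> measurable_wrt G Y ->
  measurable_wrt G (fun w => X w - Y w).
Proof.
by move=> sG /(mwrtP _ sG) hX /(mwrtP _ sG) hY; apply/mwrtP => //; exact: measurable_funB.
Qed.

Lemma mwrt_sum G (I : Type) (s : seq I) (F : I -> Omega -> R) :
  sigma_algebra setT G -> (forall i, measurable_wrt G (F i)) ->
  measurable_wrt G (fun w => \sum_(i <- s) F i w).
Proof.
move=> sG hF; elim: s => [|i s ih].
  by under eq_fun do rewrite big_nil; exact: mwrt_cst.
by under eq_fun do rewrite big_cons; exact: mwrtD.
Qed.

Lemma mwrt_sub G H X : G `<=` H -> measurable_wrt G X -> measurable_wrt H X.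
Proof. by move=> GH hX Y mY; apply: GH; exact: hX. Qed.

Lemma mwrt_meas G X : G `<=` measurable -> measurable_wrt G X ->
  measurable_fun setT X.
Proof. by move=> Gm hX _ Y mY; rewrite setTI; apply: Gm; exact: hX. Qed.

End MeasurableWrt.

Section WienerIncrements.
Context {R : realType} {d : measure_display} {Omega : measurableType d}.
Variables (Pr : probability Omega R) (Ft : R -> set_system Omega) (q : nat)
  (K : 'M[R]_q) (W : R -> Omega -> 'cV[R]_q).
Hypotheses (hF : usual_filtration Pr Ft) (hW : wiener Pr Ft K W).

Local Notation L2 := (sqint Pr).
Local Notation n2 := (sqnorm Pr).
Local Notation ip := (sqip Pr).

Definition increment (s t : R) (i : 'I_q) (w : Omega) : R := W t w i 0 - W s w i 0.

Lemma Ft_sigma t : 0 <= t -> sigma_algebra setT (Ft t).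
Proof. by case: hF => h _ _ _ _; exact: h. Qed.

Lemma Ft_meas t (X : Omega -> R) : 0 <= t -> measurable_wrt (Ft t) X -> measurable_fun setT X.
Proof. by case: hF => _ h _ _ _ t0; apply: mwrt_meas; exact: h. Qed.

Lemma Ft_mono s t (X : Omega -> R) : 0 <= s -> s <= t ->
  measurable_wrt (Ft s) X -> measurable_wrt (Ft t) X.
Proof. by case: hF => _ _ h _ _ s0 st; apply: mwrt_sub; exact: h. Qed.

Lemma W_Ft t i : 0 <= t -> measurable_wrt (Ft t) (fun w => W t w i 0).
Proof. by case: hW => h _ _ _ _ t0; apply: h => //=; rewrite in_itv/= t0. Qed.

Lemma dW_Ft s t i : 0 <= s -> s <= t -> measurable_wrt (Ft t) (increment s t i).
Proof.
move=> s0 st; apply: mwrtB; first exact: Ft_sigma (le_trans s0 st).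
- by apply: W_Ft; exact: le_trans st.
- by apply: (Ft_mono s0 st); exact: W_Ft.
Qed.

Lemma W_L2 t i : 0 <= t -> L2 (fun w => W t w i 0).
Proof.
move=> t0; split; first by apply: (Ft_meas t0); exact: W_Ft.
case: hW => _ _ _ [_ h] _; have := h t i i t0; rewrite unlock.
by move=> hE; rewrite [ltLHS](_ : _ = (K i i * t)%:E) ?ltry// -hE.
Qed.

Lemma L2_int (X : Omega -> R) : L2 X -> Pr.-integrable setT (EFin \o X).
Proof.
move=> LX; have L1 : L2 (fun=> 1).
  split => //; under eq_integral do rewrite expr1n.
  by rewrite integral_cst// mul1e; have /= -> := @probability_setT _ _ _ Pr; rewrite ltry.
by have := L2_mul_int LX L1; under eq_fun do rewrite mulr1.
Qed.

Lemma W_mean t i : 0 <= t -> \int[Pr]_w W t w i 0 = 0.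
Proof.
move=> t0; case: hW => _ _ _ [h _] _; have := h t i t0; rewrite unlock.
by rewrite /Rintegral => ->.
Qed.

Lemma W_cov t i j : 0 <= t ->
  ip (fun w => W t w i 0) (fun w => W t w j 0) = K i j * t.
Proof.
move=> t0; case: hW => _ _ _ [_ h] _; have := h t i j t0; rewrite unlock.
by rewrite /ip /Rintegral => ->.
Qed.

Lemma dW_L2 s t i : 0 <= s -> s <= t -> L2 (increment s t i).
Proof. by move=> s0 st; apply: L2B; apply: W_L2 => //; exact: le_trans st. Qed.

Lemma dW_mean s t i : 0 <= s -> s <= t -> \int[Pr]_w increment s t i w = 0.
Proof.
move=> s0 st; rewrite RintegralB//.
- by rewrite !W_mean// ?subrr// (le_trans s0 st).
- by apply/L2_int/W_L2; exact: le_trans st.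
- exact/L2_int/W_L2.
Qed.

Let inc s t : set_system Omega :=
  g_sigma_preimage (fun (i : 'I_q) w => (W t w - W s w) i 0).

Let inc_sigma s t : sigma_algebra setT (inc s t).
Proof. exact: smallest_sigma_algebra. Qed.

Let inc_dW s t i : measurable_wrt (inc s t) (increment s t i).
Proof.
move=> Y mY; apply: sub_sigma_algebra; rewrite (bigD1 i)//=; left.
exists Y => //; rewrite setTI.
by apply/seteqP; split=> w /=; rewrite /increment !mxE.
Qed.

Lemma indep_incr s t (X Y : Omega -> R) : 0 <= s -> s <= t ->
  measurable_wrt (Ft s) X -> measurable_wrt (inc s t) Y ->
  measurable_fun setT Y ->
  Pr.-integrable setT (EFin \o X) -> Pr.-integrable setT (EFin \o Y) ->
  Pr.-integrable setT (EFin \o (fun w => X w * Y w)) /\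
  \int[Pr]_w (X w * Y w) = \int[Pr]_w X w * \int[Pr]_w Y w.
Proof.
move=> s0 st FX IY mY iX iY; apply: indep_mul => //.
  exact: (Ft_meas s0).
move=> A B mA mB; case: hW => _ _ _ _ h; have [_ h2] := h s t s0 st.
by apply: h2; [exact: FX|exact: IY].
Qed.

Lemma mul_dW s t i (X : Omega -> R) : 0 <= s -> s <= t ->
  measurable_wrt (Ft s) X -> Pr.-integrable setT (EFin \o X) ->
  Pr.-integrable setT (EFin \o (fun w => X w * increment s t i w)) /\
  \int[Pr]_w (X w * increment s t i w) = 0.
Proof.
move=> s0 st FX iX.
have [] := indep_incr s0 st FX (@inc_dW s t i) (L2_meas (dW_L2 i s0 st)) iX
  (L2_int (dW_L2 i s0 st)).
by move=> ? ->; rewrite dW_mean// mulr0.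
Qed.

(** Obtained from the covariances at single times: W(s) is orthogonal to the later increment, so the
    mixed moment of W(s) and W(t) is K times s. *)
Lemma dW_cov s t i j : 0 <= s -> s <= t ->
  ip (increment s t i) (increment s t j) = K i j * (t - s).
Proof.
move=> s0 st; have t0 := le_trans s0 st.
have ip0 k l : ip (fun w => W s w k 0) (increment s t l) = 0.
  have [_] := mul_dW l s0 st (W_Ft k s0) (L2_int (W_L2 k s0)).
  by [].
have ipst k l : ip (fun w => W s w k 0) (fun w => W t w l 0) = K k l * s.
  rewrite -W_cov// -[RHS]addr0 -(ip0 k l) -ipDr//; do ?exact: W_L2.
    by congr ip; apply/funext => w; rewrite /increment addrC subrK.
  exact: dW_L2.
have -> : ip (increment s t i) (increment s t j) = ip (fun w => W t w i 0) (increment s t j).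
  rewrite -[RHS]subr0 -{1}(ip0 i j) -mulN1r -ipZl//; do ?exact: W_L2; last exact: dW_L2.
  rewrite -ipDl//; do ?exact: W_L2; last exact: dW_L2; last by apply: L2Z; exact: W_L2.
  by congr ip; apply/funext => w; rewrite /increment mulN1r.
rewrite ipC.
have -> : ip (increment s t j) (fun w => W t w i 0) =
    ip (fun w => W t w j 0) (fun w => W t w i 0) -
    ip (fun w => W s w j 0) (fun w => W t w i 0).
  rewrite -mulN1r -ipZl//; do ?exact: W_L2.
  rewrite -ipDl//; do ?exact: W_L2; last by apply: L2Z; exact: W_L2.
  by congr ip; apply/funext => w; rewrite /increment mulN1r.
rewrite ipst ipC W_cov// mulrBr; congr (_ - _ ).
by rewrite -W_cov// ipC W_cov.
Qed.

Lemma mul_dWdW s t i j (X : Omega -> R) : 0 <= s -> s <= t ->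
  measurable_wrt (Ft s) X -> Pr.-integrable setT (EFin \o X) ->
  Pr.-integrable setT (EFin \o (fun w => X w * (increment s t i w * increment s t j w))) /\
  \int[Pr]_w (X w * (increment s t i w * increment s t j w)) =
    K i j * (t - s) * \int[Pr]_w X w.
Proof.
move=> s0 st FX iX.
have iY := L2_mul_int (dW_L2 i s0 st) (dW_L2 j s0 st).
have [] := indep_incr s0 st FX (mwrtM (inc_sigma s t) (@inc_dW s t i) (@inc_dW s t j))
  (measurable_funM (L2_meas (dW_L2 i s0 st)) (L2_meas (dW_L2 j s0 st))) iX iY.
by move=> ? ->; rewrite mulrC -dW_cov.
Qed.

(** A product of two square-integrable functions is in general only integrable. Here the squares of
    the factors are independent, so the mean of their product is finite. *)
Lemma L2_mul_dW s t i (X : Omega -> R) : 0 <= s -> s <= t ->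
  measurable_wrt (Ft s) X -> L2 X -> L2 (fun w => X w * increment s t i w).
Proof.
move=> s0 st FX LX; split.
  by apply: measurable_funM; [case: LX|case: (dW_L2 i s0 st)].
have iX := L2_int_sq LX.
have [/integrableP[_ h] _] := mul_dWdW i i s0 st
  (mwrtM (Ft_sigma s0) FX FX) iX.
apply: le_lt_trans h; rewrite le_eqVlt; apply/orP; left; apply/eqP.
apply: eq_integral => w _; rewrite /= -!expr2 ger0_norm ?exprMn//.
by rewrite mulr_ge0 ?sqr_ge0.
Qed.

Lemma K_sym i j : K i j = K j i.
Proof.
by have := @W_cov 1 i j ler01; rewrite ipC W_cov// !mulr1 => ->.
Qed.

(** The form is the second moment of the linear combination of the W_i(1) with coefficients
    [c i]. *)
Lemma K_psd (c : 'I_q -> R) : 0 <= \sum_i \sum_j K i j * (c i * c j).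
Proof.
have -> : \sum_i \sum_j K i j * (c i * c j) =
  n2 (fun w => \sum_i (c i * W 1 w i 0)).
  have LW i : L2 (fun w => W 1 w i 0) by exact: W_L2.
  have LcW i : L2 (fun w => c i * W 1 w i 0) by exact: L2Z.
  rewrite n2_ip ip_suml//; last exact: L2_sum.
  apply: eq_bigr => i _; rewrite ip_sumr//; apply: eq_bigr => j _.
  by rewrite ipZl// ipZr// W_cov//; ring.
exact: n2_ge0.
Qed.

Lemma K_diag_ge0 i : 0 <= K i i.
Proof.
by have := n2_ge0 Pr (fun w => W 1 w i 0); rewrite n2_ip W_cov// mulr1.
Qed.

End WienerIncrements.

(** * Products of a function of time and a function of chance *)

Section TensorL2.
Context d1 d2 (T1 : measurableType d1) (T2 : measurableType d2) (R : realType).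
Variable m1 : {sigma_finite_measure set T1 -> \bar R}.
Variable m2 : {sigma_finite_measure set T2 -> \bar R}.

Lemma L2_tensor (f : T1 -> R) (g : T2 -> R) : sqint m1 f -> sqint m2 g ->
  sqint (m1 \x m2)%E (fun z => f z.1 * g z.2).
Proof.
move=> Lf Lg; have mfg : measurable_fun [set: T1 * T2] (fun z => f z.1 * g z.2).
  by apply: measurable_funM; apply: measurableT_comp => //; [case: Lf|case: Lg].
split => //; rewrite fubini_tonelli1/=; last 2 first.
- by apply/measurable_EFinP; exact: measurable_funX.
- by move=> x; rewrite lee_fin sqr_ge0.
rewrite (eq_integral (fun x => ((sqnorm m2 g)%:E * (f x ^+ 2)%:E))%E); last first.
  move=> x _; rewrite -n2E// muleC /fubini_F/= -ge0_integralZl//=.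
  - by apply: eq_integral => y _; rewrite exprMn EFinM.
  - by apply/measurable_EFinP; apply: measurable_funX; case: Lg.
  - by move=> y _; rewrite lee_fin sqr_ge0.
  - by rewrite lee_fin sqr_ge0.
rewrite ge0_integralZl//=.
- by rewrite n2E// -EFinM ltry.
- by apply/measurable_EFinP; apply: measurable_funX; case: Lf.
- by move=> y _; rewrite lee_fin sqr_ge0.
- by rewrite lee_fin n2_ge0.
Qed.

Lemma ip_tensor (f f' : T1 -> R) (g g' : T2 -> R) :
  sqint m1 f -> sqint m1 f' -> sqint m2 g -> sqint m2 g' ->
  sqip (m1 \x m2)%E (fun z => f z.1 * g z.2) (fun z => f' z.1 * g' z.2) =
  sqip m1 f f' * sqip m2 g g'.
Proof.
move=> Lf Lf' Lg Lg'.
have ii := L2_mul_int (L2_tensor Lf Lg) (L2_tensor Lf' Lg').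
have if1 := L2_mul_int Lf Lf'; have ig := L2_mul_int Lg Lg'.
rewrite /sqip /Rintegral -integral12_prod_meas1//= -fineM ?integrable_fin_num//.
congr fine; rewrite /fubini_F/=.
under eq_integral => x _.
  rewrite (eq_integral (fun y => (f x * f' x)%:E * (g y * g' y)%:E)%E); last first.
    by move=> y _; rewrite -EFinM; congr EFin; ring.
  rewrite integralZl//; over.
rewrite -(fineK (integrable_fin_num measurableT ig)) [RHS]muleC -integralZl//.
by apply: eq_integral => x _; rewrite muleC.
Qed.

End TensorL2.

Section Elementary.
Context {R : realType} {d : measure_display} {Omega : measurableType d}.
Variables (Pr : probability Omega R) (Ft : R -> set_system Omega) (q : nat)
  (K : 'M[R]_q) (W : R -> Omega -> 'cV[R]_q).
Hypotheses (hF : usual_filtration Pr Ft) (hW : wiener Pr Ft K W).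

Local Notation leb := (@lebesgue_measure R).
Local Notation L2 := (sqint Pr).
Local Notation n2 := (sqnorm Pr).
Local Notation ip := (sqip Pr).
Local Notation dW := (increment W).

Lemma ip_dW0 s t i (X Y : Omega -> R) : 0 <= s -> s <= t ->
  measurable_wrt (Ft s) X -> measurable_wrt (Ft s) Y -> L2 X -> L2 Y ->
  ip X (fun w => Y w * dW s t i w) = 0.
Proof.
move=> s0 st FX FY LX LY.
have [_] := mul_dW hF hW i s0 st (mwrtM (Ft_sigma hF s0) FX FY) (L2_mul_int LX LY).
by rewrite /sqip => h; rewrite -[RHS]h; apply: eq_Rintegral => w _; rewrite mulrA.
Qed.

Lemma ip_dWdW s t i j (X Y : Omega -> R) : 0 <= s -> s <= t ->
  measurable_wrt (Ft s) X -> measurable_wrt (Ft s) Y -> L2 X -> L2 Y ->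
  ip (fun w => X w * dW s t i w) (fun w => Y w * dW s t j w) =
  K i j * (t - s) * ip X Y.
Proof.
move=> s0 st FX FY LX LY.
have [_] := mul_dWdW hF hW i j s0 st (mwrtM (Ft_sigma hF s0) FX FY) (L2_mul_int LX LY).
rewrite /sqip => <-; apply: eq_Rintegral => w _; ring.
Qed.

(** One summand c 1_]a, b] of an elementary process. The coefficient is square integrable instead of
    bounded, so that the states of an Euler scheme are admissible coefficients. *)
Record elem := Elem {
  el_c : Omega -> R; el_a : R; el_b : R;
  el_a0 : 0 <= el_a; el_ab : el_a <= el_b;
  el_Ft : measurable_wrt (Ft el_a) el_c; el_L2 : L2 el_c }.

Definition ioc (a b s : R) : R := ((a < s) && (s <= b))%:R.

Definition elI i (e : elem) (w : Omega) : R := el_c e w * dW (el_a e) (el_b e) i w.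
Definition elV (e : elem) (z : R * Omega) : R :=
  ioc (el_a e) (el_b e) z.1 * el_c e z.2.

Lemma ioc_indic a b : ioc a b = \1_(`]a, b]).
Proof. by apply/funext => s; rewrite /ioc indicE mem_setE in_itv/=. Qed.

Lemma ioc_L2 a b : sqint leb (ioc a b).
Proof.
have mi : measurable_fun setT (ioc a b) by rewrite ioc_indic; exact: measurable_indic.
split => //.
rewrite (eq_integral (fun x : measurableTypeR R => (\1_(`]a, b]) x)%:E)); last first.
  by move=> s _; rewrite -ioc_indic /ioc; case: (_ && _); rewrite ?expr1n ?expr0n.
by rewrite integral_indic//= setIT lebesgue_measure_itv/=; case: ifP; rewrite ?ltry.
Qed.

Lemma ip_ioc a b a' b' : a <= a' -> a <= b -> a' <= b' ->
  sqip leb (ioc a b) (ioc a' b') =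
  if b <= a' then 0 else if b <= b' then b - a' else b' - a'.
Proof.
move=> aa ab ab'.
have -> : sqip leb (ioc a b) (ioc a' b') =
    \int[leb]_s (\1_(`]a', (Num.min b b')]) s).
  apply: eq_Rintegral => s _; rewrite -ioc_indic /ioc -natrM mulnb; congr (_%:R).
  rewrite le_min; case: (ltP a' s) => h; rewrite ?andbF//=.
  by rewrite (le_lt_trans aa h).
rewrite /Rintegral integral_indic//= setIT lebesgue_measure_itv/= lte_fin.
rewrite -EFinB lt_min; case: (ltP a' b) => //= h; rewrite minElt.
case: (ltgtP b b') => h2.
- by rewrite (lt_trans h h2).
- by case: ifP => // /negbT; rewrite -leNgt => h3; apply/esym/eqP; rewrite subr_eq0 eq_le h3 ab'.
- by rewrite -h2 h.
Qed.

Lemma elI_Ft i e : measurable_wrt (Ft (el_b e)) (elI i e).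
Proof.
case: e => c a b a0 ab Fc Lc /=; have b0 := le_trans a0 ab.
apply: mwrtM; [exact: Ft_sigma hF _ b0|exact: (Ft_mono hF a0 ab)|exact: dW_Ft hF hW _ _ _ a0 ab].
Qed.

Lemma elI_L2 i e : L2 (elI i e).
Proof. by case: e => c a b a0 ab Fc Lc; exact: (L2_mul_dW hF hW). Qed.

Lemma elV_L2 e : sqint (leb \x Pr)%E (elV e).
Proof.
exact: (L2_tensor (ioc_L2 (el_a e) (el_b e)) (el_L2 e)).
Qed.

Let cdW_split i (c : Omega -> R) x y z :
  (fun w => c w * dW x z i w) =
  (fun w => c w * dW x y i w + c w * dW y z i w).
Proof. by apply/funext => w; rewrite /increment; ring. Qed.

(** Elements of a family may overlap, because differences of families are formed by concatenation.
    Cut at the end points, two elements become pieces on equal or disjoint intervals. Equal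
    intervals give K i i times the length times the mean of c c'; on disjoint ones the later
    increment is centred and independent of the past. *)
Let iso_le i e e' : el_a e <= el_a e' ->
  ip (elI i e) (elI i e') = K i i * sqip (leb \x Pr)%E (elV e) (elV e').
Proof.
move=> aa; rewrite (ip_tensor (ioc_L2 _ _) (ioc_L2 _ _) (el_L2 e) (el_L2 e')).
move: e e' aa => [c a b a0 ab Fc Lc] [c' a' b' a0' ab' Fc' Lc'] /= aa.
rewrite ip_ioc// /elI/=.
have LcdW x y : a <= x -> x <= y -> L2 (fun w => c w * dW x y i w).
  move=> ax xy; apply: (L2_mul_dW hF hW) => //; first exact: le_trans ax.
  exact: (Ft_mono hF a0 ax).
have LcdW' x y : a' <= x -> x <= y -> L2 (fun w => c' w * dW x y i w).
  move=> ax xy; apply: (L2_mul_dW hF hW) => //; first exact: le_trans ax.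
  exact: (Ft_mono hF a0' ax).
have FcdW x y z : a <= x -> x <= y -> y <= z ->
    measurable_wrt (Ft z) (fun w => c w * dW x y i w).
  move=> ax xy yz; have x0 := le_trans a0 ax; have y0 := le_trans x0 xy.
  apply: (Ft_mono hF y0 yz); apply: mwrtM; first exact: Ft_sigma hF _ y0.
    exact: (Ft_mono hF a0 (le_trans ax xy)).
  exact: (dW_Ft hF hW).
have FcdW' x y z : a' <= x -> x <= y -> y <= z ->
    measurable_wrt (Ft z) (fun w => c' w * dW x y i w).
  move=> ax xy yz; have x0 := le_trans a0' ax; have y0 := le_trans x0 xy.
  apply: (Ft_mono hF y0 yz); apply: mwrtM; first exact: Ft_sigma hF _ y0.
    exact: (Ft_mono hF a0' (le_trans ax xy)).
  exact: (dW_Ft hF hW).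
have [ba|ab2] := leP b a'.
  rewrite mul0r mulr0; apply: ip_dW0 => //; first exact: FcdW.
  exact: LcdW.
have {}ab2 := ltW ab2.
have z1 y : a' <= y -> ip (fun w => c w * dW a a' i w) (fun w => c' w * dW a' y i w) = 0.
  by move=> ay; apply: ip_dW0 => //; [exact: FcdW|exact: LcdW].
have zz y : a' <= y -> ip (fun w => c w * dW a' y i w) (fun w => c' w * dW a' y i w) =
    K i i * (y - a') * ip c c'.
  by move=> ay; apply: ip_dWdW => //; exact: (Ft_mono hF a0 aa).
have [bb|/ltW bb] := leP b b'.
  rewrite (cdW_split i c a a' b) (cdW_split i c' a' b b').
  rewrite ipDl; [|exact: LcdW|exact: LcdW|by apply: L2D; exact: LcdW'].
  rewrite !ipDr; do ?[exact: LcdW|exact: LcdW'].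
  rewrite z1// zz// (_ : ip (fun w => c w * dW a' b i w) (fun w => c' w * dW b b' i w) = 0).
    rewrite (_ : ip (fun w => c w * dW a a' i w) (fun w => c' w * dW b b' i w) = 0).
      ring.
    apply: ip_dW0 => //; [exact: le_trans ab2| exact: FcdW| |exact: LcdW].
    exact: (Ft_mono hF a0' ab2).
  apply: ip_dW0 => //; [exact: le_trans ab2| exact: FcdW| |exact: LcdW].
  exact: (Ft_mono hF a0' ab2).
have ab3 := le_trans aa ab'.
rewrite (cdW_split i c a a' b) ipDl; [|exact: LcdW|exact: LcdW|exact: LcdW'].
rewrite (cdW_split i c a' b' b) ipDl; [|exact: LcdW|exact: LcdW|exact: LcdW'].
rewrite z1// zz// (_ : ip (fun w => c w * dW b' b i w) (fun w => c' w * dW a' b' i w) = 0).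
  ring.
rewrite ipC; apply: ip_dW0 => //; [exact: le_trans ab'| exact: FcdW'| |exact: LcdW'].
exact: (Ft_mono hF a0 ab3).
Qed.

Lemma elem_isometry i e e' :
  ip (elI i e) (elI i e') = K i i * sqip (leb \x Pr)%E (elV e) (elV e').
Proof.
have [aa|/ltW aa] := leP (el_a e) (el_a e'); first exact: iso_le.
by rewrite ipC iso_le// ipC.
Qed.

Definition ito_family i (F : seq elem) (w : Omega) : R := \sum_(e <- F) elI i e w.
Definition famV (F : seq elem) (z : R * Omega) : R := \sum_(e <- F) elV e z.

Lemma famI_L2 i F : L2 (ito_family i F).
Proof. by apply: L2_sum => e; exact: elI_L2. Qed.

Lemma famV_L2 F : sqint (leb \x Pr)%E (famV F).
Proof. by apply: L2_sum => e; exact: elV_L2. Qed.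

Lemma fam_isometry i F :
  n2 (ito_family i F) = K i i * sqnorm (leb \x Pr)%E (famV F).
Proof.
rewrite !n2_ip ip_suml; [|by move=> e; exact: elI_L2|exact: famI_L2].
rewrite ip_suml; [|by move=> e; exact: elV_L2|exact: famV_L2].
rewrite mulr_sumr; apply: eq_bigr => e _.
rewrite ip_sumr; [|by move=> e'; exact: elI_L2|exact: elI_L2].
rewrite ip_sumr; [|by move=> e'; exact: elV_L2|exact: elV_L2].
by rewrite mulr_sumr; apply: eq_bigr => e' _; exact: elem_isometry.
Qed.

End Elementary.

(** * Stability of F_t-measurability under limits *)

Section FtClosed.
Context {R : realType} {d : measure_display} {Omega : measurableType d}.
Variables (Pr : probability Omega R) (Ft : R -> set_system Omega).
Hypothesis hF : usual_filtration Pr Ft.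
Local Notation L2 := (sqint Pr).
Local Notation n2 := (sqnorm Pr).

Lemma cvge0_lt (u : nat -> \bar R) (e : R) : 0 < e -> u @ \oo --> 0%E ->
  \forall n \near \oo, (u n < e%:E)%E.
Proof.
move=> e0 /fine_cvgP[uf /cvgrPdist_lt/(_ e e0) h]; near=> n.
have un : u n \is a fin_num by near: n.
have : `|0 - (fine \o u) n| < e by near: n.
rewrite sub0r normrN /= => h2; rewrite -(fineK un) lte_fin.
exact: le_lt_trans (ler_norm _) h2.
Unshelve. all: by end_near. Qed.

Lemma Ft_negl t E : 0 <= t -> Pr.-negligible E -> Ft t E.
Proof. by case: hF => _ _ _ _ h t0; exact: h. Qed.

(** Rests on the completeness of the filtration: every subset of the exceptional null set belongs to
    F_t. *)
Lemma mwrt_ae t (X Y : Omega -> R) : 0 <= t -> {ae Pr, forall w, X w = Y w} ->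
  measurable_wrt (Ft t) X -> measurable_wrt (Ft t) Y.
Proof.
move=> t0 XY FX A mA; have sF := Ft_sigma hF t0.
pose N := [set w | ~ (X w = Y w)].
have hN E : E `<=` N -> Ft t E.
  by move=> EN; apply: (Ft_negl t0); exact: negligibleS EN XY.
rewrite -(sigma_algebra_id sF).
have -> : Y @^-1` A = (X @^-1` A `\` N) `|` (Y @^-1` A `&` N).
  apply/seteqP; split => w /=; rewrite /N/=.
    by move=> YA; have [e|ne] := pselect (X w = Y w); [left; split; rewrite ?e//|right].
  by move=> [[XA /contrapT <-]//|[]].
have mF : forall B, Ft t B -> d.-measurable B by case: hF => _ h _ _ _; exact: h.
apply: (@measurableU _ (g_sigma_algebraType (Ft t))).
  apply: (@measurableD _ (g_sigma_algebraType (Ft t))).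
    by apply: sub_sigma_algebra; exact: FX.
  by apply: sub_sigma_algebra; exact: hN.
by apply: sub_sigma_algebra; apply: hN => w [].
Qed.

Lemma mwrt_ae_lim t (X : Omega -> R) (Y : nat -> Omega -> R) : 0 <= t ->
  (forall n, measurable_wrt (Ft t) (Y n)) ->
  {ae Pr, forall w, Y^~ w @ \oo --> X w} -> measurable_wrt (Ft t) X.
Proof.
move=> t0 FY cY; have sF := Ft_sigma hF t0.
pose N := [set w | ~ (Y^~ w @ \oo --> X w)].
pose X' w := \1_(~` N) w * X w.
apply: (mwrt_ae t0 (X := X')).
  apply: filterS cY => w cYw; have nN : (~` N) w by move=> /(_ cYw).
  by rewrite /X' indicE mem_set ?mul1r.
have FN : measurable_wrt (Ft t) (\1_(~` N) : Omega -> R).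
  apply/mwrtP => //; apply: (@measurable_indic _ (g_sigma_algebraType (Ft t))).
  apply: (@measurableC _ (g_sigma_algebraType (Ft t))).
  by apply: sub_sigma_algebra; exact: Ft_negl.
apply/mwrtP => //.
apply: (@measurable_fun_cvg _ (g_sigma_algebraType (Ft t)) _ _
  (fun n w => \1_(~` N) w * Y n w)).
  by move=> n; apply/mwrtP => //; exact: mwrtM.
move=> w _; rewrite /X' indicE.
have [wN|wN] := boolP (w \in ~` N).
  rewrite mul1r; under eq_fun do rewrite mul1r.
  by move: wN; rewrite inE /N/= => /contrapT.
by rewrite mul0r; under eq_fun do rewrite mul0r; exact: cvg_cst.
Qed.

(** Approximations with squared errors at most 2^-(n+1) have an integrable sum of squared errors, so
    they converge almost surely, and F_t-measurability passes to almost sure limits. *)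
Lemma L2_closed_Ft t (X : Omega -> R) : 0 <= t -> L2 X ->
  (forall e, 0 < e -> exists Y, [/\ measurable_wrt (Ft t) Y, L2 Y &
     n2 (fun w => X w - Y w) <= e]) ->
  measurable_wrt (Ft t) X.
Proof.
move=> t0 LX h.
have /choice[Y hY] : forall n, exists Y, [/\ measurable_wrt (Ft t) Y, L2 Y &
     n2 (fun w => X w - Y w) <= 1 / (2 ^ n.+1)%:R].
  by move=> n; apply: h; rewrite divr_gt0// ltr0n expn_gt0.
have FY n : measurable_wrt (Ft t) (Y n) by case: (hY n).
apply: (mwrt_ae_lim t0 FY).
have LXY n : L2 (fun w => X w - Y n w) by apply: L2B => //; case: (hY n).
pose f n w : \bar R := ((X w - Y n w) ^+ 2)%:E.
have mf n : measurable_fun setT (f n).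
  by apply/measurable_EFinP; apply: measurable_funX; case: (LXY n).
have f0 n w : (0 <= f n w)%E by rewrite lee_fin sqr_ge0.
have mS : measurable_fun setT (fun w => \sum_(n <oo) f n w)%E.
  by apply: ge0_emeasurable_sum.
have intS : (\int[Pr]_w (\sum_(n <oo) f n w) < +oo)%E.
  rewrite integral_nneseries//; apply: (@le_lt_trans _ _ 1%E); last exact: ltry.
  apply: le_trans (epsilon_trick0 xpredT ler01).
  apply: lee_nneseries => n _; first by move=> _; exact: integral_ge0.
  by rewrite n2E// lee_fin; case: (hY n).
have iS : Pr.-integrable setT (fun w => \sum_(n <oo) f n w)%E.
  apply/integrableP; split => //.
  rewrite (eq_integral (fun w => \sum_(n <oo) f n w)%E)// => w _.
  by rewrite gee0_abs//; exact: nneseries_ge0.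
apply: filterS (integrable_ae measurableT iS) => w /(_ I) Sw.
have cs : cvgn (series (fun n => (X w - Y n w) ^+ 2)).
  apply: nondecreasing_is_cvgn.
    apply/nondecreasing_seqP => n; rewrite seriesSr// lerDl sqr_ge0//.
  exists (fine (\sum_(n <oo) f n w)%E) => _ [n _ <-].
  rewrite -lee_fin fineK// /series/= -sumEFin.
  by apply: nneseries_lim_ge => k _ _; exact: f0.
have /cvgrPdist_lt c0 := cvg_series_cvg_0 cs.
apply/cvgrPdist_lt => e e0; have e20 : 0 < e ^+ 2 by rewrite exprn_gt0.
near=> n.
have : `|0 - (X w - Y n w) ^+ 2| < e ^+ 2 by near: n; exact: c0.
rewrite sub0r normrN normrX ltr_pXn2r// nnegrE//; exact: ltW.
Unshelve. all: by end_near. Qed.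

End FtClosed.

(** * Processes as functions on the product of time and chance *)

Section Processes.
Context {R : realType} {d : measure_display} {Omega : measurableType d}.
Variable Pr : probability Omega R.
Local Notation leb := (@lebesgue_measure R).
Implicit Types (J : set R) (f : R -> Omega -> R).

(** Extension by zero puts processes on different time sets into one and the same space of
    square-integrable functions. *)
Definition rs J f : measurableTypeR R * Omega -> R := fun z => \1_J z.1 * f z.1 z.2.

Lemma rs_meas J f : measurable J ->
  measurable_fun (J `*` [set: Omega]) (fun z : R * Omega => f z.1 z.2) ->
  measurable_fun [set: measurableTypeR R * Omega] (rs J f).
Proof.
move=> mJ mf; have mJT : measurable (J `*` [set: Omega]) by exact: measurableX.
have /(measurable_restrict _ mJT measurableT) : measurable_fun
  ([set: R * Omega] `&` (J `*` [set: Omega])) (fun z : R * Omega => f z.1 z.2).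
  by rewrite setTI.
apply: eq_measurable_fun => -[s w] _; rewrite /rs /= /patch indicE /=.
have [sJ|sJ] := boolP (s \in J).
  by rewrite mul1r mem_set//=; split => //; rewrite inE in sJ.
rewrite mul0r; case: ifPn => //; rewrite inE /= => -[sJ' _].
by rewrite notin_setE in sJ.
Qed.

Lemma rs_iter J f : measurable J ->
  measurable_fun (J `*` [set: Omega]) (fun z : R * Omega => f z.1 z.2) ->
  (\int[(leb \x Pr)]_z (rs J f z ^+ 2)%:E =
   \int[Pr]_w \int[leb]_(s in J) (f s w ^+ 2)%:E)%E.
Proof.
move=> mJ mf; rewrite fubini_tonelli2/=; last 2 first.
- by apply/measurable_EFinP; apply: measurable_funX; exact: rs_meas.
- by move=> z; rewrite lee_fin sqr_ge0.
apply: eq_integral => w _; rewrite [RHS]integral_mkcond; apply: eq_integral => s _.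
rewrite /rs /patch indicE/=; case: (s \in J); rewrite ?mul1r ?mul0r//.
by rewrite expr0n.
Qed.

End Processes.

(** * Ito integrals as limits of elementary ones *)

Section ItoPairs.
Context {R : realType} {d : measure_display} {Omega : measurableType d}.
Variables (Pr : probability Omega R) (Ft : R -> set_system Omega) (q : nat)
  (K : 'M[R]_q) (W : R -> Omega -> 'cV[R]_q).
Hypotheses (hF : usual_filtration Pr Ft) (hW : wiener Pr Ft K W).
Local Notation leb := (@lebesgue_measure R).
Local Notation L2 := (sqint Pr).
Local Notation n2 := (sqnorm Pr).
Local Notation L2p := (sqint (leb \x Pr)%E).
Local Notation n2p := (sqnorm (leb \x Pr)%E).
Local Notation elem := (elem Pr Ft).
Local Notation famI := (ito_family W).

(* Stands for "[Z] is the Ito integral of [V]": stability under differences and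
   the bound [ito_pair_le] are all that is used of the isometry. *)
Definition ito_pair i (Z : Omega -> R) (V : measurableTypeR R * Omega -> R) : Prop :=
  [/\ L2 Z, L2p V & forall e : R, 0 < e -> exists F : seq elem,
    n2 (fun w => Z w - famI i F w) <= e /\ n2p (fun z => V z - famV F z) <= e].

Lemma ito_pair_fam i (F : seq elem) : ito_pair i (famI i F) (famV F).
Proof.
split; [exact: famI_L2 hF hW _ _|exact: famV_L2|move=> e e0].
exists F; split.
- rewrite (_ : (fun _ => _) = fun=> 0) ?n20 ?ltW//.
  by apply/funext => w; rewrite subrr.
- rewrite (_ : (fun _ => _) = fun=> 0) ?n20 ?ltW//.
  by apply/funext => w; rewrite subrr.
Qed.

Definition elN (e : elem) : elem :=
  @Elem _ _ _ _ _ (fun w => - 1 * el_c e w) (el_a e) (el_b e) (el_a0 e) (el_ab e)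
   (mwrtZ (-1) (Ft_sigma hF (el_a0 e)) (@el_Ft _ _ _ _ _ e))
   (L2Z (-1) (el_L2 e)).

Lemma famI_B i F F' w : famI i (F ++ [seq elN e | e <- F']) w = famI i F w - famI i F' w.
Proof.
rewrite /ito_family big_cat/= big_map -sumrN; congr (_ + _).
by apply: eq_bigr => e _; rewrite /elI/=; ring.
Qed.

Lemma famV_B F F' z : famV (F ++ [seq elN e | e <- F']) z = famV F z - famV F' z.
Proof.
rewrite /famV big_cat/= big_map -sumrN; congr (_ + _).
by apply: eq_bigr => e _; rewrite /elV/=; ring.
Qed.

Lemma ito_pairB i Z V Z' V' : ito_pair i Z V -> ito_pair i Z' V' ->
  ito_pair i (fun w => Z w - Z' w) (fun z => V z - V' z).
Proof.
move=> [LZ LV h] [LZ' LV' h']; split; [exact: L2B|exact: L2B|move=> e e0].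
have e4 : 0 < e / 4 by rewrite divr_gt0.
have [F [F1 F2]] := h _ e4; have [F' [F1' F2']] := h' _ e4.
exists (F ++ [seq elN e | e <- F']); split.
- rewrite (_ : (fun _ => _) = fun w => (Z w - famI i F w) - (Z' w - famI i F' w)).
    have LL (G : seq elem) Y : L2 Y -> L2 (fun w => Y w - famI i G w).
      by move=> LY; apply: L2B => //; exact: (famI_L2 hF hW).
    have := n2B_le (LL F _ LZ) (LL F' _ LZ'); lra.
  by apply/funext => w; rewrite famI_B; ring.
- rewrite (_ : (fun _ => _) = fun w => (V w - famV F w) - (V' w - famV F' w)).
    have LL (G : seq elem) Y : L2p Y -> L2p (fun w => Y w - famV G w).
      by move=> LY; apply: L2B => //; exact: famV_L2.
    have := n2B_le (LL F _ LV) (LL F' _ LV'); lra.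
  by apply/funext => w; rewrite famV_B; ring.
Qed.

(** The exact isometry has the factor 1. The 4 comes from using the inequality for the square of a
    sum twice, and it enters only constants that are multiplied by h later. *)
Lemma ito_pair_le i Z V : ito_pair i Z V -> n2 Z <= 4 * K i i * n2p V.
Proof.
move=> [LZ LV h]; have K0 := K_diag_ge0 hW i.
apply/ler_addgt0Pl => e e0.
(* An approximation error e' contributes 2 e' directly and 4 K i i e' through the integrand; this
   choice makes the total equal to [e]. *)
have e1 : 0 < e / (2 + 4 * K i i) by rewrite divr_gt0//; nra.
have [F [F1 F2]] := h _ e1.
have LI : L2 (famI i F) := famI_L2 hF hW i F.
have LF : L2p (famV F) := famV_L2 F.
have := n2D_le (L2B LZ LI) LI.
rewrite (_ : (fun _ => _) = Z); last by apply/funext => w; rewrite subrK.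
rewrite (fam_isometry hF hW).
have := n2B_le LV (L2B LV LF).
rewrite (_ : (fun _ => V _ - _) = famV F); last by apply/funext => z; ring.
set A := n2p (famV F) => h1 h2.
have -> : e = 2 * (e / (2 + 4 * K i i)) + 4 * K i i * (e / (2 + 4 * K i i)).
  by field; apply: lt0r_neq0; lra.
set e' := e / _ in e1 F1 F2 *.
have : K i i * A <= K i i * (2 * n2p V + 2 * e'). apply: ler_wpM2l => //. lra.
nra.
Qed.

Lemma simple_fam (H : @simple_process R d Omega) t : simple_adapted Ft H -> 0 <= t ->
  exists F : seq elem, [/\
    forall i w, famI i F w = simple_integral (fun s w => W s w i 0) H t w,
    (forall z, famV F z = \1_(`[0, t]) z.1 * simple_eval H z.1 z.2) &
    forall i, measurable_wrt (Ft t) (famI i F)].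
Proof.
move=> [H0 hH] t0.
have time0 j : (j <= sp_len H)%N -> 0 <= sp_time H j.
  elim: j => // j ih jl; apply: le_trans (ih (ltnW jl)) _.
  by have [] := hH j jl.
(* All times are capped at [t]. A coefficient that starts at or after [t] is not known at time [t],
   so it is replaced by 0; its capped interval is empty, and neither the integral nor the process
   changes. *)
have /choice[mk hmk] : forall j : 'I_(sp_len H), exists e : elem,
   [/\ el_a e = Num.min t (sp_time H j), el_b e = Num.min t (sp_time H j.+1) &
     el_c e = if sp_time H j < t then sp_coef H j else fun=> 0].
  move=> j; have [jj Fj [c hc]] := hH j (ltn_ord j).
  have a0 : 0 <= Num.min t (sp_time H j) by rewrite le_min t0 time0// ltnW.
  have ab : Num.min t (sp_time H j) <= Num.min t (sp_time H j.+1).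
    by rewrite le_min ge_min lexx/= ge_min jj orbT.
  have Fc : measurable_wrt (Ft (Num.min t (sp_time H j)))
      (if sp_time H j < t then sp_coef H j else fun=> 0).
    case: ltP => h; last by apply: mwrt_cst; exact: Ft_sigma hF _ _.
    exact: Fj.
  have Lc : L2 (if sp_time H j < t then sp_coef H j else fun=> 0).
    case: ifP => _; last exact: L2_0.
    have mc : measurable_fun setT (sp_coef H j).
      by apply: (Ft_meas hF _ Fj); exact/time0/ltnW.
    split => //; apply: (@le_lt_trans _ _ (\int[Pr]_w (c ^+ 2)%:E)%E).
      apply: ge0_le_integral => //.
      - by move=> w _; rewrite lee_fin sqr_ge0.
      - by apply/measurable_EFinP; exact: measurable_funX.
      - move=> w _; rewrite lee_fin -(real_normK (num_real (sp_coef H j w))).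
        by rewrite ler_pXn2r ?nnegrE//; exact: le_trans (hc w).
    rewrite integral_cst//.
    by have /= -> := @probability_setT _ _ _ Pr; rewrite mule1 ltry.
  by exists (Elem a0 ab Fc Lc).
exists [seq mk j | j <- enum 'I_(sp_len H)]; split.
- move=> i w; rewrite /ito_family big_map big_enum/=; apply: eq_bigr => j _.
  rewrite /elI; have [-> -> ->] := hmk j; rewrite /increment.
  have [jj _ _] := hH j (ltn_ord j).
  case: ltP => // tj; rewrite mul0r (min_l (le_trans tj jj)).
  by rewrite subrr mulr0.
- move=> [s w]; rewrite /famV big_map big_enum/= /simple_eval mulr_sumr.
  apply: eq_bigr => j _; rewrite /elV; have [-> -> ->] := hmk j.
  have tj0 : 0 <= sp_time H j by apply/time0/ltnW.
  rewrite /ioc indicE mem_setE in_itv/=.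
  case: (ltP (sp_time H j) t) => tj.
    rewrite le_min [RHS]mulrCA mulrC -natrM mulnb; congr (_ * _%:R).
    case: (ltP (sp_time H j) s) => js; rewrite ?andbF//=.
    by rewrite (le_trans tj0 (ltW js)).
  rewrite mulr0; case: (leP s t) => st; rewrite ?andbF ?mul0r//.
  by rewrite (ltNge _ s) (le_trans st tj)/= !mulr0.
- move=> i; rewrite /ito_family; under eq_fun do rewrite big_map.
  apply: mwrt_sum; first exact: Ft_sigma hF _ t0.
  move=> j; have [_ bj _] := hmk j.
  apply: (Ft_mono hF (s := el_b (mk j))); last exact: (elI_Ft hF hW).
    exact: le_trans (el_a0 (mk j)) (el_ab (mk j)).
  by rewrite bj ge_min lexx.
Qed.

(** [ito_integral] makes [Z] measurable for the full sigma-algebra only. Its F_t-measurability, on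
    which the adaptedness of the integrated input rests, is inherited from the simple integrals in
    the limit. *)
Lemma ito_integral_pair (i : 'I_q) (v : R -> Omega -> R) (t : R) (Z : Omega -> R) : 0 <= t ->
  measurable_fun (`[0, t] `*` [set: Omega]) (fun z : R * Omega => v z.1 z.2) ->
  L2p (rs `[0, t] v) ->
  ito_integral Pr Ft (fun s w => W s w i 0) v t Z ->
  ito_pair i Z (rs `[0, t] v) /\ measurable_wrt (Ft t) Z.
Proof.
move=> t0 mv Lv [mZ [H [hH cV cI]]].
have /choice[F hFH] := fun k => simple_fam (hH k) t0.
have mtO : measurable (`[0, t] : set R) by [].
have approx e : 0 < e -> exists k, [/\ L2 Z,
    n2 (fun w => Z w - famI i (F k) w) <= e &
    n2p (fun z => rs `[0, t] v z - famV (F k) z) <= e].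
  move=> e0.
  have c1 := cvge0_lt e0 cV; have c2 := cvge0_lt e0 cI.
  have [k [k1 k2]] : exists k,
      (\int[Pr]_w \int[leb]_(s in `[0%R, t]) ((simple_eval (H k) s w - v s w) ^+ 2)%:E < e%:E)%E /\
      (\int[Pr]_w ((simple_integral (fun s w => W s w i 0) (H k) t w - Z w) ^+ 2)%:E < e%:E)%E.
    near \oo => k; exists k; split; near: k; [exact: c1|exact: c2].
  exists k; have [FI FV _] := hFH k.
  have LI : L2 (famI i (F k)) := famI_L2 hF hW i (F k).
  have EI : (fun w => simple_integral (fun s w => W s w i 0) (H k) t w - Z w) =
      (fun w => famI i (F k) w - Z w) by apply/funext => w; rewrite FI.
  have [LIZ nIZ] : L2 (fun w => famI i (F k) w - Z w) /\
      n2 (fun w => famI i (F k) w - Z w) <= e.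
    apply: L2_le; first by apply: measurable_funB => //; case: LI.
    by under eq_integral do rewrite FI; exact: ltW.
  split.
  - have := L2B LI LIZ; rewrite (_ : (fun _ => _) = Z)//.
    by apply/funext => w; ring.
  - by rewrite -n2N; under eq_fun do rewrite opprB.
  - have Lev := famV_L2 (F k).
    have E z : \1_(`[0, t]) z.1 * (simple_eval (H k) z.1 z.2 - v z.1 z.2) =
        famV (F k) z - rs `[0, t] v z by rewrite FV mulrBr.
    have := n2E (L2B Lev Lv).
    rewrite -n2N -lee_fin; under [X in n2p X]eq_fun do rewrite opprB.
    move=> <-; rewrite fubini_tonelli2/=; last 2 first.
    + by apply/measurable_EFinP; apply: measurable_funX; case: (L2B Lev Lv).
    + by move=> z; rewrite lee_fin sqr_ge0.
    apply: le_trans (ltW k1); rewrite le_eqVlt; apply/orP; left; apply/eqP.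
    apply: eq_integral => w _; rewrite [RHS]integral_mkcond.
    apply: eq_integral => s _; rewrite -E /patch indicE/=.
    by case: (s \in _); rewrite ?mul1r ?mul0r// expr0n.
have LZ : L2 Z by have [k []] := approx 1 ltr01.
split.
  split => // e e0; have [k [_ k1 k2]] := approx e e0.
  by exists (F k).
apply: (L2_closed_Ft hF t0 LZ) => e e0; have [k [_ k1 k2]] := approx e e0.
exists (famI i (F k)); split => //; first by have [_ _] := hFH k; exact.
exact: famI_L2 hF hW _ _.
Unshelve. all: by end_near. Qed.

End ItoPairs.

(** * Time integrals, grids and solutions *)

Section IpMore.
Context d (T : measurableType d) (R : realType) (mu : {measure set T -> \bar R}).

Lemma ip_sqr_le (f g : T -> R) c : 0 < c -> sqint mu f -> sqint mu g -> sqnorm mu g <= c ->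
  sqip mu f g ^+ 2 <= c * sqnorm mu f.
Proof.
move=> c0 Lf Lg gc; set p := sqip mu f g.
(* Cauchy-Schwarz by projection; dividing by the bound [c] instead of the norm of [g] covers the
   case of a vanishing [g]. *)
have := n2_ge0 mu (fun x => f x - (p / c) * g x).
rewrite n2B//; last exact: L2Z.
rewrite ipZr// n2Z// -/p => h.
have h2 : (p / c) ^+ 2 * sqnorm mu g <= (p / c) ^+ 2 * c.
  by rewrite ler_wpM2l// sqr_ge0.
have h3 : c * (sqnorm mu f - 2 * (p / c * p) + (p / c) ^+ 2 * c) >= 0.
  apply: mulr_ge0; first exact: ltW.
  by apply: le_trans h _; rewrite lerD2l.
have <- : c * (sqnorm mu f - 2 * (p / c * p) + (p / c) ^+ 2 * c) + p ^+ 2 = c * sqnorm mu f.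
  by field; rewrite gt_eqF.
by rewrite lerDr.
Qed.

Lemma n2_disjoint (I : finType) (F : I -> T -> R) : (forall i, sqint mu (F i)) ->
  (forall i j x, i != j -> F i x * F j x = 0) ->
  sqnorm mu (fun x => \sum_i F i x) = \sum_i sqnorm mu (F i).
Proof.
move=> LF dF; rewrite n2_ip ip_suml//; last exact: L2_sum.
apply: eq_bigr => i _; rewrite ip_sumr// (bigD1 i)//= -n2_ip big1 ?addr0// => j ji.
have ij : i != j by rewrite eq_sym.
by rewrite /sqip; under eq_Rintegral do rewrite (dF _ _ _ ij); rewrite /Rintegral integral0.
Qed.

End IpMore.

Section RowSquare.
Context {R : realType}.

Definition rowsq (n m : nat) (Q : 'M[R]_(n, m)) l : R := \sum_k Q l k ^+ 2.

Lemma rowsq_ge0 (n m : nat) (Q : 'M[R]_(n, m)) l : 0 <= rowsq Q l.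
Proof. by apply: sumr_ge0 => k _; exact: sqr_ge0. Qed.

Lemma n2_lincomb d (T : measurableType d) (mu : {measure set T -> \bar R}) (n m : nat)
    (Q : 'M[R]_(n, m)) l (D : 'I_m -> T -> R) : (forall k, sqint mu (D k)) ->
  sqnorm mu (fun z => \sum_k Q l k * D k z) <= m%:R * rowsq Q l * \sum_k sqnorm mu (D k).
Proof.
move=> LD; apply: le_trans (n2_sum_le _) _; first by move=> k; exact: L2Z.
rewrite card_ord -mulrA ler_wpM2l// mulr_sumr; apply: ler_sum => k _.
rewrite n2Z// ler_wpM2r ?n2_ge0// /rowsq (bigD1 k)//= lerDl.
by apply: sumr_ge0 => j _; exact: sqr_ge0.
Qed.

End RowSquare.

Section TimeIntegral.
Context {R : realType} {d : measure_display} {Omega : measurableType d}.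
Variable Pr : probability Omega R.
Local Notation leb := (@lebesgue_measure R).
Local Notation L2 := (sqint Pr).
Local Notation n2 := (sqnorm Pr).
Local Notation L2p := (sqint (leb \x Pr)%E).
Local Notation n2p := (sqnorm (leb \x Pr)%E).
Implicit Types V : measurableTypeR R * Omega -> R.

Definition tint V (w : Omega) : R := \int[leb]_s V (s, w).

Lemma ioc_n2 (a b : R) : a <= b -> sqnorm leb (ioc a b) = b - a.
Proof.
move=> ab; rewrite n2_ip ip_ioc// lexx; case: ifP => // ba.
by apply/esym/eqP; rewrite subr_eq0 eq_le ba ab.
Qed.

Lemma L2_cst c : L2 (fun=> c).
Proof.
split => //; rewrite integral_cst//.
by have /= -> := @probability_setT _ _ _ Pr; rewrite mule1 ltry.
Qed.

(** Support in ]a, b], written as a factorisation: a product with a square-integrable indicator is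
    integrable, and the Cauchy-Schwarz inequality applies to it directly. *)
Definition tsupp (a b : R) V := forall z, V z = V z * ioc a b z.1.

Lemma tsupp_int a b V : L2p V -> tsupp a b V ->
  (leb \x Pr)%E.-integrable setT (EFin \o V).
Proof.
move=> LV sV; have := L2_mul_int LV (L2_tensor (ioc_L2 a b) (L2_cst 1)).
by rewrite (_ : (fun x => _) = V)//; apply/funext => z; rewrite mulr1 -sV.
Qed.

Lemma tint_meas a b V : L2p V -> tsupp a b V -> measurable_fun setT (tint V).
Proof.
move=> LV sV; have := measurable_fubini_G (tsupp_int LV sV).
by move=> h; apply: (measurableT_comp _ h).
Qed.

(** Cauchy-Schwarz on each path, then Tonelli. The factor b - a makes the integral of the control
    over a cell of length h small. *)
Lemma tint_L2 a b V : a < b -> L2p V -> tsupp a b V ->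
  L2 (tint V) /\ n2 (tint V) <= (b - a) * n2p V.
Proof.
move=> ab LV sV; have mV : measurable_fun setT V by case: LV.
have ba0 : 0 < b - a by rewrite subr_gt0.
apply: L2_le; first exact: tint_meas LV sV.
rewrite EFinM -n2E// fubini_tonelli2/=; last 2 first.
- by apply/measurable_EFinP; exact: measurable_funX.
- by move=> z; rewrite lee_fin sqr_ge0.
have mS : measurable_fun setT (fubini_G leb (fun z : measurableTypeR R * Omega => (V z ^+ 2)%:E)).
  apply: measurable_fun_fubini_tonelli_G; first by apply/measurable_EFinP; exact: measurable_funX.
  by move=> z; rewrite lee_fin sqr_ge0.
rewrite -ge0_integralZl//=; last 2 first.
- by move=> w _; apply: integral_ge0 => s _; rewrite lee_fin sqr_ge0.
- by rewrite lee_fin ltW.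
apply: ge0_le_integral => //.
- by move=> w _; rewrite lee_fin sqr_ge0.
- apply/measurable_EFinP; apply: measurable_funX; exact: tint_meas LV sV.
- apply: emeasurable_funM => //; exact: measurable_cst.
move=> w _; have mVw : measurable_fun [set: measurableTypeR R] (fun s => V (s, w)).
  by apply: measurableT_comp => //; exact: measurable_pair2.
rewrite /fubini_G /=.
(* On a path whose square integral is infinite the bound is trivial. *)
have [fin|] := ltP (\int[leb]_x ((V (x, w)) ^+ 2)%:E)%E +oo%E; last first.
  by rewrite leye_eq => /eqP ->; rewrite gt0_muley ?leey// lte_fin.
have Lv : sqint leb (fun s => V (s, w)) by split.
rewrite (n2E Lv) -EFinM lee_fin.
have -> : tint V w = sqip leb (fun s => V (s, w)) (ioc a b).
  by apply: eq_Rintegral => s _; rewrite {1}sV.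
by apply: ip_sqr_le => //; [exact: ioc_L2|rewrite ioc_n2// ltW].
Qed.

(** Additivity holds almost surely only: Fubini's theorem makes almost every path integrable, and on
    the others the integral has a default value. *)
Lemma tintD a b V V' : L2p V -> tsupp a b V -> L2p V' -> tsupp a b V' ->
  {ae Pr, forall w, tint (fun z => V z + V' z) w = tint V w + tint V' w}.
Proof.
move=> LV sV LV' sV'.
have := ae_integrable2 (tsupp_int LV sV); have := ae_integrable2 (tsupp_int LV' sV').
by apply: filterS2 => w h' h; rewrite /tint RintegralD.
Qed.

Lemma tintZ a b c V : L2p V -> tsupp a b V ->
  {ae Pr, forall w, tint (fun z => c * V z) w = c * tint V w}.
Proof.
move=> LV sV; have := ae_integrable2 (tsupp_int LV sV).
by apply: filterS => w h; rewrite /tint RintegralZl.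
Qed.

Lemma tsuppZ a b c V : tsupp a b V -> tsupp a b (fun z => c * V z).
Proof. by move=> sV z; rewrite {1}sV mulrA. Qed.

Lemma tsupp_sum a b (I : Type) (s : seq I) F : (forall i, tsupp a b (F i)) ->
  tsupp a b (fun z => \sum_(i <- s) F i z).
Proof.
by move=> sF z; rewrite mulr_suml; apply: eq_bigr => i _; rewrite {1}sF.
Qed.

Lemma tint_sum a b (I : Type) (s : seq I) F :
  (forall i, L2p (F i)) -> (forall i, tsupp a b (F i)) ->
  {ae Pr, forall w, tint (fun z => \sum_(i <- s) F i z) w = \sum_(i <- s) tint (F i) w}.
Proof.
move=> LF sF; elim: s => [|i s ih].
  apply: aeW => w; rewrite big_nil /tint.
  under eq_Rintegral do rewrite big_nil.
  by rewrite /Rintegral integral0.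
under [X in tint X]eq_fun do rewrite big_cons.
have := tintD (LF i) (sF i) (L2_sum s LF) (tsupp_sum s sF).
by move: ih; apply: filterS2 => w ih ->; rewrite big_cons ih.
Qed.

Lemma tint_tensor (a b : R) (c : Omega -> R) w : a <= b ->
  tint (fun z => ioc a b z.1 * c z.2) w = (b - a) * c w.
Proof.
move=> ab; rewrite /tint/= RintegralZr//; last first.
  have /= := L2_mul_int (ioc_L2 a b) (ioc_L2 a b).
  rewrite (_ : (fun x => _) = ioc a b)//; apply/funext => s.
  by rewrite /ioc -natrM mulnb andbb.
rewrite -(ioc_n2 ab) n2_ip; congr (_ * _); apply: eq_Rintegral => s _.
by rewrite /ioc -natrM mulnb andbb.
Qed.

Lemma n2p_tensor (a b : R) (c : Omega -> R) : a <= b -> L2 c ->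
  L2p (fun z => ioc a b z.1 * c z.2) /\
  n2p (fun z => ioc a b z.1 * c z.2) = (b - a) * n2 c.
Proof.
move=> ab Lc; split; first exact: (L2_tensor (ioc_L2 a b) Lc).
by rewrite n2_ip (ip_tensor (ioc_L2 a b) (ioc_L2 a b) Lc Lc) -!n2_ip ioc_n2.
Qed.

End TimeIntegral.

Section Restriction.
Context {R : realType} {d : measure_display} {Omega : measurableType d}.
Variables (Pr : probability Omega R) (Ft : R -> set_system Omega).
Local Notation leb := (@lebesgue_measure R).
Local Notation L2p := (sqint (leb \x Pr)%E).
Implicit Types f : R -> Omega -> R.

Lemma L2_dom d' (T' : measurableType d') (mu : {measure set T' -> \bar R})
    (f g : T' -> R) :
  measurable_fun setT f -> sqint mu g -> (forall x, f x ^+ 2 <= g x ^+ 2) ->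
  sqint mu f.
Proof.
move=> mf Lg fg; split => //; have [mg h] := Lg; apply: le_lt_trans h.
apply: ge0_le_integral => //.
- by move=> x _; rewrite lee_fin sqr_ge0.
- by apply/measurable_EFinP; exact: measurable_funX.
- by apply/measurable_EFinP; exact: measurable_funX.
- by move=> x _; rewrite lee_fin.
Qed.

Lemma enorm_sqr n (v : 'cV[R]_n) : enorm v ^+ 2 = \sum_i v i 0 ^+ 2.
Proof. by rewrite /enorm sqr_sqrtr// sumr_ge0// => i _; rewrite sqr_ge0. Qed.

Lemma L2process_enorm (J : set R) n (v : R -> Omega -> 'cV[R]_n) : measurable J ->
  L2process Pr Ft J v ->
  measurable_fun (J `*` [set: Omega]) (fun z : R * Omega => enorm (v z.1 z.2)) /\
  L2p (rs J (fun s w => enorm (v s w))).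
Proof.
move=> mJ [_ mv h].
have me : measurable_fun (J `*` [set: Omega]) (fun z : R * Omega => enorm (v z.1 z.2)).
  apply: (@measurableT_comp _ _ _ _ _ _ (@Num.sqrt R)); first by apply: continuous_measurable_fun; exact: sqrt_continuous.
  by apply: measurable_sum => i; apply: measurable_funX; exact: mv.
by split => //; split; [exact: rs_meas|rewrite rs_iter].
Qed.

Lemma L2process_coord (J : set R) n (v : R -> Omega -> 'cV[R]_n) l : measurable J ->
  L2process Pr Ft J v -> L2p (rs J (fun s w => v s w l 0)).
Proof.
move=> mJ hv; have [_ Le] := L2process_enorm mJ hv; have [_ mv _] := hv.
apply: L2_dom Le _; first by apply: rs_meas => //; exact: mv.
move=> z; rewrite /rs !exprMn enorm_sqr ler_wpM2l ?sqr_ge0//.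
by rewrite (bigD1 l)//= lerDl sumr_ge0// => i _; rewrite sqr_ge0.
Qed.

(** Half-open intervals, in contrast to the closed ones in the definition of a solution, make
    neighbouring cells disjoint, so that splitting an interval is an identity at every point. *)
Definition rI (a b : R) f := rs `]a, b] f.

Lemma rIE a b f z : rI a b f z = ioc a b z.1 * f z.1 z.2.
Proof. by rewrite /rI /rs ioc_indic. Qed.

Lemma ioc_cases (a b s : R) : ioc a b s = 0 \/ ioc a b s = 1 /\ a < s /\ s <= b.
Proof. rewrite /ioc; case: ltP => h1; case: leP => h2 /=; by [left|right]. Qed.

Lemma rI_L2 T a b f : 0 <= a -> b <= T -> L2p (rs `[0, T] f) -> L2p (rI a b f).
Proof.
move=> a0 bT Lf.
have E z : rI a b f z = ioc a b z.1 * rs `[0, T] f z.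
  rewrite rIE /rs; have [->|[-> [az zb]]] := ioc_cases a b z.1; first by rewrite !mul0r.
  by rewrite indicE mem_set ?mul1r//= in_itv/= (le_trans zb bT) (le_trans a0 (ltW az)).
apply: (L2_dom _ Lf).
  rewrite (_ : rI _ _ _ = fun z => ioc a b z.1 * rs `[0, T] f z); last by apply/funext.
  apply: measurable_funM; last by case: Lf.
  by apply: measurableT_comp => //; case: (ioc_L2 a b).
move=> z; rewrite E exprMn; have [->|[-> _]] := ioc_cases a b z.1.
  by rewrite expr0n mul0r sqr_ge0.
by rewrite expr1n mul1r.
Qed.

Lemma rI_supp a b a' b' f : a' <= a -> b <= b' -> tsupp a' b' (rI a b f).
Proof.
move=> aa bb z; rewrite rIE; have [->|[-> [az zb]]] := ioc_cases a b z.1.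
  by rewrite !mul0r.
by rewrite /ioc (le_lt_trans aa az) (le_trans zb bb) !mulr1.
Qed.

Lemma ioc_split (a b c s : R) : a <= b -> b <= c -> ioc a c s = ioc a b s + ioc b c s.
Proof.
move=> ab bc; rewrite /ioc; case: (ltP a s) => as_; case: (leP s b) => sb /=.
- by rewrite (le_trans sb bc) addr0.
- by rewrite add0r.
- by rewrite add0r.
- by move: (lt_le_trans sb as_); rewrite ltNge ab.
Qed.

Lemma rI_split a b c f z : a <= b -> b <= c -> rI a c f z = rI a b f z + rI b c f z.
Proof. by move=> ab bc; rewrite !rIE (ioc_split _ ab bc) mulrDl. Qed.

Lemma rI_mulmx a b n m (M : 'M[R]_(n, m)) (v : R -> Omega -> 'cV[R]_m) l :
  rI a b (fun s w => (M *m v s w) l 0) =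
  fun z => \sum_k M l k * rI a b (fun s w => v s w k 0) z.
Proof.
apply/funext => z; rewrite rIE mxE mulr_sumr; apply: eq_bigr => k _.
by rewrite rIE mulrCA.
Qed.

Lemma rs_mulmx J n m (M : 'M[R]_(n, m)) (v : R -> Omega -> 'cV[R]_m) l :
  rs J (fun s w => (M *m v s w) l 0) =
  fun z => \sum_k M l k * rs J (fun s w => v s w k 0) z.
Proof.
apply/funext => z; rewrite /rs mxE mulr_sumr; apply: eq_bigr => k _.
by rewrite mulrCA.
Qed.

Lemma rI_tint T t f : t <= T -> L2p (rs `[0, T] f) -> forall w,
  tint (rs `[0, t] f) w = tint (rI 0 t f) w.
Proof.
move=> tT Lf w; rewrite /tint /rI.
have E (J : set R) : (fun s => rs J f (s, w)) = ((fun s => f s w) \_ J).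
  by apply/funext => s; rewrite /rs patchE indicE/=; case: (s \in J); rewrite ?mul1r ?mul0r.
rewrite !E -!Rintegral_mkcond /Rintegral; congr fine; apply/esym.
apply: integral_itv_obnd_cbnd.
have [m _] := Lf.
have m2 : measurable_fun [set: measurableTypeR R] (fun s => rs `[0, T] f (s, w)).
  by apply: measurableT_comp => //; exact: measurable_pair2.
have m3 : measurable_fun (`]0, t] : set (measurableTypeR R)) (fun s => f s w).
  apply: eq_measurable_fun (measurable_funTS m2) => s; rewrite inE/= in_itv/= => /andP[s0 st].
  by rewrite /rs/= indicE mem_set ?mul1r//= in_itv/= (ltW s0) (le_trans st tT).
exact/measurable_EFinP.
Qed.

End Restriction.

Section Solutions.
Context {R : realType} {d : measure_display} {Omega : measurableType d}.
Variables (Pr : probability Omega R) (Ft : R -> set_system Omega) (q : nat)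
  (K : 'M[R]_q) (W : R -> Omega -> 'cV[R]_q).
Hypotheses (hF : usual_filtration Pr Ft) (hW : wiener Pr Ft K W).
Local Notation leb := (@lebesgue_measure R).
Local Notation L2 := (sqint Pr).
Local Notation n2 := (sqnorm Pr).
Local Notation L2p := (sqint (leb \x Pr)%E).
Local Notation n2p := (sqnorm (leb \x Pr)%E).

(** Elementary processes vanish up to time 0, since their intervals start at nonnegative times.
    Removing the instant 0 from the integrand therefore does not increase any approximation
    error. *)
Lemma ito_pair_rI i (Z : Omega -> R) (v : R -> Omega -> R) t T : t <= T ->
  L2p (rs `[0, T] v) -> ito_pair Pr Ft W i Z (rs `[0, t] v) ->
  ito_pair Pr Ft W i Z (rI 0 t v).
Proof.
move=> tT Lv [LZ LV h]; have LI := rI_L2 (lexx 0) tT Lv.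
split => // e e0; have [F [F1 F2]] := h e e0.
exists F; split => //; apply: le_trans F2; apply: n2_le.
- by apply: L2B => //; exact: famV_L2.
- by apply: L2B => //; exact: famV_L2.
move=> z; have [z0|z0] := leP z.1 0.
  have -> : famV F z = 0.
    rewrite /famV big1// => e1 _; rewrite /elV /ioc.
    by rewrite ltNge (le_trans z0 (el_a0 e1))/= mul0r.
  by rewrite rIE /ioc ltNge z0/= mul0r subr0 expr0n sqr_ge0.
by rewrite rIE /rs /ioc indicE mem_setE in_itv/= z0 (ltW z0).
Qed.

Section Solution.
Variables (T : R) (n : nat) (A : 'M[R]_n) (N : 'I_q -> 'M[R]_n)
  (f : R -> Omega -> 'cV[R]_n) (x : R -> Omega -> 'cV[R]_n).
Hypotheses (T0 : 0 < T) (hx : sde_solution Pr Ft W T A N f 0 x)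
  (hf : forall l, L2p (rs `[0, T] (fun s w => f s w l 0))).

Let dr l := fun s w => (A *m x s w + f s w) l 0.

Let mulmx_L2p m (M : 'M[R]_(m, n)) l : L2p (rs `[0, T] (fun s w => (M *m x s w) l 0)).
Proof.
rewrite rs_mulmx; apply: L2_sum => k; apply: L2Z.
by case: hx => hL _ _; exact: (L2process_coord k (measurable_itv _) hL).
Qed.

Let dr_L2p l : L2p (rs `[0, T] (dr l)).
Proof.
rewrite (_ : rs _ _ = fun z => rs `[0, T] (fun s w => (A *m x s w) l 0) z +
  rs `[0, T] (fun s w => f s w l 0) z); first exact: L2D.
by apply/funext => z; rewrite /rs /dr mxE mulrDr.
Qed.

Lemma sol_dec t : 0 <= t -> t <= T -> exists Z : 'I_q -> 'I_n -> Omega -> R,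
  [/\ forall i l, ito_pair Pr Ft W i (Z i l) (rI 0 t (fun s w => (N i *m x s w) l 0)),
      forall i l, measurable_wrt (Ft t) (Z i l) &
      forall l, {ae Pr, forall w, x t w l 0 = tint (rI 0 t (dr l)) w + \sum_i Z i l w}].
Proof.
move=> t0 tT; case: hx => hL _ /(_ t); rewrite t0 tT => /(_ isT)[Z [hZ hxt]].
have hp i l : ito_pair Pr Ft W i (fun w => Z i w l 0) (rs `[0, t] (fun s w => (N i *m x s w) l 0)) /\
    measurable_wrt (Ft t) (fun w => Z i w l 0).
  have [_ mx _] := hL.
  apply: (ito_integral_pair hF hW) => //.
    apply: (@eq_measurable_fun _ _ _ _ _ (fun z : R * Omega => \sum_k N i l k * x z.1 z.2 k 0)).
      by move=> z _; rewrite mxE.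
    apply: measurable_sum => k; apply: measurable_funM => //.
    apply: measurable_funS (mx k) => //; first exact: measurableX.
    move=> [s w] /= [+ _]; rewrite in_itv/= => /andP[s0 st]; split => //=.
    by rewrite in_itv/= s0 (le_trans st tT).
  rewrite rs_mulmx; apply: L2_sum => k; apply: L2Z.
  have Lk := L2process_coord k (measurable_itv _) hL.
  apply: L2_dom Lk _.
    apply: rs_meas => //; apply: measurable_funS (mx k) => //; first exact: measurableX.
    move=> [s w] /= [+ _]; rewrite in_itv/= => /andP[s0 st]; split => //=.
    by rewrite in_itv/= s0 (le_trans st tT).
  move=> z; rewrite /rs !indicE !mem_setE !in_itv/=.
  case: (leP 0 z.1) => z0; rewrite ?mul0r ?expr0n ?sqr_ge0//=.
  case: (leP z.1 t) => zt; rewrite ?mul0r ?expr0n ?sqr_ge0//=.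
  by rewrite (le_trans zt tT).
exists (fun i l w => Z i w l 0); split.
- by move=> i l; have [hi _] := hp i l; exact: ito_pair_rI tT (mulmx_L2p _ _) hi.
- by move=> i l; case: (hp i l).
move=> l; apply: filterS hxt => w ->.
rewrite !mxE add0r; congr (_ + _); last by rewrite summxE.
rewrite -(rI_tint tT (dr_L2p l)) /tint Rintegral_mkcond; apply: eq_Rintegral => s _.
by rewrite /rs patchE indicE/= /dr; case: (s \in _); rewrite ?mul1r ?mul0r.
Qed.

(** The common estimate behind three facts: a solution is square integrable at fixed times, its
    increments are controlled by the coefficients on the interval, and so is its distance to an
    Euler scheme. *)
Lemma sol_bound a b (X : Omega -> R) V (Z : 'I_q -> Omega -> R) Vi :
  measurable_fun setT X -> a < b -> L2p V -> tsupp a b V ->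
  (forall i, ito_pair Pr Ft W i (Z i) (Vi i)) ->
  {ae Pr, forall w, X w = tint V w + \sum_i Z i w} ->
  L2 X /\ n2 X <= 2 * ((b - a) * n2p V + q%:R * \sum_i 4 * K i i * n2p (Vi i)).
Proof.
move=> mX ab LV sV hZ hX; have [Lt nt] := tint_L2 ab LV sV.
have LZ i : L2 (Z i) by case: (hZ i).
have LS : L2 (fun w => \sum_i Z i w) by exact: L2_sum.
have XE : {ae Pr, forall w, tint V w + \sum_i Z i w = X w}.
  by apply: filterS hX => w ->.
have [LX ->] := L2_ae mX XE (L2D Lt LS); split=> //.
apply: le_trans (n2D_le Lt LS) _; rewrite mulrDr lerD// ler_pM2l//.
apply: le_trans (n2_sum_le LZ) _; rewrite card_ord ler_wpM2l//.
by apply: ler_sum => i _; exact: (ito_pair_le hF hW).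
Qed.

Lemma sol_Ft t l : 0 <= t -> t <= T -> measurable_wrt (Ft t) (fun w => x t w l 0).
Proof.
move=> t0 tT; case: hx => [[h _ _] _ _]; apply: h => //=.
by rewrite in_itv/= t0.
Qed.

Lemma sol_L2 t l : 0 <= t -> t <= T -> L2 (fun w => x t w l 0).
Proof.
move=> t0 tT; have [Z [hZ _ hx']] := sol_dec t0 tT.
apply: (proj1 (sol_bound (Ft_meas hF t0 (sol_Ft l t0 tT)) T0 _ _ (fun i => hZ i l) (hx' l))).
- exact: rI_L2 (dr_L2p l).
- exact: rI_supp.
Qed.

Lemma sol_incr s t l : 0 <= s -> s < t -> t <= T ->
  n2 (fun w => x t w l 0 - x s w l 0) <=
  2 * ((t - s) * n2p (rI s t (dr l)) +
    q%:R * \sum_i 4 * K i i * n2p (rI s t (fun s w => (N i *m x s w) l 0))).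
Proof.
move=> s0 st tT; have t0 := le_trans s0 (ltW st); have sT := le_trans (ltW st) tT.
have [Z [hZ _ hxt]] := sol_dec t0 tT; have [Z' [hZ' _ hxs]] := sol_dec s0 sT.
have E g : (fun z => rI 0 t g z - rI 0 s g z) = rI s t g.
  by apply/funext => z; rewrite (rI_split _ _ s0 (ltW st)) addrAC subrr add0r.
have LI a b g : L2p (rs `[0, T] g) -> 0 <= a -> b <= T -> L2p (rI a b g).
  by move=> Lg a0 bT; exact: rI_L2 Lg.
have hd : {ae Pr, forall w, tint (rI 0 t (dr l)) w = tint (rI 0 s (dr l)) w + tint (rI s t (dr l)) w}.
  have -> : rI 0 t (dr l) = fun z => rI 0 s (dr l) z + rI s t (dr l) z.
    by apply/funext => z; rewrite (rI_split _ _ s0 (ltW st)).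
  apply: (@tintD _ _ _ _ 0 T); [exact: LI|exact: rI_supp|exact: LI|exact: rI_supp].
apply: (proj2 (sol_bound (Z := fun i w => Z i l w - Z' i l w)
  (Vi := fun i => rI s t (fun s w => (N i *m x s w) l 0)) _ st _ _ _ _)).
- by apply: measurable_funB; [exact: (Ft_meas hF t0 (sol_Ft l t0 tT))|exact: (Ft_meas hF s0 (sol_Ft l s0 sT))].
- exact: LI.
- exact: rI_supp.
- by move=> i; rewrite -E; exact: (ito_pairB hF hW).
have := hxt l; have := hxs l; move: hd; apply: filterS3 => w -> -> ->.
rewrite sumrB; ring.
Qed.

End Solution.
End Solutions.

Section Grid.
Context {R : realType} {d : measure_display} {Omega : measurableType d}.
Variables (Pr : probability Omega R).
Local Notation leb := (@lebesgue_measure R).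
Local Notation L2 := (sqint Pr).
Local Notation n2 := (sqnorm Pr).
Local Notation L2p := (sqint (leb \x Pr)%E).
Local Notation n2p := (sqnorm (leb \x Pr)%E).

Definition cell (h : R) (k : nat) (s : R) : R := ioc (k%:R * h) (k.+1%:R * h) s.
Definition rC (h : R) (k : nat) (f : R -> Omega -> R) := rI (k%:R * h) (k.+1%:R * h) f.

Lemma cell_le (h : R) (k k' : nat) : 0 <= h -> (k <= k')%N -> k%:R * h <= k'%:R * h.
Proof. by move=> h0 kk; rewrite ler_wpM2r// ler_nat. Qed.

Lemma cell_disj (h : R) (k k' : nat) (s : R) : 0 <= h -> k != k' -> cell h k s * cell h k' s = 0.
Proof.
move=> h0; wlog kk : k k' / (k < k')%N.
  move=> H kk'; have := kk'; rewrite neq_ltn => /orP[kl|kl]; first exact: H.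
  by rewrite mulrC; apply: H => //; rewrite eq_sym.
move=> _; rewrite /cell /ioc -natrM mulnb; case: (leP s (k.+1%:R * h)) => sk; rewrite ?andbF//.
by rewrite (ltNge (k'%:R * h)) (le_trans sk (cell_le h0 kk))/= andbF.
Qed.

Lemma cell_sum (h : R) (M : nat) (s : R) : 0 <= h -> ioc 0 (M%:R * h) s = \sum_(k < M) cell h k s.
Proof.
move=> h0; elim: M => [|M ih].
  by rewrite big_ord0 mul0r /ioc; case: (ltP 0 s) => //= s0; rewrite leNgt s0.
rewrite big_ord_recr/= -ih; apply: ioc_split; last exact: cell_le.
by rewrite mulr_ge0.
Qed.

Lemma rC_E (h : R) (k : nat) f z : rC h k f z = cell h k z.1 * f z.1 z.2.
Proof. by rewrite /rC rIE. Qed.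

Lemma cell_tensor (h : R) (k : nat) (c : Omega -> R) : 0 <= h -> L2 c ->
  L2p (fun z => cell h k z.1 * c z.2) /\
  n2p (fun z => cell h k z.1 * c z.2) = h * n2 c.
Proof.
move=> h0 Lc; have := n2p_tensor (cell_le h0 (leqnSn k)) Lc.
by rewrite (_ : k.+1%:R * h - k%:R * h = h)//; rewrite -natr1; ring.
Qed.

Lemma rC_sum (h : R) (M : nat) f z : 0 <= h -> rI 0 (M%:R * h) f z = \sum_(k < M) rC h k f z.
Proof.
move=> h0; rewrite rIE (cell_sum _ _ h0) mulr_suml.
by apply: eq_bigr => k _; rewrite rC_E.
Qed.

Lemma rC_L2 (h T : R) (M k : nat) f : 0 <= h -> M%:R * h <= T -> (k < M)%N ->
  L2p (rs `[0, T] f) -> L2p (rC h k f).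
Proof.
move=> h0 MT kM; apply: rI_L2; first by rewrite mulr_ge0.
by apply: le_trans MT; exact: cell_le.
Qed.

Lemma n2p_rC_sum (h T : R) (M : nat) f : 0 <= h -> M%:R * h <= T ->
  L2p (rs `[0, T] f) -> \sum_(k < M) n2p (rC h k f) = n2p (rI 0 (M%:R * h) f).
Proof.
move=> h0 MT Lf; have -> : rI 0 (M%:R * h) f = fun z => \sum_(k < M) rC h k f z.
  by apply/funext => z; rewrite rC_sum.
rewrite n2_disjoint//; first by move=> k; exact: (rC_L2 h0 MT (ltn_ord k) Lf).
by move=> k k' z kk; rewrite !rC_E mulrACA cell_disj// mul0r.
Qed.

Lemma n2p_rI_le (a b T : R) f : 0 <= a -> b <= T -> L2p (rs `[0, T] f) ->
  n2p (rI a b f) <= n2p (rI 0 T f).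
Proof.
move=> a0 bT Lf; apply: n2_le; do ?exact: rI_L2 Lf.
move=> z; rewrite !rIE !exprMn ler_wpM2r ?sqr_ge0//.
have [->|[-> [az zb]]] := ioc_cases a b z.1; first by rewrite expr0n sqr_ge0.
by rewrite /ioc (le_lt_trans a0 az) (le_trans zb bT).
Qed.

End Grid.

(** * Oscillation of a solution within the grid cells *)

Section Oscillation.
Context {R : realType} {d : measure_display} {Omega : measurableType d}.
Variables (Pr : probability Omega R) (Ft : R -> set_system Omega) (q : nat)
  (K : 'M[R]_q) (W : R -> Omega -> 'cV[R]_q).
Hypotheses (hF : usual_filtration Pr Ft) (hW : wiener Pr Ft K W).
Local Notation leb := (@lebesgue_measure R).
Local Notation L2 := (sqint Pr).
Local Notation L2p := (sqint (leb \x Pr)%E).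
Local Notation n2p := (sqnorm (leb \x Pr)%E).
Variables (T : R) (n : nat) (A : 'M[R]_n) (N : 'I_q -> 'M[R]_n)
  (f : R -> Omega -> 'cV[R]_n) (x : R -> Omega -> 'cV[R]_n).
Hypotheses (T0 : 0 < T) (hx : sde_solution Pr Ft W T A N f 0 x)
  (hf : forall l, L2p (rs `[0, T] (fun s w => f s w l 0))).

Let dr l := fun s w => (A *m x s w + f s w) l 0.
Let Nx i l := fun s w => (N i *m x s w) l 0.
Let xl l := fun s w => x s w l 0.

Let xl_L2p l : L2p (rs `[0, T] (xl l)).
Proof. by case: hx => hL _ _; exact: (L2process_coord l (measurable_itv _) hL). Qed.

Let Nx_L2p i l : L2p (rs `[0, T] (Nx i l)).
Proof. by rewrite /Nx rs_mulmx; apply: L2_sum => k; apply: L2Z; exact: xl_L2p. Qed.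

Let dr_L2p l : L2p (rs `[0, T] (dr l)).
Proof.
rewrite (_ : rs _ _ = fun z => rs `[0, T] (fun s w => (A *m x s w) l 0) z +
  rs `[0, T] (fun s w => f s w l 0) z).
  apply: L2D => //; rewrite rs_mulmx; apply: L2_sum => k; apply: L2Z; exact: xl_L2p.
by apply/funext => z; rewrite /rs /dr mxE mulrDr.
Qed.

Definition step_gap (h : R) (M : nat) l : measurableTypeR R * Omega -> R := fun z =>
  rI 0 (M%:R * h) (xl l) z - \sum_(k < M) cell h k z.1 * x (k%:R * h) z.2 l 0.

Definition osc_const l : R := 2 * (T * n2p (rI 0 T (dr l)) +
    q%:R * \sum_i 4 * K i i * n2p (rI 0 T (Nx i l))).

Let gapE h M l z : 0 <= h -> step_gap h M l z =
  \sum_(k < M) (rC h k (xl l) z - cell h k z.1 * x (k%:R * h) z.2 l 0).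
Proof. by move=> h0; rewrite /step_gap rC_sum// sumrB. Qed.

Lemma step_gap_L2 h M l : 0 <= h -> M%:R * h <= T -> L2p (step_gap h M l).
Proof.
move=> h0 MT; rewrite (_ : step_gap _ _ _ = fun z =>
  \sum_(k < M) (rC h k (xl l) z - cell h k z.1 * x (k%:R * h) z.2 l 0)); last first.
  by apply/funext => z; rewrite gapE.
apply: L2_sum => k; apply: L2B; first exact: (rC_L2 h0 MT (ltn_ord k) (xl_L2p l)).
have kT : k%:R * h <= T by apply: le_trans MT; apply: cell_le => //; exact: ltnW.
exact: (proj1 (cell_tensor k h0 (sol_L2 hF hW T0 hx hf l (mulr_ge0 (ler0n _ k) h0) kT))).
Qed.

(** The drift is square integrable in time but not bounded, so a single increment need not be O(h).
    It is bounded by the energy of the coefficients on its cell. These energies add up to a fixed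
    amount, and integrating over the cell supplies the factor h. *)
Lemma step_gap_le h M l : 0 < h -> (0 < M)%N -> M%:R * h <= T ->
  n2p (step_gap h M l) <= h * osc_const l.
Proof.
move=> h0 M0 MT; have h0' := ltW h0.
pose F (k : 'I_M) z := rC h k (xl l) z - cell h k z.1 * x (k%:R * h) z.2 l 0.
have FE k z : F k z = cell h k z.1 * (x z.1 z.2 l 0 - x (k%:R * h) z.2 l 0).
  by rewrite /F rC_E mulrBr.
have tk0 k : 0 <= k%:R * h by rewrite mulr_ge0.
have tkT (k : 'I_M) : k.+1%:R * h <= T by apply: le_trans MT; exact: cell_le.
have tkS k : k.+1%:R * h = k%:R * h + h by rewrite -natr1 mulrDl mul1r.
have LF k : L2p (F k).
  apply: L2B; first exact: (rC_L2 h0' MT (ltn_ord k) (xl_L2p l)).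
  have kT : k%:R * h <= T by apply: le_trans (tkT k); exact: cell_le.
  exact: (proj1 (cell_tensor k h0' (sol_L2 hF hW T0 hx hf l (tk0 k) kT))).
rewrite (_ : step_gap _ _ _ = fun z => \sum_k F k z); last first.
  by apply/funext => z; rewrite gapE.
rewrite n2_disjoint//; last first.
  by move=> k k' z kk; rewrite !FE mulrACA cell_disj// mul0r.
(* Bounds the second moment of every increment that starts at the left end of cell [k] and stays in
   the cell. *)
pose B (k : nat) := 2 * (h * n2p (rC h k (dr l)) +
    q%:R * \sum_i 4 * K i i * n2p (rC h k (Nx i l))).
have B0 k : 0 <= B k.
  rewrite /B mulr_ge0// addr_ge0// mulr_ge0 ?n2_ge0// sumr_ge0// => i _.
  by rewrite !mulr_ge0 ?n2_ge0// (K_diag_ge0 hW).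
have FB k : n2p (F k) <= h * B k.
  rewrite -lee_fin -n2E// fubini_tonelli1/=; last 2 first.
  - by apply/measurable_EFinP; apply: measurable_funX; case: (LF k).
  - by move=> z; rewrite lee_fin sqr_ge0.
  apply: (@le_trans _ _ (\int[leb]_s ((B k)%:E * (cell h k s)%:E))%E); last first.
    rewrite ge0_integralZl//=; last 3 first.
    - by apply/measurable_EFinP; case: (ioc_L2 (k%:R * h) (k.+1%:R * h)).
    - by move=> s _; rewrite lee_fin /cell /ioc.
    - by rewrite lee_fin.
    rewrite [X in (_ * X <= _)%E](_ : _ = h%:E); first by rewrite -EFinM mulrC.
    under eq_integral => s _.
      rewrite (_ : cell h k s = cell h k s ^+ 2); last first.
        by rewrite /cell /ioc; case: (_ && _); rewrite ?expr1n ?expr0n.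
      over.
    rewrite (n2E (ioc_L2 _ _)) ioc_n2 ?tkS; last by rewrite lerDl.
    by rewrite addrAC subrr add0r.
  apply: ge0_le_integral => //.
  - by move=> s _; apply: integral_ge0 => w _; rewrite lee_fin sqr_ge0.
  - apply: measurable_fun_fubini_tonelli_F; last by move=> z; rewrite lee_fin sqr_ge0.
    by apply/measurable_EFinP; apply: measurable_funX; case: (LF k).
  - apply: emeasurable_funM => //; apply/measurable_EFinP.
    by case: (ioc_L2 (k%:R * h) (k.+1%:R * h)).
  move=> s _; rewrite /fubini_F/=.
  have [c0|[c1 [s1 s2]]] := ioc_cases (k%:R * h) (k.+1%:R * h) s.
    rewrite integral0_eq ?/cell ?c0 ?mule0// => w _.
    by rewrite FE/= /cell c0 mul0r expr0n.
  rewrite /cell c1 mule1.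
  have sT : s <= T by exact: le_trans (tkT k).
  have s0 : 0 <= s by exact: le_trans (ltW s1).
  rewrite (eq_integral (fun w => ((x s w l 0 - x (k%:R * h) w l 0) ^+ 2)%:E)); last first.
    by move=> w _; rewrite FE /cell c1 mul1r.
  have Ls := sol_L2 hF hW T0 hx hf l s0 sT.
  have Lk : L2 (fun w => x (k%:R * h) w l 0).
    apply: (sol_L2 hF hW T0 hx hf) => //.
    by apply: le_trans (tkT k); exact: cell_le.
  rewrite (n2E (L2B Ls Lk)) lee_fin.
  apply: le_trans (sol_incr hF hW hx hf l (tk0 k) s1 sT) _.
  have mono g : L2p (rs `[0, T] g) -> n2p (rI (k%:R * h) s g) <= n2p (rC h k g).
    move=> Lg; apply: n2_le.
    - exact: rI_L2 Lg.
    - exact: (rC_L2 h0' MT (ltn_ord k) Lg).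
    move=> z; rewrite rC_E rIE !exprMn ler_wpM2r ?sqr_ge0// /cell /ioc.
    case: ltP => //= kz; case: (leP z.1 s) => zs; last by rewrite expr0n sqr_ge0.
    by rewrite (le_trans zs s2).
  rewrite ler_pM2l// lerD//.
    apply: ler_pM; [by rewrite subr_ge0 ltW|exact: n2_ge0| |exact: (mono _ (dr_L2p l))].
    by move: s2; rewrite tkS; lra.
  rewrite ler_wpM2l//; apply: ler_sum => i _; rewrite ler_wpM2l//; last exact: (mono _ (Nx_L2p i l)).
  by rewrite mulr_ge0// (K_diag_ge0 hW).
apply: le_trans (ler_sum _ (fun k _ => FB k)) _.
rewrite -mulr_sumr ler_pM2l// /B -mulr_sumr ler_pM2l// big_split/= -!mulr_sumr lerD//.
  have hT : h <= T by apply: le_trans MT; rewrite ler_peMl// ler1n.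
  by rewrite (n2p_rC_sum h0' MT)//; apply: ler_pM; rewrite ?n2_ge0//; exact: n2p_rI_le.
rewrite ler_wpM2l// exchange_big/=; apply: ler_sum => i _.
rewrite -mulr_sumr ler_wpM2l//; first by rewrite mulr_ge0// (K_diag_ge0 hW).
by rewrite (n2p_rC_sum h0' MT)//; exact: n2p_rI_le.
Qed.

End Oscillation.

Section StepIntegral.
Context {R : realType} {d : measure_display} {Omega : measurableType d}.
Variables (Pr : probability Omega R).
Local Notation leb := (@lebesgue_measure R).
Local Notation L2 := (sqint Pr).
Local Notation L2p := (sqint (leb \x Pr)%E).

Lemma cell_supp (h T : R) (k : nat) (c : Omega -> R) : 0 <= h -> k.+1%:R * h <= T ->
  tsupp 0 T (fun z : measurableTypeR R * Omega => cell h k z.1 * c z.2).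
Proof.
move=> h0 kT z; have := @rI_supp R d Omega (k%:R * h) (k.+1%:R * h) 0 T (fun _ w => c w).
by move=> /(_ (mulr_ge0 (ler0n _ k) h0) kT z); rewrite !rIE.
Qed.

Lemma tint_sub_step (h T : R) (M : nat) V (c : nat -> Omega -> R) :
  0 <= h -> M%:R * h <= T -> L2p V -> tsupp 0 T V -> (forall k, (k < M)%N -> L2 (c k)) ->
  {ae Pr, forall w, tint (fun z => V z - \sum_(k < M) cell h k z.1 * c k z.2) w =
    tint V w - \sum_(k < M) h * c k w}.
Proof.
move=> h0 MT LV sV Lc.
pose F (k : 'I_M) := fun z : measurableTypeR R * Omega => cell h k z.1 * c k z.2.
have LF k : L2p (F k) by exact: (proj1 (cell_tensor k h0 (Lc k (ltn_ord k)))).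
have sF k : tsupp 0 T (F k).
  by apply: cell_supp => //; apply: le_trans MT; exact: cell_le.
have LS : L2p (fun z => \sum_k F k z) by exact: L2_sum.
have sS : tsupp 0 T (fun z => \sum_k F k z) by exact: tsupp_sum.
have h1 := tint_sum (index_enum _) LF sF.
have h2 := tintZ (-1) LS sS.
have := tintD LV sV (L2Z (-1) LS) (tsuppZ (-1) sS).
move: h2 h1; apply: filterS3 => w h2 h1 h3.
rewrite (_ : (fun z => V z - _) = fun z => V z + -1 * \sum_k F k z); last first.
  by apply/funext => z; rewrite mulN1r.
rewrite h3 h2 h1 mulN1r; congr (_ - _); apply: eq_bigr => k _.
rewrite /F /cell tint_tensor; last exact: cell_le.
by congr (_ * _); rewrite -natr1; ring.
Qed.

Lemma rI_00 (f : R -> Omega -> R) : rI 0 0 f = fun=> 0.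
Proof.
apply/funext => z; rewrite rIE; have [->|[_ [a b]]] := ioc_cases 0 0 z.1.
  by rewrite mul0r.
by move: (lt_le_trans a b); rewrite ltxx.
Qed.

Lemma tint0 (w : Omega) : tint (fun=> 0 : R) w = 0.
Proof. by rewrite /tint /Rintegral integral0. Qed.

End StepIntegral.

(** * Adaptedness of the integrated state and of the integrated input *)

Section DriftMeasurability.
Context {R : realType} {d : measure_display} {Omega : measurableType d}.
Variables (Pr : probability Omega R) (Ft : R -> set_system Omega) (q : nat)
  (K : 'M[R]_q) (W : R -> Omega -> 'cV[R]_q).
Hypotheses (hF : usual_filtration Pr Ft) (hW : wiener Pr Ft K W).
Local Notation leb := (@lebesgue_measure R).
Local Notation L2 := (sqint Pr).
Local Notation L2p := (sqint (leb \x Pr)%E).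
Variables (T : R) (n : nat) (A : 'M[R]_n) (N : 'I_q -> 'M[R]_n)
  (f : R -> Omega -> 'cV[R]_n) (x : R -> Omega -> 'cV[R]_n).
Hypotheses (T0 : 0 < T) (hx : sde_solution Pr Ft W T A N f 0 x)
  (hf : forall l, L2p (rs `[0, T] (fun s w => f s w l 0))).

Let xl l := fun s w => x s w l 0.

Let xl_L2p l : L2p (rs `[0, T] (xl l)).
Proof. by case: hx => hL _ _; exact: (L2process_coord l (measurable_itv _) hL). Qed.

(** Joint measurability and adaptedness do not yield this directly. The integral is the limit in
    mean square of Riemann sums at left end points, which are known at time [t]; [step_gap_le] gives
    the convergence. *)
Lemma tint_x_Ft t l : 0 <= t -> t <= T -> measurable_wrt (Ft t) (tint (rI 0 t (xl l))).
Proof.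
move=> t0 tT; have sF := Ft_sigma hF t0.
have [t00|tpos] : t = 0 \/ 0 < t.
  by move: t0; rewrite le_eqVlt => /orP[/eqP <-|]; [left|right].
  subst t; rewrite rI_00.
  rewrite (_ : tint _ = fun=> 0); first exact: mwrt_cst.
  by apply/funext => w; exact: tint0.
have Lx : L2p (rI 0 t (xl l)) by exact: rI_L2 (xl_L2p l).
have sx : tsupp 0 t (rI 0 t (xl l)) by exact: rI_supp.
have [Lt _] := tint_L2 tpos Lx sx.
apply: (L2_closed_Ft hF t0 Lt) => e e0.
(* With [M] cells the squared error is at most t h times the oscillation constant, that is c / M;
   hence more than c / e cells suffice. *)
pose c := t * t * osc_const Pr K T A N f x l.
have osc0 : 0 <= osc_const Pr K T A N f x l.
  rewrite /osc_const mulr_ge0// addr_ge0// mulr_ge0 ?n2_ge0 ?(ltW T0)// sumr_ge0// => i _.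
  by rewrite !mulr_ge0 ?n2_ge0// (K_diag_ge0 hW).
have c0 : 0 <= c / e.
  apply: divr_ge0; last exact: ltW.
  by rewrite /c; apply: mulr_ge0 => //; apply: mulr_ge0.
pose M := Num.bound (c / e).
have cM := archi_boundP c0; rewrite -/M in cM.
have M0 : (0 < M)%N by rewrite -(ltr_nat R); exact: le_lt_trans cM.
have M0r : 0 < M%:R :> R by rewrite ltr0n.
pose h := t / M%:R.
have h0 : 0 < h by rewrite divr_gt0.
have Mh : M%:R * h = t by rewrite /h mulrCA divff ?mulr1// gt_eqF.
have MT : M%:R * h <= T by rewrite Mh.
have kh0 (k : nat) : 0 <= k%:R * h by rewrite mulr_ge0// ltW.
have kht (k : nat) : (k <= M)%N -> k%:R * h <= t.
  by move=> kM; rewrite -Mh cell_le// ltW.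
have Lk k : (k < M)%N -> L2 (fun w => x (k%:R * h) w l 0).
  by move=> kM; apply: (sol_L2 hF hW T0 hx hf) => //; exact: le_trans (kht _ (ltnW kM)) tT.
pose Y w := \sum_(k < M) h * x (k%:R * h) w l 0.
have LY : L2 Y by apply: L2_sum => k; apply: L2Z; exact: Lk.
exists Y; split => //.
  apply: mwrt_sum => // k; apply: mwrtZ => //.
  apply: (Ft_mono hF (kh0 k)); first exact: kht (ltnW _).
  by apply: (sol_Ft hx) => //; exact: le_trans (kht _ (ltnW (ltn_ord k))) tT.
have Lg := step_gap_L2 hF hW T0 hx hf l (ltW h0) MT.
have sg : tsupp 0 t (step_gap x h M l).
  move=> z; rewrite /step_gap Mh mulrBl -sx; congr (_ - _); rewrite mulr_suml.
  apply: eq_bigr => k _.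
  by rewrite -(@cell_supp _ _ _ h t k (fun w => x (k%:R * h) w l 0) (ltW h0) (kht _ (ltn_ord k))).
have [Lgt ngt] := tint_L2 tpos Lg sg.
have E : {ae Pr, forall w, tint (step_gap x h M l) w = tint (rI 0 t (xl l)) w - Y w}.
  rewrite /step_gap Mh.
  by apply: (tint_sub_step (T := t) (c := fun k w => x (k%:R * h) w l 0)) => //;
    rewrite ?Mh// ltW.
have [_ ->] := L2_ae (L2_meas (L2B Lt LY)) E Lgt.
apply: (le_trans ngt); rewrite subr0.
have := step_gap_le hF hW T0 hx hf l h0 M0 MT.
move=> /(ler_wpM2l (ltW tpos)) /le_trans; apply.
have -> : t * (h * osc_const Pr K T A N f x l) = c / M%:R by rewrite /h /c; ring.
by rewrite ler_pdivrMr// mulrC -ler_pdivrMr// ltW.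
Qed.

(** The inhomogeneity may be too irregular for Riemann sums. The equation is solved for its integral
    instead: it is the state minus the stochastic integrals and minus A times the integrated state,
    all known at time [t]. *)
Lemma tint_f_Ft t l : 0 <= t -> t <= T ->
  measurable_wrt (Ft t) (tint (rI 0 t (fun s w => f s w l 0))).
Proof.
move=> t0 tT; have sF := Ft_sigma hF t0.
have [Z [_ FZ hxt]] := sol_dec hF hW hx hf t0 tT.
have LI g : L2p (rs `[0, T] g) -> L2p (rI 0 t g) by move=> Lg; exact: rI_L2 Lg.
have sI (g : R -> Omega -> R) : tsupp 0 T (rI 0 t g) by exact: rI_supp.
have LAx k : L2p (fun z => A l k * rI 0 t (xl k) z) by apply: L2Z; exact: LI.
have sAx k : tsupp 0 T (fun z => A l k * rI 0 t (xl k) z) by apply: tsuppZ; exact: sI.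
apply: (mwrt_ae hF t0 (X := fun w => x t w l 0 - \sum_i Z i l w -
   \sum_k A l k * tint (rI 0 t (xl k)) w)); last first.
  apply: mwrtB => //.
    by apply: mwrtB => //; [exact: (sol_Ft hx)|exact: mwrt_sum].
  by apply: mwrt_sum => // k; apply: mwrtZ => //; exact: tint_x_Ft.
have h1 := tint_sum (index_enum _) LAx sAx.
have h2 : {ae Pr, forall w, forall k, tint (fun z => A l k * rI 0 t (xl k) z) w =
    A l k * tint (rI 0 t (xl k)) w}.
  by apply: filter_forall => k; have := tintZ (A l k) (LI _ (xl_L2p k)) (sI _); exact.
have h3 : {ae Pr, forall w, tint (rI 0 t (fun s w => (A *m x s w + f s w) l 0)) w =
   tint (fun z => \sum_k A l k * rI 0 t (xl k) z) w + tint (rI 0 t (fun s w => f s w l 0)) w}.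
  rewrite (_ : rI 0 t (fun s w => (A *m x s w + f s w) l 0) = fun z =>
     (\sum_k A l k * rI 0 t (xl k) z) + rI 0 t (fun s w => f s w l 0) z).
    apply: tintD; [exact: L2_sum|exact: tsupp_sum|exact: LI|exact: sI].
  apply/funext => z; rewrite -[X in X + _](congr1 (fun g => g z) (rI_mulmx 0 t A x l)).
  by rewrite !rIE mxE mulrDr.
have h4 := hxt l.
have h12 : {ae Pr, forall w, tint (fun z => \sum_k A l k * rI 0 t (xl k) z) w =
    \sum_k A l k * tint (rI 0 t (xl k)) w}.
  by move: h1 h2; apply: filterS2 => w -> h2; apply: eq_bigr => k _; rewrite h2.
move: h12 h3 h4; apply: filterS3 => w -> h3 ->; rewrite h3; ring.
Qed.

End DriftMeasurability.

(** * Convergence of the Euler scheme *)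

Lemma discrete_gronwall (R : realType) (M : nat) (e : nat -> R) (a b : R) :
  0 <= a -> 0 <= b ->
  (forall j, (j <= M)%N -> e j <= a + b * \sum_(k < j) e k) ->
  forall j, (j <= M)%N -> e j <= a * expR (b * j%:R).
Proof.
move=> a0 b0 h j jM; apply: le_trans (h j jM) _.
have b1 : 1 + b <= expR b := expR_ge1Dx b.
elim: j jM => [|j ih] jM; first by rewrite big_ord0 !mulr0 addr0 expR0 mulr1.
have jM' := ltnW jM; have := ih jM'; have := h j jM'.
rewrite big_ord_recr/=; set S := a + b * \sum_(i < j) e i => h1 h2.
have -> : a + b * (\sum_(i < j) e i + e j) = S + b * e j by rewrite /S; ring.
apply: (@le_trans _ _ ((1 + b) * (a * expR (b * j%:R)))).
  have : b * e j <= b * (a * expR (b * j%:R)) by rewrite ler_wpM2l// (le_trans h1 h2).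
  lra.
have -> : b * j.+1%:R = b + b * j%:R by rewrite -natr1; ring.
rewrite expRD mulrCA ler_wpM2l// ler_wpM2r// expR_ge0.
Qed.

Section Euler.
Context {R : realType} {d : measure_display} {Omega : measurableType d}.
Variables (Pr : probability Omega R) (Ft : R -> set_system Omega) (q : nat)
  (K : 'M[R]_q) (W : R -> Omega -> 'cV[R]_q).
Hypotheses (hF : usual_filtration Pr Ft) (hW : wiener Pr Ft K W).
Local Notation leb := (@lebesgue_measure R).
Local Notation L2 := (sqint Pr).
Local Notation n2 := (sqnorm Pr).
Local Notation L2p := (sqint (leb \x Pr)%E).
Local Notation n2p := (sqnorm (leb \x Pr)%E).

Section Scheme.
Variables (h : R) (n : nat) (A : 'M[R]_n) (N : 'I_q -> 'M[R]_n)
  (G : nat -> Omega -> 'cV[R]_n).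

Definition cdW (k : nat) i (w : Omega) : R := increment W (k%:R * h) (k.+1%:R * h) i w.

(** [G k] stands for the integral of the inhomogeneity over cell [k], so it is known at the end of
    the step, whereas drift and noise coefficients are frozen at its beginning. *)
Fixpoint euler (k : nat) (w : Omega) : 'cV[R]_n :=
  if k is k'.+1 then
    let e := euler k' w in
    e + h *: (A *m e) + G k' w + \sum_i cdW k' i w *: (N i *m e)
  else 0.

Lemma euler_S k l w : euler k.+1 w l 0 =
  euler k w l 0 + h * (A *m euler k w) l 0 + G k w l 0 +
  \sum_i (N i *m euler k w) l 0 * cdW k i w.
Proof.
rewrite /= !mxE summxE; congr (_ + _); apply: eq_bigr => i _.
by rewrite mxE mulrC.
Qed.

Lemma euler_sum k l w : euler k w l 0 = \sum_(j < k)
  (h * (A *m euler j w) l 0 + G j w l 0 + \sum_i (N i *m euler j w) l 0 * cdW j i w).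
Proof.
elim: k => [|k ih]; first by rewrite big_ord0 /= mxE.
by rewrite euler_S big_ord_recr/= -ih !addrA.
Qed.

Variable M : nat.
Hypotheses (h0 : 0 <= h)
  (FG : forall k l, (k < M)%N -> measurable_wrt (Ft (k.+1%:R * h)) (fun w => G k w l 0))
  (LG : forall k l, (k < M)%N -> L2 (fun w => G k w l 0)).

Let kh0 (k : nat) : 0 <= k%:R * h. Proof. by rewrite mulr_ge0. Qed.

Lemma euler_Ft k l : (k <= M)%N ->
  measurable_wrt (Ft (k%:R * h)) (fun w => euler k w l 0) /\
  L2 (fun w => euler k w l 0).
Proof.
elim: k l => [|k ih] l kM.
  under eq_fun do rewrite /= mxE; split; last exact: L2_0.
  by apply: mwrt_cst; exact: (Ft_sigma hF (kh0 0)).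
have kM' := ltnW kM.
have kS := cell_le h0 (leqnSn k).
have sF := Ft_sigma hF (kh0 k.+1).
have Fk l' : measurable_wrt (Ft (k%:R * h)) (fun w => euler k w l' 0) by case: (ih l' kM').
have Lk l' : L2 (fun w => euler k w l' 0) by case: (ih l' kM').
have FM (Q : 'M[R]_n) l' : measurable_wrt (Ft (k%:R * h)) (fun w => (Q *m euler k w) l' 0).
  under eq_fun do rewrite mxE.
  apply: mwrt_sum; first exact: (Ft_sigma hF (kh0 k)).
  by move=> k'; apply: mwrtZ => //; exact: (Ft_sigma hF (kh0 k)).
have LM (Q : 'M[R]_n) l' : L2 (fun w => (Q *m euler k w) l' 0).
  by under eq_fun do rewrite mxE; apply: L2_sum => k'; exact: L2Z.
have up (X : Omega -> R) : measurable_wrt (Ft (k%:R * h)) X -> measurable_wrt (Ft (k.+1%:R * h)) X.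
  exact: (Ft_mono hF (kh0 k) kS).
under eq_fun do rewrite euler_S; split.
  apply: mwrtD => //; last first.
    apply: mwrt_sum => // i; apply: mwrtM => //; first exact: up.
    exact: (dW_Ft hF hW).
  apply: mwrtD => //; last exact: FG.
  by apply: mwrtD => //; [exact: up|apply: mwrtZ => //; exact: up].
apply: L2D; last by apply: L2_sum => i; exact: (L2_mul_dW hF hW).
apply: L2D; last exact: LG.
by apply: L2D => //; exact: L2Z.
Qed.

Lemma euler_mulmx_Ft (Q : 'M[R]_n) k l : (k <= M)%N ->
  measurable_wrt (Ft (k%:R * h)) (fun w => (Q *m euler k w) l 0) /\
  L2 (fun w => (Q *m euler k w) l 0).
Proof.
move=> kM; under eq_fun do rewrite mxE; split.
  apply: mwrt_sum; first exact: (Ft_sigma hF (kh0 k)).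
  by move=> k'; apply: mwrtZ; [exact: (Ft_sigma hF (kh0 k))|case: (euler_Ft k' kM)].
by apply: L2_sum => k'; apply: L2Z; case: (euler_Ft k' kM).
Qed.

End Scheme.

Section Convergence.
Variables (T : R) (n : nat) (A : 'M[R]_n) (N : 'I_q -> 'M[R]_n)
  (f : R -> Omega -> 'cV[R]_n) (x : R -> Omega -> 'cV[R]_n).
Hypotheses (T0 : 0 < T) (hx : sde_solution Pr Ft W T A N f 0 x)
  (hf : forall l, L2p (rs `[0, T] (fun s w => f s w l 0))).

Let xl l := fun s w => x s w l 0.

Let xl_L2p l : L2p (rs `[0, T] (xl l)).
Proof. by case: hx => hL _ _; exact: (L2process_coord l (measurable_itv _) hL). Qed.

Definition good_driver (h : R) (M : nat) (G : nat -> Omega -> 'cV[R]_n) :=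
  forall k l, (k < M)%N ->
  [/\ measurable_wrt (Ft (k.+1%:R * h)) (fun w => G k w l 0),
      L2 (fun w => G k w l 0) &
      {ae Pr, forall w, G k w l 0 = tint (rC h k (fun s w => f s w l 0)) w}].

Let CA : R := \sum_l 2 * (T * (n%:R * rowsq A l) +
  q%:R * \sum_i 4 * K i i * (n%:R * rowsq (N i) l)).
Let osc : R := \sum_l osc_const Pr K T A N f x l.

Let CA0 : 0 <= CA.
Proof.
apply: sumr_ge0 => l _; apply: mulr_ge0 => //; apply: addr_ge0.
  by rewrite mulr_ge0 ?(ltW T0)// mulr_ge0// rowsq_ge0.
apply: mulr_ge0 => //; apply: sumr_ge0 => i _.
by apply: mulr_ge0; [rewrite mulr_ge0// (K_diag_ge0 hW)|rewrite mulr_ge0// rowsq_ge0].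
Qed.

Let osc0 : 0 <= osc.
Proof.
apply: sumr_ge0 => l _; rewrite /osc_const mulr_ge0// addr_ge0//.
  by rewrite mulr_ge0 ?n2_ge0 ?(ltW T0).
rewrite mulr_ge0// sumr_ge0// => i _.
by rewrite mulr_ge0 ?n2_ge0// mulr_ge0// (K_diag_ge0 hW).
Qed.

(** With exact input integrals the inhomogeneity cancels from the error, which then solves the
    linear equation with integrand [D], the gap between the state and the step process of the
    scheme. This gap is oscillation within cells, of order h, plus the earlier grid errors, so a
    discrete Gronwall lemma closes the estimate. *)
Lemma euler_conv : exists C : R, 0 <= C /\ forall (M : nat) (h : R) G,
  (0 < M)%N -> 0 < h -> M%:R * h = T -> good_driver h M G ->
  \sum_l n2p (fun z => rI 0 T (xl l) z - \sum_(k < M) cell h k z.1 * euler h A N G k z.2 l 0)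
    <= C * h.
Proof.
exists (2 * osc + 2 * T * (CA * 2 * osc * expR (2 * CA * T))); split.
  by rewrite addr_ge0 ?mulr_ge0 ?expR_ge0// ?(ltW T0)// ?mulr_ge0.
move=> M h G M0 h0 Mh hG; have h0' := ltW h0.
pose xi := euler h A N G.
have FG k l : (k < M)%N -> measurable_wrt (Ft (k.+1%:R * h)) (fun w => G k w l 0).
  by move=> kM; case: (hG k l kM).
have LG k l : (k < M)%N -> L2 (fun w => G k w l 0).
  by move=> kM; case: (hG k l kM).
have MT (j : nat) : (j <= M)%N -> j%:R * h <= T.
  by move=> jM; rewrite -Mh cell_le.
have kh0 (k : nat) : 0 <= k%:R * h by rewrite mulr_ge0.
have Lx j l : (j <= M)%N -> L2 (fun w => x (j%:R * h) w l 0).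
  by move=> jM; apply: (sol_L2 hF hW T0 hx hf) => //; exact: MT.
have Lxi j l : (j <= M)%N -> L2 (fun w => xi j w l 0).
  by move=> jM; case: (euler_Ft A N h0' FG LG l jM).
pose e (j : nat) := \sum_l n2 (fun w => x (j%:R * h) w l 0 - xi j w l 0).
pose D (j : nat) l : measurableTypeR R * Omega -> R :=
  fun z => rI 0 (j%:R * h) (xl l) z - \sum_(k < j) cell h k z.1 * xi k z.2 l 0.
have Lcx (j : nat) (Q : nat -> Omega -> R) : (j <= M)%N -> (forall k, (k < j)%N -> L2 (Q k)) ->
    forall k : 'I_j, L2p (fun z => cell h k z.1 * Q k z.2).
  by move=> jM LQ k; exact: (proj1 (cell_tensor k h0' (LQ _ (ltn_ord k)))).
have LD j l : (j <= M)%N -> L2p (D j l).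
  move=> jM; apply: L2B; first exact: (rI_L2 (lexx 0) (MT _ jM) (xl_L2p l)).
  apply: L2_sum => k; apply: (Lcx j (fun k w => xi k w l 0)) => // k' k'j.
  exact: Lxi (ltnW (leq_trans k'j jM)).
have nD j l : (0 < j)%N -> (j <= M)%N -> n2p (D j l) <= 2 * (h * osc_const Pr K T A N f x l) +
    2 * h * \sum_(k < j) n2 (fun w => x (k%:R * h) w l 0 - xi k w l 0).
  move=> j0 jM; rewrite (_ : D j l = fun z => step_gap x h j l z +
    \sum_(k < j) cell h k z.1 * (x (k%:R * h) z.2 l 0 - xi k z.2 l 0)); last first.
    apply/funext => z; rewrite /D /step_gap -addrA; congr (_ + _).
    rewrite -!sumrN -big_split/=; apply: eq_bigr => k _; ring.
  have LS (k : 'I_j) : L2p (fun z => cell h k z.1 * (x (k%:R * h) z.2 l 0 - xi k z.2 l 0)).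
    apply: (Lcx j (fun k w => x (k%:R * h) w l 0 - xi k w l 0)) => // k' k'j.
    have k'M := ltnW (leq_trans k'j jM).
    by apply: L2B; [exact: Lx|exact: Lxi].
  apply: le_trans (n2D_le _ _) _.
  - exact: (step_gap_L2 hF hW T0 hx hf l h0' (MT _ jM)).
  - exact: L2_sum.
  apply: lerD; rewrite -?mulrA ler_pM2l//.
    exact: (step_gap_le hF hW T0 hx hf l h0 j0 (MT j jM)).
  rewrite n2_disjoint//; last first.
    by move=> k k' z kk; rewrite mulrACA cell_disj// mul0r.
  rewrite mulr_sumr; apply: ler_sum => k _.
  have kM := ltnW (leq_trans (ltn_ord k) jM).
  have [_ ->] // := cell_tensor k h0' (L2B (Lx k l kM) (Lxi k l kM)).
have nDs j : (j <= M)%N -> \sum_l n2p (D j l) <= 2 * h * osc + 2 * h * \sum_(k < j) e k.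
  move=> jM; have [j0|j0] := posnP j.
    rewrite j0 big_ord0 mulr0 addr0 big1 ?mulr_ge0// => l _.
    rewrite (_ : D 0%N l = fun=> 0) ?n20//.
    by apply/funext => z; rewrite /D mul0r rI_00 big_ord0 subr0.
  apply: le_trans (ler_sum _ (fun l _ => nD j l j0 jM)) _.
  rewrite big_split/= le_eqVlt; apply/orP; left; apply/eqP; congr (_ + _).
    by rewrite /osc mulr_sumr; apply: eq_bigr => l _; rewrite mulrA.
  by rewrite -mulr_sumr exchange_big.
have ej j : (j <= M)%N -> e j <= CA * \sum_l n2p (D j l).
  move=> jM; rewrite /CA mulr_suml; apply: ler_sum => l _.
  have [Z [hZ _ hxt]] := sol_dec hF hW hx hf (kh0 j) (MT j jM).
  (* The noise part of the scheme is an elementary Ito integral, so its difference from the noise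
     part of the solution is again an [ito_pair], with integrand N i times the gap [D]. *)
  have mk i : exists F : seq (elem Pr Ft),
      (forall w, ito_family W i F w = \sum_(k < j) (N i *m xi k w) l 0 * cdW h k i w) /\
      (forall z, famV F z = \sum_(k < j) cell h k z.1 * (N i *m xi k z.2) l 0).
    have /choice[m hm] : forall k : 'I_j, exists e : elem Pr Ft,
        [/\ el_a e = k%:R * h, el_b e = k.+1%:R * h & el_c e = fun w => (N i *m xi k w) l 0].
      move=> k; have kM := ltnW (leq_trans (ltn_ord k) jM).
      have [Fk Lk] := euler_mulmx_Ft A N h0' FG LG (N i) l kM.
      by exists (Elem (kh0 k) (cell_le h0' (leqnSn k)) Fk Lk).
    exists [seq m k | k <- enum 'I_j]; split.
      move=> w; rewrite /ito_family big_map big_enum/=; apply: eq_bigr => k _.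
      by rewrite /elI; have [-> -> ->] := hm k.
    move=> z; rewrite /famV big_map big_enum/=; apply: eq_bigr => k _.
    by rewrite /elV; have [-> -> ->] := hm k.
  have /choice[F hFF] := mk.
  have LDj k : L2p (D j k) by exact: LD.
  have sD k : tsupp 0 T (D j k).
    move=> z; rewrite /D mulrBl -(rI_supp _ (lexx 0) (MT j jM)); congr (_ - _).
    rewrite mulr_suml; apply: eq_bigr => k' _.
    rewrite -(@cell_supp _ _ _ h T k' (fun w => xi k' w k 0))// MT//.
    exact: leq_trans (ltn_ord k') jM.
  have Qx (Q : 'M[R]_n) z : rI 0 (j%:R * h) (fun s w => (Q *m x s w) l 0) z -
      \sum_(k < j) cell h k z.1 * (Q *m xi k z.2) l 0 = \sum_k Q l k * D j k z.
    rewrite rI_mulmx /D; under [RHS]eq_bigr do rewrite mulrBr.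
    rewrite sumrB; congr (_ - _).
    under [RHS]eq_bigr do rewrite mulr_sumr.
    rewrite exchange_big/=; apply: eq_bigr => k _.
    by rewrite mxE mulr_sumr; apply: eq_bigr => k' _; rewrite mulrCA.
  have LV (Q : 'M[R]_n) : L2p (fun z => \sum_k Q l k * D j k z) by apply: L2_sum => k; exact: L2Z.
  have := @sol_bound _ _ _ _ _ _ _ _ hF hW 0 T (fun w => x (j%:R * h) w l 0 - xi j w l 0)
    (fun z => \sum_k A l k * D j k z) (fun i w => Z i l w - ito_family W i (F i) w)
    (fun i z => \sum_k N i l k * D j k z).
  case=> //.
  - by apply: measurable_funB; [case: (Lx j l jM)|case: (Lxi j l jM)].
  - by apply: tsupp_sum => k; exact: tsuppZ.
  - move=> i; have := ito_pairB hF hW (hZ i l) (ito_pair_fam hF hW i (F i)).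
    congr (ito_pair _ _ _ _ _ _); apply/funext => z.
    by rewrite (proj2 (hFF i)) Qx.
  - have LI g : L2p (rs `[0, T] g) -> L2p (rI 0 (j%:R * h) g).
      by move=> Lg; exact: (rI_L2 (lexx 0) (MT j jM) Lg).
    have sI (g : R -> Omega -> R) : tsupp 0 T (rI 0 (j%:R * h) g).
      by apply: rI_supp => //; exact: MT.
    have LAx : L2p (rI 0 (j%:R * h) (fun s w => (A *m x s w) l 0)).
      by apply: LI; rewrite rs_mulmx; apply: L2_sum => k; apply: L2Z; exact: xl_L2p.
    have h1 : {ae Pr, forall w,
        tint (rI 0 (j%:R * h) (fun s w => (A *m x s w + f s w) l 0)) w =
        tint (rI 0 (j%:R * h) (fun s w => (A *m x s w) l 0)) w +
        tint (rI 0 (j%:R * h) (fun s w => f s w l 0)) w}.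
      rewrite (_ : rI _ _ (fun s w => (A *m x s w + f s w) l 0) = fun z =>
          rI 0 (j%:R * h) (fun s w => (A *m x s w) l 0) z +
          rI 0 (j%:R * h) (fun s w => f s w l 0) z).
        by apply: (@tintD _ _ _ _ 0 T) => //; exact: LI.
      by apply/funext => z; rewrite !rIE mxE mulrDr.
    have h2 : {ae Pr, forall w, tint (fun z => \sum_k A l k * D j k z) w =
        tint (rI 0 (j%:R * h) (fun s w => (A *m x s w) l 0)) w -
        \sum_(k < j) h * (A *m xi k w) l 0}.
      have := tint_sub_step (c := fun k w => (A *m xi k w) l 0) h0' (MT j jM) LAx (sI _).
      rewrite (_ : (fun z => \sum_k A l k * D j k z) = fun z =>
          rI 0 (j%:R * h) (fun s w => (A *m x s w) l 0) z -
          \sum_(k < j) cell h k z.1 * (A *m xi k z.2) l 0); last first.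
        by apply/funext => z; rewrite Qx.
      apply=> k kj; have kM := ltnW (leq_trans kj jM).
      by case: (euler_mulmx_Ft A N h0' FG LG A l kM).
    (* Here the inhomogeneity of the solution is matched exactly by the sum of the driver terms. *)
    have h3 : {ae Pr, forall w, tint (rI 0 (j%:R * h) (fun s w => f s w l 0)) w =
        \sum_(k < j) G k w l 0}.
      have LC (k : 'I_j) : L2p (rC h k (fun s w => f s w l 0)).
        exact: (rC_L2 h0' (MT j jM) (ltn_ord k) (hf l)).
      have sC (k : 'I_j) : tsupp 0 T (rC h k (fun s w => f s w l 0)).
        by apply: rI_supp => //; apply: MT; exact: leq_trans (ltn_ord k) jM.
      have hG' : {ae Pr, forall w, forall k : 'I_j,
          G k w l 0 = tint (rC h k (fun s w => f s w l 0)) w}.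
        by apply: filter_forall => k; case: (hG k l (leq_trans (ltn_ord k) jM)).
      rewrite (_ : rI _ _ _ = fun z => \sum_(k < j) rC h k (fun s w => f s w l 0) z); last first.
        by apply/funext => z; rewrite rC_sum.
      move: (tint_sum (index_enum _) LC sC) hG'; apply: filterS2 => w -> hG'.
      by apply: eq_bigr => k _; rewrite hG'.
    have h13 : {ae Pr, forall w, x (j%:R * h) w l 0 =
        tint (rI 0 (j%:R * h) (fun s w => (A *m x s w) l 0)) w +
        \sum_(k < j) G k w l 0 + \sum_i Z i l w}.
      by move: (hxt l) h1 h3; apply: filterS3 => w -> -> ->.
    move: h13 h2; apply: filterS2 => w -> ->; rewrite /xi euler_sum !big_split/=.
    rewrite sumrN exchange_big/=.
    rewrite (eq_bigr _ (fun i _ => proj1 (hFF i) w) : \sum_i ito_family W i (F i) w = _).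
    ring.
  move=> _ /le_trans; apply.
  rewrite subr0 -mulrA ler_pM2l// mulrDl; apply: lerD.
    by rewrite -mulrA ler_pM2l// n2_lincomb.
  rewrite -mulrA ler_wpM2l// mulr_suml; apply: ler_sum => i _.
  rewrite -[leRHS]mulrA; apply: ler_wpM2l; first by rewrite mulr_ge0// (K_diag_ge0 hW).
  exact: n2_lincomb.
(* The Gronwall rate carries a factor h and at most T / h steps are taken, so the exponential stays
   bounded as h tends to 0. *)
have eg j : (j <= M)%N -> e j <= CA * (2 * h * osc) * expR (CA * (2 * h) * j%:R).
  apply: discrete_gronwall.
  - by rewrite !mulr_ge0.
  - by rewrite !mulr_ge0.
  move=> k kM; apply: le_trans (ej k kM) _.
  rewrite -[X in _ <= _ + X]mulrA -mulrDr ler_wpM2l//; exact: nDs.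
have := nDs M (leqnn M); rewrite /D Mh => /le_trans; apply.
have ek (k : 'I_M) : e k <= CA * (2 * h * osc) * expR (2 * CA * T).
  apply: le_trans (eg k (ltnW (ltn_ord k))) _.
  rewrite ler_wpM2l ?mulr_ge0// ler_expR -Mh.
  have -> : CA * (2 * h) * k%:R = 2 * CA * (k%:R * h) by ring.
  by rewrite ler_wpM2l ?mulr_ge0// cell_le// ltnW.
have : \sum_(k < M) e k <= M%:R * (CA * (2 * h * osc) * expR (2 * CA * T)).
  apply: le_trans (ler_sum _ (fun k _ => ek k)) _.
  by rewrite sumr_const card_ord -[leLHS]mulr_natl.
move=> /(ler_wpM2l (mulr_ge0 (ler0n _ 2) h0')) hs.
apply: (@le_trans _ _ (2 * h * osc + 2 * h * (M%:R * (CA * (2 * h * osc) * expR (2 * CA * T))))).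
  by rewrite lerD2l.
rewrite -Mh le_eqVlt; apply/orP; left; apply/eqP; ring.
Qed.

End Convergence.
End Euler.

(** * Energy balance of one truncation step *)

Section BilinearK.
Context {R : realType} {q : nat} (K : 'M[R]_q).

(** The covariance per unit of time of the noises with coefficients [f] and [g]. *)
Definition QK (f g : 'I_q -> R) : R := \sum_i \sum_j K i j * (f i * g j).

Hypotheses (Ksym : forall i j, K i j = K j i)
  (Kpsd : forall c : 'I_q -> R, 0 <= QK c c).

Lemma QKC f g : QK f g = QK g f.
Proof.
rewrite /QK exchange_big/=; apply: eq_bigr => i _; apply: eq_bigr => j _.
by rewrite Ksym (mulrC (f j)).
Qed.

Lemma QKDl f g h : QK (fun i => f i + g i) h = QK f h + QK g h.
Proof.
rewrite /QK -big_split; apply: eq_bigr => i _; rewrite -big_split; apply: eq_bigr => j _ /=.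
ring.
Qed.

Lemma QKZl a f h : QK (fun i => a * f i) h = a * QK f h.
Proof.
rewrite /QK mulr_sumr; apply: eq_bigr => i _; rewrite mulr_sumr; apply: eq_bigr => j _ /=.
ring.
Qed.

Lemma QK_add f g : QK (fun i => f i + g i) (fun i => f i + g i) =
  QK f f + 2 * QK f g + QK g g.
Proof.
rewrite QKDl (QKC f) (QKC g) !QKDl (QKC g f); ring.
Qed.

Lemma QK_addZ f g a : QK (fun i => f i + a * g i) (fun i => f i + a * g i) =
  QK f f + 2 * a * QK f g + a ^+ 2 * QK g g.
Proof.
rewrite QK_add (QKC f) QKZl (QKC g f) QKZl (QKC g) QKZl; ring.
Qed.

(* One row of the error system: [al = 1 = ga] above the removed row, [al = 1],
   [ga = 0] on the removed row (whose weight is [s], so that the cross terms of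
   the two halves cancel), and [al = 0 = ga] below it. *)
Lemma storage_row (sl s xi eta axi aeta al ga : R) (nxi neta : 'I_q -> R) :
  0 < sl ->
  [\/ al = 1 /\ ga = 1, [/\ al = 1, ga = 0, eta = 0 & sl = s] |
      [/\ al = 0, ga = 0, xi = 0 & eta = 0]] ->
  sl * (2 * (xi - eta) * (al * axi - ga * aeta) +
        QK (fun i => al * nxi i - ga * neta i) (fun i => al * nxi i - ga * neta i)) +
  s ^+ 2 * (sl^-1 * (2 * (xi + eta) * (al * axi + ga * aeta) +
        QK (fun i => al * nxi i + ga * neta i) (fun i => al * nxi i + ga * neta i))) <=
  sl * (2 * (xi - eta) * (axi - aeta) +
        QK (fun i => nxi i - neta i) (fun i => nxi i - neta i)) +
  s ^+ 2 * (sl^-1 * (2 * (xi + eta) * (axi + aeta) +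
        QK (fun i => nxi i + neta i) (fun i => nxi i + neta i))).
Proof.
move=> sl0 [[-> ->]|[-> -> -> sls]|[-> -> -> ->]].
- have -> : (fun i => 1 * nxi i - 1 * neta i) = fun i => nxi i - neta i.
    by apply/funext => i; ring.
  have -> : (fun i => 1 * nxi i + 1 * neta i) = fun i => nxi i + neta i.
    by apply/funext => i; ring.
  by rewrite !mul1r.
- subst sl; have s0 : s != 0 by rewrite gt_eqF.
  have E (t : R) : s ^+ 2 * (s^-1 * t) = s * t by field.
  rewrite !E.
  have -> : (fun i => 1 * nxi i - 0 * neta i) = nxi by apply/funext => i; ring.
  have -> : (fun i => 1 * nxi i + 0 * neta i) = nxi by apply/funext => i; ring.
  have -> : (fun i => nxi i - neta i) = (fun i => nxi i + -1 * neta i).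
    by apply/funext => i; ring.
  (* The terms in [aeta] and the mixed noise terms cancel between the two halves; the right-hand
     side exceeds the left by 2 s QK neta neta, which is nonnegative. *)
  rewrite QK_addZ QK_add; have := mulr_ge0 (ltW sl0) (Kpsd neta); nra.
- have Q0 : QK (fun=> 0) (fun=> 0) = 0.
    by rewrite /QK big1// => i _; rewrite big1// => j _; rewrite !mulr0.
  have -> : (fun i => 0 * nxi i - 0 * neta i) = fun=> 0 by apply/funext => i; ring.
  have -> : (fun i => 0 * nxi i + 0 * neta i) = fun=> 0 by apply/funext => i; ring.
  rewrite Q0 [leLHS](_ : _ = 0); last by ring.
  set u := QK _ _; set v := QK _ _.
  have u0 : 0 <= u by exact: Kpsd.
  have v0 : 0 <= v by exact: Kpsd.
  rewrite [leRHS](_ : _ = sl * u + s ^+ 2 * (sl^-1 * v)); last by ring.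
  have i0 : 0 <= sl^-1 by rewrite invr_ge0 ltW.
  exact: addr_ge0 (mulr_ge0 (ltW sl0) u0) (mulr_ge0 (sqr_ge0 s) (mulr_ge0 i0 v0)).
Qed.

(** On a kept row the input drops out of the difference and doubles in the sum; on the removed row
    both halves contribute equally. In every case the input meets only the Sigma^-1-weighted sum of
    the states, which is the pairing that [reach_ineq] controls. *)
Lemma storage_row_input (sl s xi eta bu al ga : R) : 0 < sl ->
  [\/ al = 1 /\ ga = 1, [/\ al = 1, ga = 0, eta = 0 & sl = s] |
      [/\ al = 0, ga = 0, xi = 0 & eta = 0]] ->
  sl * (2 * (xi - eta) * (al * bu - ga * bu)) +
  s ^+ 2 * (sl^-1 * (2 * (xi + eta) * (al * bu + ga * bu))) =
  4 * s ^+ 2 * (sl^-1 * (xi + eta) * bu).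
Proof.
move=> sl0 [[-> ->]|[-> -> -> sls]|[-> -> -> ->]].
- ring.
- by subst sl; field; rewrite gt_eqF.
- ring.
Qed.

End BilinearK.

Section StepLemma.
Context {R : realType} {d : measure_display} {Omega : measurableType d}.
Variables (Pr : probability Omega R) (Ft : R -> set_system Omega) (q : nat)
  (K : 'M[R]_q) (W : R -> Omega -> 'cV[R]_q).
Hypotheses (hF : usual_filtration Pr Ft) (hW : wiener Pr Ft K W).
Local Notation L2 := (sqint Pr).
Local Notation n2 := (sqnorm Pr).
Local Notation ip := (sqip Pr).

(* The step is h = dl^2: Young's inequality with weight [dl] then makes the cross
   term between input and noise of lower order. *)
Lemma step_bound (s h dl : R) (X a b : Omega -> R) (n : 'I_q -> Omega -> R) :
  0 <= s -> 0 < dl -> h = dl ^+ 2 ->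
  measurable_wrt (Ft s) X -> measurable_wrt (Ft s) a ->
  (forall i, measurable_wrt (Ft s) (n i)) ->
  L2 X -> L2 a -> L2 b -> (forall i, L2 (n i)) ->
  forall kap, kap = \sum_i \sum_j K i j * ip (n i) (n j) ->
  n2 (fun w => X w + h * a w + b w + \sum_i n i w * increment W s (s + h) i w) <=
  n2 X + 2 * h * ip X a + 2 * ip X b + h * kap +
  (2 * h ^+ 2 * n2 a + 2 * n2 b + dl^-1 * n2 b + dl * h * kap).
Proof.
move=> s0 dl0 hE FX Fa Fn LX La Lb Ln kap kapE.
have h0 : 0 < h by rewrite hE exprn_gt0.
have ssh : s <= s + h by rewrite lerDl ltW.
pose G w := \sum_i n i w * increment W s (s + h) i w.
have LnW i : L2 (fun w => n i w * increment W s (s + h) i w) by exact: (L2_mul_dW hF hW).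
have LG : L2 G by exact: L2_sum.
have ip0 Y : measurable_wrt (Ft s) Y -> L2 Y -> ip Y G = 0.
  move=> FY LY; rewrite ip_sumr// big1// => i _.
  exact: (ip_dW0 hF hW).
have nG : n2 G = h * kap.
  rewrite n2_ip ip_suml// kapE mulr_sumr; apply: eq_bigr => i _.
  rewrite ip_sumr// mulr_sumr; apply: eq_bigr => j _.
  rewrite (ip_dWdW hF hW)//; ring.
have Lha : L2 (fun w => h * a w) by exact: L2Z.
have Lc : L2 (fun w => h * a w + b w) by exact: L2D.
rewrite (_ : (fun w => _) = fun w => (X w + (h * a w + b w)) + G w); last first.
  by apply/funext => w; rewrite /G; ring.
rewrite n2D//; last exact: L2D.
rewrite n2D// ipDl// ip0// ipDl// ipZl// ip0// ipDr// ipZr// nG.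
have := n2D_le Lha Lb; rewrite n2Z//.
have dl0' : 0 < dl^-1 by rewrite invr_gt0.
(* [X] and [a] are known at time [s] and hence orthogonal to the noise [G]. The input [b] is known
   only at the end of the step, so its correlation with [G] has to be estimated. *)
have := ip_le_eps dl0' Lb LG; rewrite invrK nG.
lra.
Qed.

Lemma kap_le (n : 'I_q -> Omega -> R) : (forall i, L2 (n i)) ->
  \sum_i \sum_j K i j * ip (n i) (n j) <=
  (\sum_i \sum_j `|K i j|) * \sum_i n2 (n i).
Proof.
move=> Ln; rewrite mulr_suml; apply: ler_sum => i _; rewrite mulr_suml; apply: ler_sum => j _.
apply: le_trans (ler_norm _) _; rewrite normrM ler_wpM2l//.
have Si k : n2 (n k) <= \sum_i n2 (n i).
  by rewrite (bigD1 k)//= lerDl; apply: sumr_ge0 => k' _; exact: n2_ge0.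
have := ip_le_eps ltr01 (Ln i) (Ln j).
have Lm : L2 (fun w => - n i w) by exact: L2N.
have := ip_le_eps ltr01 Lm (Ln j).
have -> : ip (fun w => - n i w) (n j) = - ip (n i) (n j).
  by rewrite -mulN1r -ipZl//; congr (sqip _ _ _); apply/funext => w; rewrite mulN1r.
rewrite n2N invr1; have := Si i; have := Si j => h1 h2 h3 h4.
rewrite ler_norml; apply/andP; split; lra.
Qed.

End StepLemma.

Section BalancedSystem.
Context {R : realType} {q n m p : nat} (K : 'M[R]_q) (A : 'M[R]_n)
  (N : 'I_q -> 'M[R]_n) (B : 'M[R]_(n, m)) (C : 'M[R]_(p, n)) (sg : 'I_n -> R) (beta : R).

(* The truncated systems are kept in R^n, where they can be compared. *)
Definition trunc (k : nat) (M : 'M[R]_n) : 'M[R]_n := pid_mx k *m M *m pid_mx k.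

Lemma pid_mulmxE (n' : nat) (k : nat) (v : 'M[R]_(n, n')) l j :
  ((pid_mx k : 'M[R]_n) *m v) l j = (l < k)%N%:R * v l j.
Proof.
rewrite mxE (bigD1 l)//= big1 ?addr0; first by rewrite mxE eqxx.
move=> i il; rewrite mxE (_ : (l == i :> nat) = false) ?mul0r//.
by rewrite val_eqE eq_sym (negbTE il).
Qed.

Lemma trunc_mulmxE k (M : 'M[R]_n) (v : 'cV[R]_n) l : pid_mx k *m v = v ->
  (trunc k M *m v) l 0 = (l < k)%N%:R * (M *m v) l 0.
Proof. by move=> kv; rewrite /trunc -!mulmxA kv pid_mulmxE. Qed.

(* The Riccati equation for Q tested against the weight Sigma; its dual, from the
   inequality for P, is tested against Sigma^-1. *)
Definition obs_ineq := forall v : 'cV[R]_n,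
  \sum_l sg l * (2 * v l 0 * (A *m v) l 0 +
     QK K (fun i => (N i *m v) l 0) (fun i => (N i *m v) l 0)) +
  \sum_c (C *m v) c 0 ^+ 2 <= beta * \sum_l sg l * v l 0 ^+ 2.

Definition reach_ineq := forall v : 'cV[R]_n,
  \sum_l (sg l)^-1 * (2 * v l 0 * (A *m v) l 0 +
     QK K (fun i => (N i *m v) l 0) (fun i => (N i *m v) l 0)) +
  \sum_j (\sum_l B l j * ((sg l)^-1 * v l 0)) ^+ 2 <=
  beta * \sum_l (sg l)^-1 * v l 0 ^+ 2.

Hypotheses (Ksym : forall i j, K i j = K j i)
  (Kpsd : forall c : 'I_q -> R, 0 <= QK K c c)
  (sg0 : forall l, 0 < sg l) (hO : obs_ineq) (hR : reach_ineq).

Definition storage (s : R) (xm xp : 'I_n -> R) : R :=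
  \sum_l (sg l * xm l ^+ 2 + s ^+ 2 * ((sg l)^-1 * xp l ^+ 2)).

(** The dissipation inequality for each outcome. Row by row the truncated dynamics are compared with
    the full ones; then [obs_ineq] applies to xi - eta and [reach_ineq] to xi + eta. [U] is an
    integral over a cell, not a rate, which explains the h^-1 in its cost. *)
Lemma storage_pointwise (k : 'I_n) (h : R) (xi eta : 'cV[R]_n) (U : 'cV[R]_m) :
  0 < h -> pid_mx k.+1 *m xi = xi -> (pid_mx k : 'M[R]_n) *m eta = eta ->
  forall (s : R) (al ga : 'I_n -> R), s = sg k ->
  (forall l, al l = (l < k.+1)%N%:R) -> (forall l, ga l = (l < k)%N%:R) ->
  \sum_l (sg l *
     (h * (2 * (xi l 0 - eta l 0) * (al l * (A *m xi) l 0 - ga l * (A *m eta) l 0) +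
        QK K (fun i => al l * (N i *m xi) l 0 - ga l * (N i *m eta) l 0)
             (fun i => al l * (N i *m xi) l 0 - ga l * (N i *m eta) l 0)) +
      2 * (xi l 0 - eta l 0) * (al l * (B *m U) l 0 - ga l * (B *m U) l 0)) +
   s ^+ 2 * ((sg l)^-1 *
     (h * (2 * (xi l 0 + eta l 0) * (al l * (A *m xi) l 0 + ga l * (A *m eta) l 0) +
        QK K (fun i => al l * (N i *m xi) l 0 + ga l * (N i *m eta) l 0)
             (fun i => al l * (N i *m xi) l 0 + ga l * (N i *m eta) l 0)) +
      2 * (xi l 0 + eta l 0) * (al l * (B *m U) l 0 + ga l * (B *m U) l 0)))) <=
  h * beta * storage s (fun l => xi l 0 - eta l 0) (fun l => xi l 0 + eta l 0) -
  h * (\sum_c (C *m (xi - eta)) c 0 ^+ 2) + 4 * s ^+ 2 * h^-1 * \sum_j U j 0 ^+ 2.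
Proof.
move=> h0 kxi keta s al ga sE alE gaE.
have rows (l : 'I_n) : [\/ al l = 1 /\ ga l = 1,
    [/\ al l = 1, ga l = 0, eta l 0 = 0 & sg l = s] |
    [/\ al l = 0, ga l = 0, xi l 0 = 0 & eta l 0 = 0]].
  have xl : xi l 0 = al l * xi l 0 by rewrite -{1}kxi pid_mulmxE alE.
  have el : eta l 0 = ga l * eta l 0 by rewrite -{1}keta pid_mulmxE gaE.
  rewrite xl el alE gaE ltnS; case: (ltngtP l k) => lk.
  - by apply: Or31.
  - by apply: Or33; split; rewrite ?mul0r.
  - apply: Or32; split; rewrite ?mul0r// sE; congr sg; exact: val_inj.
pose xm := xi - eta; pose xp := xi + eta.
have xmE l : xi l 0 - eta l 0 = xm l 0 by rewrite !mxE.
have xpE l : xi l 0 + eta l 0 = xp l 0 by rewrite !mxE.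
have mE (M : 'M[R]_n) l : (M *m xi) l 0 - (M *m eta) l 0 = (M *m xm) l 0.
  by rewrite /xm mulmxBr !mxE.
have pE (M : 'M[R]_n) l : (M *m xi) l 0 + (M *m eta) l 0 = (M *m xp) l 0.
  by rewrite /xp mulmxDr !mxE.
pose rm l := 2 * xm l 0 * (A *m xm) l 0 +
  QK K (fun i => (N i *m xm) l 0) (fun i => (N i *m xm) l 0).
pose rp l := 2 * xp l 0 * (A *m xp) l 0 +
  QK K (fun i => (N i *m xp) l 0) (fun i => (N i *m xp) l 0).
apply: (@le_trans _ _ (\sum_l (h * (sg l * rm l + s ^+ 2 * ((sg l)^-1 * rp l)) +
    4 * s ^+ 2 * ((sg l)^-1 * xp l 0 * (B *m U) l 0)))).
  apply: ler_sum => l _.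
  have := @storage_row _ _ _ Ksym Kpsd (sg l) s (xi l 0) (eta l 0) ((A *m xi) l 0) ((A *m eta) l 0)
    (al l) (ga l) (fun i => (N i *m xi) l 0)
    (fun i => (N i *m eta) l 0) (sg0 l) (rows l).
  have := @storage_row_input _ (sg l) s (xi l 0) (eta l 0) ((B *m U) l 0) (al l) (ga l) (sg0 l) (rows l).
  have -> : (fun i => (N i *m xi) l 0 - (N i *m eta) l 0) = (fun i => (N i *m xm) l 0).
    by apply/funext => i; rewrite mE.
  have -> : (fun i => (N i *m xi) l 0 + (N i *m eta) l 0) = (fun i => (N i *m xp) l 0).
    by apply/funext => i; rewrite pE.
  rewrite mE pE -/(rm l) -/(rp l).
  set Q1 := QK _ _ _; set Q2 := QK _ _ _.
  rewrite xmE xpE -/(rm l) -/(rp l) => hi.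
  move=> /(ler_wpM2l (ltW h0)) hd; rewrite -hi.
  by apply: le_trans (_ : _ <= _) (lerD hd (lexx _)); rewrite le_eqVlt; apply/orP; left; apply/eqP; ring.
rewrite big_split/= -!mulr_sumr big_split/= -!mulr_sumr.
have e1 := hO xm; have e2 := hR xp.
pose Y j := \sum_l B l j * ((sg l)^-1 * xp l 0).
have -> : \sum_l (sg l)^-1 * xp l 0 * (B *m U) l 0 = \sum_j Y j * U j 0.
  under [RHS]eq_bigr do rewrite mulr_suml.
  rewrite exchange_big/=; apply: eq_bigr => l _.
  rewrite [(B *m U) l 0]mxE mulr_sumr; apply: eq_bigr => j _; ring.
(* Completing the square: the term h |Y|^2 is exactly what the input term of [reach_ineq] pays for,
   and the rest is the cost of the control. *)
have yU : 4 * \sum_j Y j * U j 0 <= h * \sum_j Y j ^+ 2 + 4 * h^-1 * \sum_j U j 0 ^+ 2.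
  rewrite !mulr_sumr -big_split/=; apply: ler_sum => j _.
  have := sqr_ge0 (h * Y j - 2 * U j 0); rewrite -subr_ge0 => hs.
  have -> : h * Y j ^+ 2 + 4 * h^-1 * U j 0 ^+ 2 - 4 * (Y j * U j 0) =
    h^-1 * (h * Y j - 2 * U j 0) ^+ 2 by field; rewrite gt_eqF.
  by rewrite mulr_ge0 ?sqr_ge0// invr_ge0 ltW.
rewrite /storage big_split/= -mulr_sumr.
have -> : \sum_i sg i * (xi i 0 - eta i 0) ^+ 2 = \sum_i sg i * xm i 0 ^+ 2.
  by apply: eq_bigr => i _; rewrite xmE.
have -> : \sum_i (sg i)^-1 * (xi i 0 + eta i 0) ^+ 2 = \sum_i (sg i)^-1 * xp i 0 ^+ 2.
  by apply: eq_bigr => i _; rewrite xpE.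
have {}e2 : \sum_l (sg l)^-1 * (2 * xp l 0 * (A *m xp) l 0 +
     QK K (fun i => (N i *m xp) l 0) (fun i => (N i *m xp) l 0)) +
  \sum_j Y j ^+ 2 <= beta * \sum_l (sg l)^-1 * xp l 0 ^+ 2 := e2.
move: e1 e2; rewrite -/xm.
set O1 := \sum_l sg l * (_ + _); set O2 := \sum_c _; set O3 := \sum_l _ * _ ^+ 2.
set R1 := \sum_l (sg l)^-1 * (_ + _); set R2 := \sum_j Y j ^+ 2 in yU *; set R3 := \sum_l _^-1 * _ ^+ 2.
move=> e1 e2.
have {}e1 := ler_wpM2l (ltW h0) e1.
have {}e2 := ler_wpM2l (mulr_ge0 (ltW h0) (sqr_ge0 s)) e2.
have {}yU := ler_wpM2l (sqr_ge0 s) yU.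
lra.
Qed.

End BalancedSystem.

Section HasExpectation.
Context {R : realType} {d : measure_display} {Omega : measurableType d}.
Variables (Pr : probability Omega R).
Local Notation L2 := (sqint Pr).
Local Notation n2 := (sqnorm Pr).
Local Notation ip := (sqip Pr).
Implicit Types f g : Omega -> R.

(** Integrability and value are kept together, so that the mean of a long pointwise expression is
    found by following its syntax. *)
Definition hasE f v := Pr.-integrable setT (EFin \o f) /\ \int[Pr]_w f w = v.

Lemma hasE_D f g v w : hasE f v -> hasE g w -> hasE (fun x => f x + g x) (v + w).
Proof.
move=> [If <-] [Ig <-]; split; first exact: (integrableD measurableT If Ig).
by rewrite RintegralD.
Qed.

Lemma hasE_Z c f v : hasE f v -> hasE (fun x => c * f x) (c * v).
Proof.
move=> [If <-]; split; first exact: (integrableZl measurableT c If).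
by rewrite RintegralZl.
Qed.

Lemma hasE_ip f g : L2 f -> L2 g -> hasE (fun x => f x * g x) (ip f g).
Proof. by move=> Lf Lg; split => //; exact: L2_mul_int. Qed.

Lemma hasE_sq f : L2 f -> hasE (fun x => f x ^+ 2) (n2 f).
Proof. by move=> Lf; split; [exact: L2_int_sq|]. Qed.

Lemma hasE_sum (I : Type) (s : seq I) (F : I -> Omega -> R) v :
  (forall i, hasE (F i) (v i)) ->
  hasE (fun x => \sum_(i <- s) F i x) (\sum_(i <- s) v i).
Proof.
move=> hF; elim: s => [|i s ih].
  rewrite big_nil; under eq_fun do rewrite big_nil.
  by split; [exact: integrable0|rewrite /Rintegral integral0].
rewrite big_cons; under eq_fun do rewrite big_cons.
exact: hasE_D.
Qed.

Lemma hasE_le f g v w : hasE f v -> hasE g w -> (forall x, f x <= g x) -> v <= w.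
Proof. by move=> [If <-] [Ig <-] fg; apply: le_Rintegral. Qed.

Lemma hasE_QK (q : nat) (K : 'M[R]_q) (n : 'I_q -> Omega -> R) : (forall i, L2 (n i)) ->
  hasE (fun w => QK K (fun i => n i w) (fun i => n i w))
       (\sum_i \sum_j K i j * ip (n i) (n j)).
Proof.
by move=> Ln; apply: hasE_sum => i; apply: hasE_sum => j; apply: hasE_Z; exact: hasE_ip.
Qed.

Lemma hasE_step (q : nat) (K : 'M[R]_q) (h : R) (X a b : Omega -> R) (n : 'I_q -> Omega -> R) :
  L2 X -> L2 a -> L2 b -> (forall i, L2 (n i)) ->
  hasE (fun w => h * (2 * X w * a w + QK K (fun i => n i w) (fun i => n i w)) + 2 * X w * b w)
    (h * (2 * ip X a + \sum_i \sum_j K i j * ip (n i) (n j)) + 2 * ip X b).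
Proof.
move=> LX La Lb Ln; apply: hasE_D.
  apply: hasE_Z; apply: hasE_D; last exact: hasE_QK.
  by under eq_fun do rewrite -mulrA; apply: hasE_Z; exact: hasE_ip.
by under eq_fun do rewrite -mulrA; apply: hasE_Z; exact: hasE_ip.
Qed.

Lemma L2_mulmx (n m : nat) (Q : 'M[R]_(n, m)) (v : Omega -> 'cV[R]_m) l :
  (forall k, L2 (fun w => v w k 0)) -> L2 (fun w => (Q *m v w) l 0).
Proof. by move=> Lv; under eq_fun do rewrite mxE; apply: L2_sum => k; exact: L2Z. Qed.

Lemma n2_mulmx (n m : nat) (Q : 'M[R]_(n, m)) (v : Omega -> 'cV[R]_m) l :
  (forall k, L2 (fun w => v w k 0)) ->
  n2 (fun w => (Q *m v w) l 0) <= m%:R * rowsq Q l * \sum_k n2 (fun w => v w k 0).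
Proof. by move=> Lv; under eq_fun do rewrite mxE; exact: n2_lincomb. Qed.

End HasExpectation.

Lemma linear_growth (R : realType) (M : nat) (S e : nat -> R) (a c : R) :
  0 <= a -> 0 <= c -> (forall k, (k < M)%N -> 0 <= e k) -> S 0%N = 0 ->
  (forall j, (j < M)%N -> S j.+1 <= (1 + a) * S j + c * e j) ->
  forall j, (j <= M)%N -> S j <= expR (a * j%:R) * (c * \sum_(k < j) e k).
Proof.
move=> a0 c0 e0 S0 h; elim=> [|j ih] jM; first by rewrite S0 big_ord0 !mulr0.
apply: le_trans (h j jM) _.
have a1 : 1 + a <= expR a := expR_ge1Dx a.
have a10 : 0 <= 1 + a by rewrite addr_ge0.
have sj : 0 <= c * \sum_(k < j) e k.
  by rewrite mulr_ge0// sumr_ge0// => k _; apply: e0; exact: ltn_trans (ltn_ord k) jM.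
have ej := e0 j jM.
have -> : a * j.+1%:R = a + a * j%:R by rewrite -natr1; ring.
rewrite big_ord_recr/= mulrDr [leRHS]mulrDr; apply: lerD.
  apply: (@le_trans _ _ ((1 + a) * (expR (a * j%:R) * (c * \sum_(k < j) e k)))).
    by rewrite ler_wpM2l// ih// ltnW.
  rewrite expRD [leRHS](_ : _ = expR a * (expR (a * j%:R) * (c * \sum_(k < j) e k))).
    by rewrite ler_wpM2r// mulr_ge0 ?expR_ge0.
  ring.
rewrite ler_peMl ?mulr_ge0// -expR0 ler_expR.
by rewrite addr_ge0 ?mulr_ge0.
Qed.

(** * Second moments of the Euler scheme, uniformly in the step *)

Section Moments.
Context {R : realType} {d : measure_display} {Omega : measurableType d}.
Variables (Pr : probability Omega R) (Ft : R -> set_system Omega) (q : nat)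
  (K : 'M[R]_q) (W : R -> Omega -> 'cV[R]_q).
Hypotheses (hF : usual_filtration Pr Ft) (hW : wiener Pr Ft K W).
Local Notation L2 := (sqint Pr).
Local Notation n2 := (sqnorm Pr).

Definition Kabs : R := \sum_(i < q) \sum_(j < q) `|K i j|.

Lemma Kabs_ge0 : 0 <= Kabs.
Proof. by apply: sumr_ge0 => i _; apply: sumr_ge0 => j _. Qed.

(** [e k] plays the role of the energy of the control on cell [k]; the factor h is the gain of
    Cauchy-Schwarz for an integral over the cell. *)
Definition adapted_driver n (h : R) (M : nat) (cG : R) (e : nat -> R)
    (G : nat -> Omega -> 'cV[R]_n) := forall k l, (k < M)%N ->
  [/\ measurable_wrt (Ft (k.+1%:R * h)) (fun w => G k w l 0),
      L2 (fun w => G k w l 0) & n2 (fun w => G k w l 0) <= cG * (h * e k)].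

(** The constant depends on [T] but not on the step, which makes the remainders of the energy
    balance small after summation over all steps. *)
Lemma euler_moment n (A : 'M[R]_n) (N : 'I_q -> 'M[R]_n) (cG T : R) : 0 <= cG -> 0 <= T ->
  exists C : R, 0 <= C /\ forall (h dl : R) (M : nat) G (e : nat -> R),
  0 < dl -> dl <= 1 -> h = dl ^+ 2 -> M%:R * h <= T ->
  (forall k, (k < M)%N -> 0 <= e k) -> adapted_driver h M cG e G ->
  forall j, (j <= M)%N ->
    \sum_l n2 (fun w => euler W h A N G j w l 0) <= C * \sum_(k < M) e k.
Proof.
move=> cG0 T0.
pose ca l := n%:R * rowsq A l.
pose cn l := Kabs * \sum_i n%:R * rowsq (N i) l.
have ca0 l : 0 <= ca l by rewrite mulr_ge0// rowsq_ge0.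
have cn0 l : 0 <= cn l.
  by rewrite mulr_ge0 ?Kabs_ge0// sumr_ge0// => i _; rewrite mulr_ge0// rowsq_ge0.
pose al := 2 + \sum_l (3 * ca l + 2 * cn l).
have al0 : 0 <= al.
  by rewrite addr_ge0// sumr_ge0// => l _; rewrite addr_ge0// mulr_ge0.
exists (expR (al * T) * (4 * n%:R * cG)); split.
  by rewrite mulr_ge0 ?expR_ge0// !mulr_ge0.
move=> h dl M G e dl0 dl1 hE MT e0 hG.
have h0 : 0 < h by rewrite hE exprn_gt0.
have h1 : h <= 1 by rewrite hE expr_le1// ltW.
have FG k l : (k < M)%N -> measurable_wrt (Ft (k.+1%:R * h)) (fun w => G k w l 0).
  by move=> kM; case: (hG k l kM).
have LG k l : (k < M)%N -> L2 (fun w => G k w l 0) by move=> kM; case: (hG k l kM).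
pose xi := euler W h A N G.
pose S j := \sum_l n2 (fun w => xi j w l 0).
have S0 : S 0%N = 0 by rewrite /S big1// => l _; rewrite /xi/=; under eq_fun do rewrite mxE; exact: n20.
have step j : (j < M)%N -> S j.+1 <= (1 + al * h) * S j + 4 * n%:R * cG * e j.
  move=> jM; have Sj0 : 0 <= S j by apply: sumr_ge0 => l _; exact: n2_ge0.
  have ej := e0 j jM.
  pose u l := n2 (fun w => xi j w l 0).
  have -> : (1 + al * h) * S j + 4 * n%:R * cG * e j =
    \sum_l (u l + 2 * h * u l + h * (3 * ca l + 2 * cn l) * S j + 4 * cG * e j).
    rewrite !big_split/= -/(S j) sumr_const card_ord -mulr_suml -!mulr_sumr -/(S j).
    by rewrite -[_ *+ n]mulr_natr /al; ring.
  apply: ler_sum => l _.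
  have [Fl Ll] := euler_Ft hF hW A N (ltW h0) FG LG l (ltnW jM).
  have FM Q := euler_mulmx_Ft hF hW A N (ltW h0) FG LG Q l (ltnW jM).
  have LM (Q : 'M[R]_n) : L2 (fun w => (Q *m xi j w) l 0) := proj2 (FM Q).
  have Lxi k : L2 (fun w => xi j w k 0).
    by case: (euler_Ft hF hW A N (ltW h0) FG LG k (ltnW jM)).
  have s0 : 0 <= j%:R * h by rewrite mulr_ge0// ltW.
  have := step_bound hF hW s0 dl0 hE Fl (proj1 (FM A)) (fun i => proj1 (FM (N i)))
    Ll (LM A) (LG j l jM) (fun i => LM (N i)) erefl.
  set kap := \sum_i _; set X := fun w => euler W h A N G j w l 0.
  set a := fun w => (A *m _) l 0; set b := fun w => G j w l 0.
  have -> : (fun w => X w + h * a w + b w + \sum_i (N i *m euler W h A N G j w) l 0 *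
     increment W (j%:R * h) (j%:R * h + h) i w) = fun w => xi j.+1 w l 0.
    apply/funext => w; rewrite /xi euler_S; congr (_ + _); apply: eq_bigr => i _.
    by rewrite /cdW -natr1 mulrDl mul1r.
  move=> /le_trans; apply.
  have na : n2 a <= ca l * S j by exact: n2_mulmx.
  have nk : kap <= cn l * S j.
    apply: le_trans (kap_le K (fun i => LM (N i))) _; rewrite -mulrA ler_wpM2l ?Kabs_ge0//.
    rewrite mulr_suml; apply: ler_sum => i _; exact: n2_mulmx.
  have nb : n2 b <= cG * (h * e j) by case: (hG j l jM).
  have i1 := ip_le_eps ltr01 Ll (LM A); rewrite invr1 in i1.
  (* The weight h splits the correlation of state and input into h times the moment, absorbed by the
     growth factor, and the energy of the control on the cell. *)
  have i2 := ip_le_eps h0 Ll (LG j l jM).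
  rewrite -/X -/a -/b in i1 i2.
  have {}i1 := ler_wpM2l (ltW h0) i1.
  have nb' : h^-1 * n2 b <= cG * e j.
    by rewrite mulrC ler_pdivrMr//; apply: le_trans nb _; rewrite mulrA mulrAC.
  have nbd : dl^-1 * n2 b <= cG * e j.
    rewrite mulrC ler_pdivrMr//; apply: le_trans nb _.
    have : cG * e j * h <= cG * e j * dl.
      by apply: ler_wpM2l; [rewrite mulr_ge0|rewrite hE expr2 ler_piMl// ltW].
    lra.
  have nb2 : 2 * n2 b <= 2 * (cG * e j).
    have : cG * e j * h <= cG * e j * 1 by apply: ler_wpM2l => //; rewrite mulr_ge0.
    lra.
  have na2 : h ^+ 2 * n2 a <= h * (ca l * S j).
    rewrite expr2 -mulrA ler_pM2l//; apply: le_trans na.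
    by rewrite ler_piMl ?n2_ge0.
  have na1 : h * n2 a <= h * (ca l * S j) by rewrite ler_pM2l.
  have nk1 : h * kap <= h * (cn l * S j) by rewrite ler_pM2l.
  have nk2 : dl * h * kap <= h * (cn l * S j).
    apply: (@le_trans _ _ (dl * (h * (cn l * S j)))).
      by rewrite -mulrA ler_wpM2l// ltW.
    by rewrite ler_piMl//; apply: mulr_ge0; [exact: ltW|rewrite mulr_ge0].
  have uE : n2 X = u l by [].
  rewrite uE in i1 i2 *; lra.
move=> j jM; apply: le_trans (linear_growth _ _ e0 S0 step jM) _.
- by rewrite mulr_ge0// ltW.
- by rewrite !mulr_ge0.
rewrite -[leRHS]mulrA; apply: ler_pM; rewrite ?expR_ge0//.
- by rewrite mulr_ge0 ?mulr_ge0// sumr_ge0// => k _; apply: e0; exact: leq_trans (ltn_ord k) jM.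
- rewrite ler_expR -mulrA ler_wpM2l//; apply: le_trans MT.
  by rewrite mulrC ler_wpM2r ?ler_nat// ltW.
rewrite ler_wpM2l ?mulr_ge0//.
rewrite -!(big_mkord xpredT e) (big_cat_nat (leq0n j) jM)/= lerDl big_nat_cond sumr_ge0// => k.
by rewrite andbT => /andP[_]; exact: e0.
Qed.

End Moments.

Section Energy.
Context {R : realType} {d : measure_display} {Omega : measurableType d}.
Variables (Pr : probability Omega R) (Ft : R -> set_system Omega) (q : nat)
  (K : 'M[R]_q) (W : R -> Omega -> 'cV[R]_q).
Hypotheses (hF : usual_filtration Pr Ft) (hW : wiener Pr Ft K W).
Local Notation L2 := (sqint Pr).
Local Notation n2 := (sqnorm Pr).
Local Notation ip := (sqip Pr).
Variables (n m : nat) (A : 'M[R]_n) (N : 'I_q -> 'M[R]_n) (B : 'M[R]_(n, m))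
  (sg : 'I_n -> R) (T : R).
Hypotheses (sg0 : forall l, 0 < sg l) (T0 : 0 <= T).

Local Notation pid k := (pid_mx k : 'M[R]_n).

(* The Euler scheme of the system truncated to the first k coordinates. *)
Definition txi (h : R) (U : nat -> Omega -> 'cV[R]_m) (k : nat) :=
  euler W h (trunc k A) (fun i => trunc k (N i)) (fun j w => pid k *m (B *m U j w)).

(** Measurability is asked of the image under [B], because the state equation reveals the integrated
    input only through [B]. *)
Definition input_bound (h : R) (M : nat) (e : nat -> R) (U : nat -> Omega -> 'cV[R]_m) :=
  forall j, (j < M)%N ->
  [/\ 0 <= e j, forall l, measurable_wrt (Ft (j.+1%:R * h)) (fun w => (B *m U j w) l 0),
      forall i, L2 (fun w => U j w i 0) & \sum_i n2 (fun w => U j w i 0) <= h * e j].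

Lemma pid_txi h U k j w : pid k *m txi h U k j w = txi h U k j w.
Proof.
have idem (v : 'cV[R]_n) : pid k *m (pid k *m v) = pid k *m v.
  apply/matrixP => a b; rewrite !pid_mulmxE; case: (a < k)%N; rewrite ?mul1r ?mul0r//.
elim: j => [|j ih]; first by rewrite mulmx0.
rewrite /txi /= -/(txi h U k j w) !mulmxDr ih; congr (_ + _ + _ + _).
- by rewrite -scalemxAr /trunc -!mulmxA idem.
- exact: idem.
- rewrite mulmx_sumr; apply: eq_bigr => i _.
  by rewrite -scalemxAr /trunc -!mulmxA idem.
Qed.

Let cB : R := \sum_l m%:R * rowsq B l.

Let cB0 : 0 <= cB.
Proof. by apply: sumr_ge0 => l _; rewrite mulr_ge0// rowsq_ge0. Qed.

Lemma txi_driver h M e U k : 0 <= h -> input_bound h M e U ->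
  adapted_driver Pr Ft h M cB e (fun j w => pid k *m (B *m U j w)).
Proof.
move=> h0 hU j l jM; have [ej Fj Lj nj] := hU j jM.
have LB l' : L2 (fun w => (B *m U j w) l' 0) by exact: L2_mulmx.
have nB : n2 (fun w => (B *m U j w) l 0) <= cB * (h * e j).
  apply: le_trans (n2_mulmx _ _ Lj) _; apply: ler_pM => //.
  - by rewrite mulr_ge0// rowsq_ge0.
  - by apply: sumr_ge0 => i _; exact: n2_ge0.
  - rewrite /cB (bigD1 l)//= lerDl; apply: sumr_ge0 => i _.
    by rewrite mulr_ge0// rowsq_ge0.
under eq_fun do rewrite pid_mulmxE; split.
- by apply: mwrtZ => //; apply: (Ft_sigma hF); rewrite mulr_ge0.
- exact: L2Z.
- rewrite n2Z//; apply: le_trans nB; rewrite -[leRHS]mul1r ler_wpM2r ?n2_ge0//.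
  by case: (l < k)%N; rewrite ?expr1n ?expr0n.
Qed.

Definition Vst (s : R) (xi eta : Omega -> 'cV[R]_n) : R :=
  \sum_l (sg l * n2 (fun w => xi w l 0 - eta w l 0) +
          s ^+ 2 * ((sg l)^-1 * n2 (fun w => xi w l 0 + eta w l 0))).

Lemma Vst_ge0 s xi eta : 0 <= Vst s xi eta.
Proof.
apply: sumr_ge0 => l _; apply: addr_ge0; first by rewrite mulr_ge0 ?n2_ge0// ltW.
by rewrite mulr_ge0 ?sqr_ge0// mulr_ge0 ?n2_ge0// invr_ge0 ltW.
Qed.

(** All remainders of [step_bound] are of order dl (h E + e_j), with E the total energy of the
    control. Summed over the steps this is at most dl (T + 1) E, which tends to 0 with the step. *)
Lemma err_le (dl h E ej ca cn cb na nb kap : R) : 0 < dl -> dl <= 1 -> h = dl ^+ 2 ->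
  0 <= E -> 0 <= ej -> 0 <= ca -> 0 <= cn -> 0 <= cb -> 0 <= nb -> 0 <= na ->
  na <= ca * E -> kap <= cn * E -> nb <= cb * (h * ej) ->
  2 * h ^+ 2 * na + 2 * nb + dl^-1 * nb + dl * h * kap <=
  (2 * ca + cn + 3 * cb) * (dl * (h * E + ej)).
Proof.
move=> dl0 dl1 hE E0 e0 ca0 cn0 cb0 nb0 na0 hna hk hnb.
have h0 : 0 < h by rewrite hE exprn_gt0.
have hd : h <= dl by rewrite hE expr2 ler_piMl// ltW.
have cbe : 0 <= cb * ej by rewrite mulr_ge0.
have t1 : 2 * h ^+ 2 * na <= 2 * ca * (dl * (h * E)).
  have : h * (h * na) <= dl * (h * (ca * E)).
    apply: ler_pM => //; [exact: ltW|by rewrite mulr_ge0// ltW|by rewrite ler_pM2l].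
  rewrite expr2; lra.
have t2 : nb <= cb * (dl * ej).
  apply: le_trans hnb _; have : (cb * ej) * h <= (cb * ej) * dl by rewrite ler_wpM2l.
  lra.
have t3 : dl^-1 * nb <= cb * (dl * ej).
  rewrite mulrC ler_pdivrMr//; apply: le_trans hnb _; rewrite hE.
  by rewrite le_eqVlt; apply/orP; left; apply/eqP; ring.
have t4 : dl * h * kap <= cn * (dl * (h * E)).
  have : dl * h * kap <= dl * h * (cn * E) by rewrite ler_wpM2l// mulr_ge0// ltW.
  lra.
have dhE : 0 <= dl * (h * E) by rewrite !mulr_ge0// ltW.
have de : 0 <= dl * ej by rewrite mulr_ge0// ltW.
have := mulr_ge0 ca0 de; have := mulr_ge0 cn0 de; have := mulr_ge0 cb0 dhE.
lra.
Qed.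

(* One step of either half of the error storage ([c = -1] for xi - eta, [c = 1]
   for xi + eta). *)
Lemma half_step (k : 'I_n) (c : R) : c ^+ 2 = 1 -> exists Ce : R, 0 <= Ce /\
  forall (h dl : R) (M : nat) U (e : nat -> R),
  0 < dl -> dl <= 1 -> h = dl ^+ 2 -> M%:R * h <= T -> input_bound h M e U ->
  forall j l, (j < M)%N ->
  let xi := txi h U k.+1 in let eta := txi h U k in
  let a w := (trunc k.+1 A *m xi j w) l 0 + c * (trunc k A *m eta j w) l 0 in
  let b w := (pid k.+1 *m (B *m U j w)) l 0 + c * (pid k *m (B *m U j w)) l 0 in
  let nn i w := (trunc k.+1 (N i) *m xi j w) l 0 + c * (trunc k (N i) *m eta j w) l 0 in
  let X w := xi j w l 0 + c * eta j w l 0 in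
  [/\ L2 X, L2 a, L2 b, forall i, L2 (nn i) &
  n2 (fun w => xi j.+1 w l 0 + c * eta j.+1 w l 0) <=
  n2 X + 2 * h * ip X a + 2 * ip X b + h * (\sum_i \sum_i' K i i' * ip (nn i) (nn i')) +
  Ce * (dl * (h * (\sum_(i < M) e i) + e j))].
Proof.
move=> c1.
(* Second-moment bounds for the two schemes, both independent of the step, feed the hypotheses of
   [err_le]. *)
have [C1 [C10 hC1]] := euler_moment hF hW (trunc k.+1 A) (fun i => trunc k.+1 (N i)) cB0 T0.
have [C2 [C20 hC2]] := euler_moment hF hW (trunc k A) (fun i => trunc k (N i)) cB0 T0.
pose ca (M1 M2 : 'M[R]_n) l := 2 * (n%:R * rowsq M1 l * C1) + 2 * (n%:R * rowsq M2 l * C2).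
have ca0 M1 M2 l : 0 <= ca M1 M2 l.
  by rewrite addr_ge0// mulr_ge0// mulr_ge0// mulr_ge0// rowsq_ge0.
pose cn l := Kabs K * \sum_i ca (trunc k.+1 (N i)) (trunc k (N i)) l.
have cn0 l : 0 <= cn l by rewrite mulr_ge0 ?Kabs_ge0// sumr_ge0.
pose Cl l := 2 * ca (trunc k.+1 A) (trunc k A) l + cn l + 3 * (4 * cB).
have Cl0 l : 0 <= Cl l.
  apply: addr_ge0; last by rewrite mulr_ge0// mulr_ge0.
  by apply: addr_ge0 => //; rewrite mulr_ge0.
exists (\sum_l Cl l); split; first exact: sumr_ge0.
move=> h dl M U e dl0 dl1 hE MT hU j l jM xi eta a b nn X.
have h0 : 0 < h by rewrite hE exprn_gt0.
have h0' := ltW h0.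
have e0 i : (i < M)%N -> 0 <= e i by move=> iM; case: (hU i iM).
have D1 := txi_driver k.+1 h0' hU; have D2 := txi_driver k h0' hU.
have FG1 i l' : (i < M)%N -> measurable_wrt (Ft (i.+1%:R * h)) (fun w => (pid k.+1 *m (B *m U i w)) l' 0).
  by move=> iM; case: (D1 i l' iM).
have FG2 i l' : (i < M)%N -> measurable_wrt (Ft (i.+1%:R * h)) (fun w => (pid k *m (B *m U i w)) l' 0).
  by move=> iM; case: (D2 i l' iM).
have LG1 i l' : (i < M)%N -> L2 (fun w => (pid k.+1 *m (B *m U i w)) l' 0).
  by move=> iM; case: (D1 i l' iM).
have LG2 i l' : (i < M)%N -> L2 (fun w => (pid k *m (B *m U i w)) l' 0).
  by move=> iM; case: (D2 i l' iM).
have jM' := ltnW jM.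
have X1 l' := euler_Ft hF hW (trunc k.+1 A) (fun i => trunc k.+1 (N i)) h0' FG1 LG1 l' jM'.
have X2 l' := euler_Ft hF hW (trunc k A) (fun i => trunc k (N i)) h0' FG2 LG2 l' jM'.
have Q1 Q l' := euler_mulmx_Ft hF hW (trunc k.+1 A) (fun i => trunc k.+1 (N i)) h0' FG1 LG1 Q l' jM'.
have Q2 Q l' := euler_mulmx_Ft hF hW (trunc k A) (fun i => trunc k (N i)) h0' FG2 LG2 Q l' jM'.
have s0 : 0 <= j%:R * h by rewrite mulr_ge0.
have sF := Ft_sigma hF s0.
have comb f g : measurable_wrt (Ft (j%:R * h)) f /\ L2 f -> measurable_wrt (Ft (j%:R * h)) g /\ L2 g ->
    measurable_wrt (Ft (j%:R * h)) (fun w => f w + c * g w) /\ L2 (fun w => f w + c * g w).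
  by move=> [Ff Lf] [Fg Lg]; split; [apply: mwrtD => //; exact: mwrtZ|apply: L2D => //; exact: L2Z].
have [FX LX] := comb _ _ (X1 l) (X2 l).
have [Fa La] := comb _ _ (Q1 (trunc k.+1 A) l) (Q2 (trunc k A) l).
have hn i := comb _ _ (Q1 (trunc k.+1 (N i)) l) (Q2 (trunc k (N i)) l).
have Lb : L2 b by apply: L2D; [exact: LG1|apply: L2Z; exact: LG2].
have Ln i : L2 (nn i) := proj2 (hn i).
split => //.
have E0 : 0 <= \sum_(i < M) e i by apply: sumr_ge0 => i _; exact: e0.
have m1 := hC1 _ _ _ _ _ dl0 dl1 hE MT e0 D1 j jM'.
have m2 := hC2 _ _ _ _ _ dl0 dl1 hE MT e0 D2 j jM'.
have n2c f g : L2 f -> L2 g -> n2 (fun w => f w + c * g w) <= 2 * n2 f + 2 * n2 g.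
  move=> Lf Lg; apply: le_trans (n2D_le Lf (L2Z c Lg)) _.
  by rewrite n2Z// c1 mul1r.
have nca M1 M2 : n2 (fun w => (M1 *m xi j w) l 0 + c * (M2 *m eta j w) l 0) <=
    ca M1 M2 l * \sum_(i < M) e i.
  apply: le_trans (n2c _ _ (proj2 (Q1 M1 l)) (proj2 (Q2 M2 l))) _.
  rewrite /ca [leRHS]mulrDl; apply: lerD; rewrite -[leRHS]mulrA ler_pM2l//.
    apply: le_trans (n2_mulmx _ _ (fun l' => proj2 (X1 l'))) _.
    by rewrite -[leRHS]mulrA ler_wpM2l// mulr_ge0// rowsq_ge0.
  apply: le_trans (n2_mulmx _ _ (fun l' => proj2 (X2 l'))) _.
  by rewrite -[leRHS]mulrA ler_wpM2l// mulr_ge0// rowsq_ge0.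
have nb : n2 b <= 4 * cB * (h * e j).
  apply: le_trans (n2c _ _ (LG1 j l jM) (LG2 j l jM)) _.
  have [_ _ h1] := D1 j l jM; have [_ _ h2] := D2 j l jM; lra.
have nk : \sum_i \sum_i' K i i' * ip (nn i) (nn i') <= cn l * \sum_(i < M) e i.
  apply: le_trans (kap_le K Ln) _; rewrite -mulrA ler_wpM2l ?Kabs_ge0//.
  rewrite mulr_suml; apply: ler_sum => i _; exact: nca.
have := step_bound hF hW s0 dl0 hE FX Fa (fun i => proj1 (hn i)) LX La Lb Ln erefl.
rewrite (_ : (fun w => _) = fun w => xi j.+1 w l 0 + c * eta j.+1 w l 0); last first.
  apply/funext => w; rewrite /xi /eta /txi !euler_S -/(txi h U k.+1 j w) -/(txi h U k j w).
  have SE : \sum_i nn i w * increment W (j%:R * h) (j%:R * h + h) i w =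
      \sum_i (trunc k.+1 (N i) *m txi h U k.+1 j w) l 0 * cdW W h j i w +
      c * \sum_i (trunc k (N i) *m txi h U k j w) l 0 * cdW W h j i w.
    rewrite mulr_sumr -big_split/=; apply: eq_bigr => i _.
    have -> : increment W (j%:R * h) (j%:R * h + h) i w = cdW W h j i w.
      by rewrite /cdW -natr1 mulrDl mul1r.
    rewrite /nn /xi /eta; ring.
  rewrite SE /X /a /b /xi /eta; ring.
move=> /le_trans; apply; rewrite lerD2l.
have := err_le dl0 dl1 hE E0 (e0 j jM) (ca0 (trunc k.+1 A) (trunc k A) l) (cn0 l)
  (mulr_ge0 (ler0n R 4) cB0) (n2_ge0 _ _) (n2_ge0 _ _) (nca _ _) nk nb.
move=> /le_trans; apply; rewrite ler_wpM2r//.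
  by rewrite mulr_ge0 ?(ltW dl0)// addr_ge0 ?mulr_ge0 ?e0.
by rewrite (bigD1 l)//= lerDl; exact: sumr_ge0.
Qed.

End Energy.

Section EnergyStep.
Context {R : realType} {d : measure_display} {Omega : measurableType d}.
Variables (Pr : probability Omega R) (Ft : R -> set_system Omega) (q : nat)
  (K : 'M[R]_q) (W : R -> Omega -> 'cV[R]_q).
Hypotheses (hF : usual_filtration Pr Ft) (hW : wiener Pr Ft K W).
Local Notation L2 := (sqint Pr).
Local Notation n2 := (sqnorm Pr).
Local Notation ip := (sqip Pr).
Variables (n m p : nat) (A : 'M[R]_n) (N : 'I_q -> 'M[R]_n) (B : 'M[R]_(n, m))
  (C : 'M[R]_(p, n)) (sg : 'I_n -> R) (beta T : R).
Hypotheses (sg0 : forall l, 0 < sg l) (hO : obs_ineq K A N C sg beta)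
  (hR : reach_ineq K A N B sg beta) (T0 : 0 <= T).
Local Notation txi h U k := (txi W A N B h U k).

Lemma energy_step (k : 'I_n) : exists Cst : R, 0 <= Cst /\
  forall (h dl : R) (M : nat) U (e : nat -> R),
  0 < dl -> dl <= 1 -> h = dl ^+ 2 -> M%:R * h <= T -> input_bound Pr Ft B h M e U ->
  forall j, (j < M)%N ->
  Vst Pr sg (sg k) (txi h U k.+1 j.+1) (txi h U k j.+1) <=
  (1 + beta * h) * Vst Pr sg (sg k) (txi h U k.+1 j) (txi h U k j) -
  h * (\sum_c n2 (fun w => (C *m (txi h U k.+1 j w - txi h U k j w)) c 0)) +
  4 * sg k ^+ 2 * e j + Cst * (dl * (h * (\sum_(i < M) e i) + e j)).
Proof.
have cm : (-1 : R) ^+ 2 = 1 by ring.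
have cp : (1 : R) ^+ 2 = 1 by ring.
have [Cm [Cm0 hm]] := half_step hF hW A N B T0 k cm.
have [Cp [Cp0 hp]] := half_step hF hW A N B T0 k cp.
set s := sg k.
have w0 l : 0 <= s ^+ 2 * (sg l)^-1 by rewrite mulr_ge0 ?sqr_ge0// invr_ge0 ltW.
exists (\sum_l (sg l * Cm + s ^+ 2 * (sg l)^-1 * Cp)); split.
  by apply: sumr_ge0 => l _; rewrite addr_ge0// mulr_ge0// ltW.
move=> h dl M U e dl0 dl1 hE MT hU j jM.
have h0 : 0 < h by rewrite hE exprn_gt0.
pose xi := txi h U k.+1; pose eta := txi h U k.
have hm' l := hm h dl M U e dl0 dl1 hE MT hU j l jM.
have hp' l := hp h dl M U e dl0 dl1 hE MT hU j l jM.
pose a c l w := (trunc k.+1 A *m xi j w) l 0 + c * (trunc k A *m eta j w) l 0.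
pose b c l w := (pid_mx k.+1 *m (B *m U j w)) l 0 + c * ((pid_mx k : 'M[R]_n) *m (B *m U j w)) l 0.
pose nn c l i w := (trunc k.+1 (N i) *m xi j w) l 0 + c * (trunc k (N i) *m eta j w) l 0.
pose X c l w := xi j w l 0 + c * eta j w l 0.
(* The leading change of one coordinate of either half over a step, and below it the function of the
   outcome whose mean it is. *)
pose phi c l := h * (2 * ip (X c l) (a c l) +
   \sum_i \sum_i' K i i' * ip (nn c l i) (nn c l i')) + 2 * ip (X c l) (b c l).
pose f c l w := h * (2 * X c l w * a c l w + QK K (fun i => nn c l i w) (fun i => nn c l i w)) +
   2 * X c l w * b c l w.
have Em l : hasE Pr (f (-1) l) (phi (-1) l).
  by have [LX La Lb Ln _] := hm' l; exact: hasE_step.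
have Ep l : hasE Pr (f 1 l) (phi 1 l).
  by have [LX La Lb Ln _] := hp' l; exact: hasE_step.
have [ej FU LU nU] := hU j jM.
have Lm l : L2 (fun w => xi j w l 0 - eta j w l 0).
  have [+ _ _ _ _] := hm' l.
  by rewrite (_ : (fun w => _) = fun w => xi j w l 0 - eta j w l 0)//; apply/funext => w; rewrite mulN1r.
have Lp l : L2 (fun w => xi j w l 0 + eta j w l 0).
  have [+ _ _ _ _] := hp' l.
  by rewrite (_ : (fun w => _) = fun w => xi j w l 0 + eta j w l 0)//; apply/funext => w; rewrite mul1r.
have XmE l : X (-1) l = fun w => xi j w l 0 - eta j w l 0.
  by apply/funext => w; rewrite /X mulN1r.
have XpE l : X 1 l = fun w => xi j w l 0 + eta j w l 0.
  by apply/funext => w; rewrite /X mul1r.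
have LC c : L2 (fun w => (C *m (xi j w - eta j w)) c 0).
  by apply: L2_mulmx => l; under eq_fun do rewrite !mxE; exact: Lm.
have EL : hasE Pr (fun w => \sum_l (sg l * f (-1) l w + s ^+ 2 * ((sg l)^-1 * f 1 l w)))
    (\sum_l (sg l * phi (-1) l + s ^+ 2 * ((sg l)^-1 * phi 1 l))).
  by apply: hasE_sum => l; apply: hasE_D; do ?apply: hasE_Z; [exact: Em|exact: Ep].
have ER : hasE Pr (fun w => h * beta * storage sg s (fun l => xi j w l 0 - eta j w l 0)
      (fun l => xi j w l 0 + eta j w l 0) + (- h) * (\sum_c (C *m (xi j w - eta j w)) c 0 ^+ 2) +
      4 * s ^+ 2 * h^-1 * \sum_i U j w i 0 ^+ 2)
    (h * beta * Vst Pr sg s (xi j) (eta j) +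
     (- h) * (\sum_c n2 (fun w => (C *m (xi j w - eta j w)) c 0)) +
     4 * s ^+ 2 * h^-1 * \sum_i n2 (fun w => U j w i 0)).
  apply: hasE_D; [apply: hasE_D|]; apply: hasE_Z; apply: hasE_sum => i.
  - by apply: hasE_D; do ?apply: hasE_Z; apply: hasE_sq.
  - exact: hasE_sq.
  - exact: hasE_sq.
have Ksym := K_sym hW; have Kpsd := K_psd hF hW.
(* [storage_pointwise] holds for each outcome; taking means turns it into a bound for the weighted
   sum of the [phi]. *)
have /(hasE_le EL ER) le1 w : \sum_l (sg l * f (-1) l w + s ^+ 2 * ((sg l)^-1 * f 1 l w)) <=
    h * beta * storage sg s (fun l => xi j w l 0 - eta j w l 0)
      (fun l => xi j w l 0 + eta j w l 0) + (- h) * (\sum_c (C *m (xi j w - eta j w)) c 0 ^+ 2) +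
      4 * s ^+ 2 * h^-1 * \sum_i U j w i 0 ^+ 2.
  have kxi := pid_txi W A N B h U k.+1 j w; have keta := pid_txi W A N B h U k j w.
  have := storage_pointwise Ksym Kpsd sg0 hO hR (U j w) h0 kxi keta
    (erefl (sg k)) (fun=> erefl) (fun=> erefl).
  rewrite mulNr; apply: le_trans; rewrite le_eqVlt; apply/orP; left; apply/eqP.
  apply: eq_bigr => l _; rewrite /f /X /a /b /nn -/xi -/eta !pid_mulmxE.
  rewrite !(trunc_mulmxE _ _ kxi) !(trunc_mulmxE _ _ keta).
  congr (_ * (_ * (_ + _) + _) + _ * (_ * (_ * (_ + _) + _))); try ring.
  - by congr QK; apply/funext => i;
      rewrite (trunc_mulmxE _ _ kxi) (trunc_mulmxE _ _ keta); ring.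
  - by congr QK; apply/funext => i;
      rewrite (trunc_mulmxE _ _ kxi) (trunc_mulmxE _ _ keta); ring.
set Er := dl * (h * _ + e j).
apply: (@le_trans _ _ (\sum_l (sg l * (n2 (X (-1) l) + phi (-1) l + Cm * Er) +
     s ^+ 2 * ((sg l)^-1 * (n2 (X 1 l) + phi 1 l + Cp * Er))))).
  apply: ler_sum => l _; apply: lerD.
    have hml : n2 (fun w => xi j.+1 w l 0 + -1 * eta j.+1 w l 0) <= n2 (X (-1) l) + 2 * h * ip (X (-1) l) (a (-1) l) +
      2 * ip (X (-1) l) (b (-1) l) + h * (\sum_i \sum_i' K i i' * ip (nn (-1) l i) (nn (-1) l i')) + Cm * Er.
      by case: (hm' l).
    have -> : (fun w => xi j.+1 w l 0 - eta j.+1 w l 0) = fun w => xi j.+1 w l 0 + -1 * eta j.+1 w l 0.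
      by apply/funext => w; rewrite mulN1r.
    rewrite ler_pM2l//; apply: le_trans hml _; rewrite /phi.
    by rewrite le_eqVlt; apply/orP; left; apply/eqP; ring.
  have hpl : n2 (fun w => xi j.+1 w l 0 + 1 * eta j.+1 w l 0) <= n2 (X (1) l) + 2 * h * ip (X (1) l) (a (1) l) +
      2 * ip (X (1) l) (b (1) l) + h * (\sum_i \sum_i' K i i' * ip (nn (1) l i) (nn (1) l i')) + Cp * Er.
    by case: (hp' l).
  have -> : (fun w => xi j.+1 w l 0 + eta j.+1 w l 0) = fun w => xi j.+1 w l 0 + 1 * eta j.+1 w l 0.
    by apply/funext => w; rewrite mul1r.
  rewrite !mulrA; apply: ler_wpM2l => //; apply: le_trans hpl _; rewrite /phi.
  by rewrite /Er le_eqVlt; apply/orP; left; apply/eqP; ring.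
have -> : \sum_l (sg l * (n2 (X (-1) l) + phi (-1) l + Cm * Er) +
     s ^+ 2 * ((sg l)^-1 * (n2 (X 1 l) + phi 1 l + Cp * Er))) =
  Vst Pr sg s (xi j) (eta j) + \sum_l (sg l * phi (-1) l + s ^+ 2 * ((sg l)^-1 * phi 1 l)) +
  (\sum_l (sg l * Cm + s ^+ 2 * (sg l)^-1 * Cp)) * Er.
  rewrite mulr_suml -!big_split/=; apply: eq_bigr => l _; rewrite XmE XpE; ring.
(* The h^-1 left by completing the square is cancelled by the factor h in [input_bound]. *)
have hU' : 4 * s ^+ 2 * h^-1 * (\sum_i n2 (fun w => U j w i 0)) <= 4 * s ^+ 2 * e j.
  rewrite -[leLHS]mulrA; apply: ler_wpM2l; first by rewrite mulr_ge0 ?sqr_ge0.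
  by rewrite mulrC ler_pdivrMr// mulrC.
rewrite -/xi -/eta.
move: le1 hU'.
set V := Vst _ _ _ _ _; move=> le1 hU'; lra.
Qed.

End EnergyStep.

(** The triangle inequality on squared norms: if the norm of F i is at most a i times a common c,
    the bound is the square of c times the sum of the a i. Unlike the version with roots it
    accommodates additive errors. *)
Lemma n2_sum_weighted d (T : measurableType d) (R : realType)
    (mu : {measure set T -> \bar R}) (I : Type) (s : seq I) (a : I -> R) (F : I -> T -> R) :
  (forall i, 0 < a i) -> (forall i, sqint mu (F i)) ->
  sqnorm mu (fun x => \sum_(i <- s) F i x) <=
  (\sum_(i <- s) a i) * (\sum_(i <- s) (a i)^-1 * sqnorm mu (F i)).
Proof.
move=> a0 LF; rewrite n2_ip ip_suml//; last exact: L2_sum.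
pose g i j := 2^-1 * (a j * (a i)^-1 * sqnorm mu (F i)) + 2^-1 * (a i * (a j)^-1 * sqnorm mu (F j)).
apply: (@le_trans _ _ (\sum_(i <- s) \sum_(j <- s) g i j)).
  apply: ler_sum => i _; rewrite ip_sumr//; apply: ler_sum => j _.
  have c0 : 0 < a j * (a i)^-1 by rewrite mulr_gt0// invr_gt0.
  have := ip_le_eps c0 (LF i) (LF j); rewrite invfM invrK (mulrC (a j)^-1) /g; lra.
rewrite le_eqVlt; apply/orP; left; apply/eqP.
under eq_bigr do rewrite big_split/= -mulr_sumr -mulr_sumr.
rewrite big_split/= -!mulr_sumr.
have E1 : \sum_(i <- s) \sum_(j <- s) a j * (a i)^-1 * sqnorm mu (F i) =
    (\sum_(i <- s) a i) * (\sum_(i <- s) (a i)^-1 * sqnorm mu (F i)).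
  rewrite mulr_sumr; apply: eq_bigr => i _; rewrite mulr_suml.
  by apply: eq_bigr => j _; rewrite mulrA.
rewrite E1 exchange_big/= E1; lra.
Qed.

(** The discrete form of multiplying by e^(-b t). Weights at the right end of each step turn the
    growth factor into a decreasing sequence, as (1 + b h) e^(-b h) is at most 1; the final storage
    is nonnegative and is dropped. *)
Lemma weighted_gronwall (R : realType) (M : nat) (V pj rj : nat -> R) (b h : R) :
  0 <= b -> 0 <= h -> V 0%N = 0 -> (forall j, 0 <= V j) ->
  (forall j, (j < M)%N -> V j.+1 <= (1 + b * h) * V j - pj j + rj j) ->
  \sum_(j < M) expR (- (b * (j.+1%:R * h))) * pj j <=
  \sum_(j < M) expR (- (b * (j.+1%:R * h))) * rj j.
Proof.
move=> b0 h0 V0 Vge step.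
suff : forall k, (k <= M)%N ->
    expR (- (b * (k%:R * h))) * V k + \sum_(j < k) expR (- (b * (j.+1%:R * h))) * pj j <=
    \sum_(j < k) expR (- (b * (j.+1%:R * h))) * rj j.
  move=> /(_ M (leqnn M)) hM; apply: le_trans hM.
  by rewrite lerDr mulr_ge0 ?expR_ge0.
elim=> [|k ih] kM; first by rewrite !big_ord0 V0 mulr0 addr0.
have {}ih := ih (ltnW kM).
rewrite !big_ord_recr/=; set w := expR (- (b * (k.+1%:R * h))).
have w0 : 0 <= w by exact: expR_ge0.
have h1 := ler_wpM2l w0 (step k kM).
have h2 : w * (1 + b * h) * V k <= expR (- (b * (k%:R * h))) * V k.
  rewrite ler_wpM2r//.
  apply: (@le_trans _ _ (w * expR (b * h))); first by rewrite ler_wpM2l// expR_ge1Dx.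
  rewrite /w -expRD ler_expR le_eqVlt; apply/orP; left; apply/eqP.
  rewrite -natr1; ring.
lra.
Qed.

(** * Summation over the time steps and over the removed coordinates *)

Section EnergySum.
Context {R : realType} {d : measure_display} {Omega : measurableType d}.
Variables (Pr : probability Omega R) (Ft : R -> set_system Omega) (q : nat)
  (K : 'M[R]_q) (W : R -> Omega -> 'cV[R]_q).
Hypotheses (hF : usual_filtration Pr Ft) (hW : wiener Pr Ft K W).
Local Notation L2 := (sqint Pr).
Local Notation n2 := (sqnorm Pr).
Variables (n m p : nat) (A : 'M[R]_n) (N : 'I_q -> 'M[R]_n) (B : 'M[R]_(n, m))
  (C : 'M[R]_(p, n)) (sg : 'I_n -> R) (beta T : R).
Hypotheses (sg0 : forall l, 0 < sg l) (hO : obs_ineq K A N C sg beta)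
  (hR : reach_ineq K A N B sg beta) (T0 : 0 <= T) (beta0 : 0 <= beta).
Local Notation txi h U k := (txi W A N B h U k).
Local Notation wt h j := (expR (- (beta * (j.+1%:R * h)))).

Lemma energy_sum (k : 'I_n) : exists Cst : R, 0 <= Cst /\
  forall (h dl : R) (M : nat) U (e : nat -> R),
  0 < dl -> dl <= 1 -> h = dl ^+ 2 -> M%:R * h <= T -> input_bound Pr Ft B h M e U ->
  \sum_(j < M) wt h j *
    (h * \sum_c n2 (fun w => (C *m (txi h U k.+1 j w - txi h U k j w)) c 0)) <=
  4 * sg k ^+ 2 * \sum_(j < M) wt h j * e j + Cst * (dl * \sum_(j < M) e j).
Proof.
have [C0 [C00 hC]] := energy_step hF hW sg0 hO hR T0 k.
(* Each of the M steps contributes h E to the remainder, at most T E in total; the individual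
   energies add another E. *)
exists (C0 * (T + 1)); split; first by rewrite mulr_ge0// addr_ge0.
move=> h dl M U e dl0 dl1 hE MT hU.
have h0 : 0 < h by rewrite hE exprn_gt0.
have step := hC h dl M U e dl0 dl1 hE MT hU.
set E := \sum_(i < M) e i in step *.
have e0 j : (j < M)%N -> 0 <= e j by move=> jM; case: (hU j jM).
have E0 : 0 <= E by apply: sumr_ge0 => j _; exact: e0.
pose V j := Vst Pr sg (sg k) (txi h U k.+1 j) (txi h U k j).
pose rj j := 4 * sg k ^+ 2 * e j + C0 * (dl * (h * E + e j)).
have V0 : V 0%N = 0.
  rewrite /V /Vst big1// => l _ /=.
  under eq_fun do rewrite mxE subr0; rewrite n20.
  by under eq_fun do rewrite mxE addr0; rewrite n20 !mulr0 addr0.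
have Vge j : 0 <= V j by exact: Vst_ge0.
have := weighted_gronwall (rj := rj) beta0 (ltW h0) V0 Vge.
move=> /(_ M (fun j => h * \sum_c n2 (fun w => (C *m (txi h U k.+1 j w - txi h U k j w)) c 0))).
move=> H; apply: le_trans (H _) _.
  by move=> j jM; have := step j jM; rewrite /V /rj; lra.
apply: (@le_trans _ _ (\sum_(j < M) (4 * sg k ^+ 2 * (wt h j * e j) +
    C0 * (dl * (h * E + e j))))).
  apply: ler_sum => j _; rewrite /rj mulrDr; apply: lerD; first by rewrite mulrCA.
  rewrite ler_piMl//.
    have ej := e0 j (ltn_ord j).
    by rewrite mulr_ge0// mulr_ge0 ?(ltW dl0)// addr_ge0// mulr_ge0// ltW.
  by rewrite -expR0 ler_expR oppr_le0 mulr_ge0// mulr_ge0// ltW.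
rewrite big_split/= -mulr_sumr lerD2l -!mulr_sumr -mulrA ler_wpM2l//.
rewrite mulrCA ler_pM2l// big_split/= sumr_const card_ord mulrDl mul1r lerD2r.
by rewrite -mulr_natl mulrA ler_wpM2r.
Qed.

Lemma chain_bound (r : nat) : (r <= n)%N -> exists Cst : R, 0 <= Cst /\
  forall (h dl : R) (M : nat) U (e : nat -> R),
  0 < dl -> dl <= 1 -> h = dl ^+ 2 -> M%:R * h <= T -> input_bound Pr Ft B h M e U ->
  \sum_(j < M) wt h j *
    (h * \sum_c n2 (fun w => (C *m (txi h U n j w - txi h U r j w)) c 0)) <=
  (2 * \sum_(k < n | (r <= k)%N) sg k) ^+ 2 * \sum_(j < M) wt h j * e j +
  Cst * (dl * \sum_(j < M) e j).
Proof.
move=> rn.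
have /choice[Ck hCk] := fun k => energy_sum k.
(* Coordinates count from 0, so these are the indices r+1, ..., n of the usual notation; passing
   from k + 1 to k kept coordinates removes coordinate [k]. *)
pose s := [seq k : 'I_n <- enum 'I_n | (r <= k)%N].
pose S := \sum_(k <- s) sg k.
have sE (F : 'I_n -> R) : \sum_(k < n | (r <= k)%N) F k = \sum_(k <- s) F k.
  by rewrite /s big_filter big_enum_cond.
have S0 : 0 <= S by apply: sumr_ge0 => k _; exact: ltW.
exists (S * \sum_(k <- s) (sg k)^-1 * Ck k); split.
  by rewrite mulr_ge0// sumr_ge0// => k _; rewrite mulr_ge0 ?invr_ge0 ?(ltW (sg0 k))//; case: (hCk k).
move=> h dl M U e dl0 dl1 hE MT hU; rewrite sE -/S.
have h0 : 0 < h by rewrite hE exprn_gt0.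
set We := \sum_(j < M) wt h j * e j; set E := \sum_(j < M) e j.
have Lt j k l : (j < M)%N -> L2 (fun w => txi h U k j w l 0).
  move=> jM; have D := txi_driver hF k (ltW h0) hU.
  have FG i l' : (i < M)%N -> measurable_wrt (Ft (i.+1%:R * h)) (fun w => ((pid_mx k : 'M[R]_n) *m (B *m U i w)) l' 0).
    by move=> iM; case: (D i l' iM).
  have LG i l' : (i < M)%N -> L2 (fun w => ((pid_mx k : 'M[R]_n) *m (B *m U i w)) l' 0).
    by move=> iM; case: (D i l' iM).
  by case: (euler_Ft hF hW (trunc k A) (fun i => trunc k (N i)) (ltW h0) FG LG l (ltnW jM)).
pose g j k c w := (C *m (txi h U k.+1 j w - txi h U k j w)) c 0.
have Lg j k c : (j < M)%N -> L2 (g j k c).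
  move=> jM; apply: L2_mulmx => l; under eq_fun do rewrite !mxE.
  by apply: L2B; exact: Lt.
have tele j c w : (C *m (txi h U n j w - txi h U r j w)) c 0 = \sum_(k <- s) g j k c w.
  rewrite -sE; have -> : txi h U n j w - txi h U r j w =
      \sum_(k < n | (r <= k)%N) (txi h U k.+1 j w - txi h U k j w).
    have := big_geq_mkord (op := +%R) (idx := 0) r n xpredT
      (fun k => txi h U k.+1 j w - txi h U k j w).
    rewrite telescope_sumr// => ->; exact: eq_bigl.
  by rewrite mulmx_sumr summxE.
have cs (j : 'I_M) c : n2 (fun w => (C *m (txi h U n j w - txi h U r j w)) c 0) <=
    S * \sum_(k <- s) (sg k)^-1 * n2 (g j k c).
  under eq_fun do rewrite tele.
  by apply: n2_sum_weighted => // k; exact: Lg.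
apply: (@le_trans _ _ (S * \sum_(k <- s) (sg k)^-1 *
    \sum_(j < M) wt h j * (h * \sum_c n2 (g j k c)))).
  apply: (@le_trans _ _ (\sum_(j < M) wt h j * (h * \sum_c S * \sum_(k <- s) (sg k)^-1 * n2 (g j k c)))).
    apply: ler_sum => j _; rewrite ler_wpM2l ?expR_ge0// ler_pM2l//.
    by apply: ler_sum => c _; exact: cs.
  rewrite le_eqVlt; apply/orP; left; apply/eqP.
  rewrite (eq_bigr (fun j : 'I_M => S * \sum_(k <- s) (sg k)^-1 *
      (wt h j * (h * \sum_c n2 (g j k c))))); last first.
    move=> j _; have -> : \sum_c S * \sum_(k <- s) (sg k)^-1 * n2 (g j k c) =
        S * \sum_(k <- s) (sg k)^-1 * \sum_c n2 (g j k c).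
      rewrite -mulr_sumr exchange_big/=; congr (_ * _); apply: eq_bigr => k _.
      by rewrite mulr_sumr.
    have -> (x : R) : wt h j * (h * (S * x)) = S * (wt h j * (h * x)) by ring.
    by congr (S * _); rewrite !mulr_sumr; apply: eq_bigr => k _; ring.
  rewrite -mulr_sumr exchange_big/=; congr (_ * _); apply: eq_bigr => k _.
  by rewrite mulr_sumr.
apply: (@le_trans _ _ (S * \sum_(k <- s) (sg k)^-1 * (4 * sg k ^+ 2 * We + Ck k * (dl * E)))).
  rewrite ler_wpM2l//; apply: ler_sum => k _; rewrite ler_wpM2l ?invr_ge0 ?(ltW (sg0 k))//.
  by case: (hCk k) => _; exact.
rewrite le_eqVlt; apply/orP; left; apply/eqP.
(* The weight 1 / sigma_k turns the cost 4 sigma_k^2 into 4 sigma_k; summing and multiplying by S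
   gives the square of 2 S. *)
have -> : \sum_(k <- s) (sg k)^-1 * (4 * sg k ^+ 2 * We + Ck k * (dl * E)) =
    4 * We * S + (\sum_(k <- s) (sg k)^-1 * Ck k) * (dl * E).
  rewrite /S [X in _ = X + _]mulr_sumr [X in _ = _ + X]mulr_suml -big_split/=; apply: eq_bigr => k _.
  by field; rewrite gt_eqF.
ring.
Qed.

End EnergySum.

(** * Balanced coordinates *)

Section MatrixFacts.
Context {R : realType}.

Lemma enorm_sqrE n (v : 'cV[R]_n) : enorm v ^+ 2 = (v^T *m v) 0 0.
Proof.
rewrite enorm_sqr mxE; apply: eq_bigr => i _; by rewrite mxE expr2.
Qed.

Lemma enorm_ge0 n (v : 'cV[R]_n) : 0 <= enorm v. Proof. exact: sqrtr_ge0. Qed.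

Lemma enormZ n a (v : 'cV[R]_n) : enorm (a *: v) = `|a| * enorm v.
Proof.
rewrite /enorm; under eq_bigr do rewrite mxE exprMn.
by rewrite -mulr_sumr sqrtrM ?sqr_ge0// sqrtr_sqr.
Qed.

Lemma enorm_eq0 n (v : 'cV[R]_n) : enorm v = 0 -> v = 0.
Proof.
move=> v0; apply/matrixP => i j; rewrite ord1 mxE; apply/eqP; rewrite -sqrf_eq0.
have : \sum_i v i 0 ^+ 2 = 0 by rewrite -enorm_sqr v0 expr0n.
by move/eqP; rewrite psumr_eq0 => [/allP/(_ i (mem_index_enum i))//|k _]; exact: sqr_ge0.
Qed.

(** The supremum of an unbounded set is a default value, so boundedness has to be known before
    [specnorm] can serve as an upper bound. *)
Lemma specnorm_bound m n (M : 'M[R]_(m, n)) :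
  has_ubound [set enorm (M *m v) | v in [set v : 'cV[R]_n | enorm v <= 1]].
Proof.
exists (Num.sqrt (\sum_i (\sum_k `|M i k|) ^+ 2)) => _ [v /= v1 <-].
rewrite ler_wsqrtr//; apply: ler_sum => i _.
rewrite -[leLHS](real_normK (num_real _)) ler_pXn2r ?nnegrE//; last first.
  exact: sumr_ge0.
rewrite mxE; apply: le_trans (ler_norm_sum _ _ _) _; apply: ler_sum => k _.
rewrite normrM ler_piMr//; apply: le_trans v1; rewrite -(ler_pXn2r (n := 2)) ?nnegrE ?enorm_ge0//.
rewrite real_normK ?num_real// enorm_sqr (bigD1 k)//= lerDl.
by apply: sumr_ge0 => j _; exact: sqr_ge0.
Qed.

Lemma specnorm_ge0 m n (M : 'M[R]_(m, n)) : 0 <= specnorm M.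
Proof.
apply: le_trans (ub_le_sup (specnorm_bound M) _); first exact: (enorm_ge0 (M *m 0)).
exists 0 => //=; rewrite /enorm big1 ?sqrtr0// => i _; by rewrite mxE expr0n.
Qed.

Lemma enorm_specnorm m n (M : 'M[R]_(m, n)) v : enorm (M *m v) <= specnorm M * enorm v.
Proof.
have [v0|v0] := eqVneq (enorm v) 0.
  by rewrite v0 mulr0 (enorm_eq0 v0) mulmx0 /enorm big1 ?sqrtr0// => i _; rewrite mxE expr0n.
have vp : 0 < enorm v by rewrite lt_def v0 enorm_ge0.
have i0 : `|(enorm v)^-1| = (enorm v)^-1 by rewrite ger0_norm// invr_ge0 ltW.
rewrite -ler_pdivrMr//; apply: ub_le_sup; first exact: specnorm_bound.
exists ((enorm v)^-1 *: v) => /=; first by rewrite enormZ i0 mulVf.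
by rewrite -scalemxAr enormZ i0 mulrC.
Qed.

Lemma enorm_specnorm_sqr m n (M : 'M[R]_(m, n)) v :
  enorm (M *m v) ^+ 2 <= specnorm M ^+ 2 * enorm v ^+ 2.
Proof.
by rewrite -exprMn ler_pXn2r ?nnegrE ?mulr_ge0 ?enorm_ge0 ?specnorm_ge0// enorm_specnorm.
Qed.

Definition bf n (X : 'M[R]_n) (x y : 'cV[R]_n) : R := (x^T *m X *m y) 0 0.

Lemma bf_diag n (S X : 'M[R]_n) (s : 'rV[R]_n) x y : X = S^T *m diag_mx s *m S ->
  \sum_l s 0 l * ((S *m x) l 0 * (S *m y) l 0) = bf X x y.
Proof.
move=> ->; rewrite /bf.
have -> : x^T *m (S^T *m diag_mx s *m S) *m y = (S *m x)^T *m diag_mx s *m (S *m y).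
  by rewrite trmx_mul !mulmxA.
rewrite mxE; apply: eq_bigr => l _; rewrite mul_mx_diag.
set u := S *m x; set v := S *m y.
by rewrite [X in _ = X * _]mxE [u^T _ _]mxE mulrCA mulrA.
Qed.

Lemma bf_sum n (I : Type) (s : seq I) (X : I -> 'M[R]_n) x y :
  bf (\sum_(i <- s) X i) x y = \sum_(i <- s) bf (X i) x y.
Proof.
by rewrite /bf mulmx_sumr mulmx_suml summxE.
Qed.

Lemma bfD n (X Y : 'M[R]_n) x y : bf (X + Y) x y = bf X x y + bf Y x y.
Proof. by rewrite /bf mulmxDr mulmxDl mxE. Qed.

Lemma bfN n (X : 'M[R]_n) x y : bf (- X) x y = - bf X x y.
Proof. by rewrite /bf mulmxN mulNmx mxE. Qed.

Lemma bfZ n a (X : 'M[R]_n) x y : bf (a *: X) x y = a * bf X x y.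
Proof. by rewrite /bf -scalemxAr -scalemxAl mxE. Qed.

Lemma bf_mul n (X F G : 'M[R]_n) x y : bf (F^T *m X *m G) x y = bf X (F *m x) (G *m y).
Proof. by rewrite /bf trmx_mul !mulmxA. Qed.

Lemma bf_mulr n (X G : 'M[R]_n) x y : bf (X *m G) x y = bf X x (G *m y).
Proof. by rewrite /bf !mulmxA. Qed.

Lemma bf_mull n (X F : 'M[R]_n) x y : bf (F^T *m X) x y = bf X (F *m x) y.
Proof. by rewrite /bf trmx_mul !mulmxA. Qed.

Lemma bf_gram n m (F : 'M[R]_(m, n)) x : bf (F^T *m F) x x = enorm (F *m x) ^+ 2.
Proof. by rewrite enorm_sqrE /bf trmx_mul !mulmxA. Qed.

Lemma bfC n (X : 'M[R]_n) x y : X^T = X -> bf X x y = bf X y x.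
Proof.
move=> sX; rewrite /bf -[in RHS]sX.
have -> : y^T *m X^T *m x = (x^T *m X *m y)^T by rewrite !trmx_mul trmxK mulmxA.
by rewrite [RHS]mxE.
Qed.

Section Balanced.
Variables (q n : nat) (K : 'M[R]_q) (A : 'M[R]_n) (N : 'I_q -> 'M[R]_n)
  (S X : 'M[R]_n) (s : 'rV[R]_n).
Hypotheses (uS : S \in unitmx) (XE : X = S^T *m diag_mx s *m S).

Let sX : X^T = X.
Proof. by rewrite XE !trmx_mul trmxK tr_diag_mx mulmxA. Qed.

(** The rows weighted by [s] form a Lyapunov operator at [X], evaluated in the original coordinates.
    It is used for [Q] with weights sigma_l and for the inverse of [P] with weights 1 / sigma_l. *)
Lemma balanced_form (v : 'cV[R]_n) :
  \sum_l s 0 l * (2 * v l 0 * ((S *m A *m invmx S) *m v) l 0 +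
     QK K (fun i => ((S *m N i *m invmx S) *m v) l 0)
          (fun i => ((S *m N i *m invmx S) *m v) l 0)) =
  bf (A^T *m X + X *m A +
      \sum_(i < q) \sum_(j < q) K i j *: ((N i)^T *m X *m N j))
     (invmx S *m v) (invmx S *m v).
Proof.
set x := invmx S *m v; have vE : v = S *m x by rewrite /x mulKVmx.
have mE (M : 'M[R]_n) : (S *m M *m invmx S) *m v = S *m (M *m x).
  by rewrite /x !mulmxA.
rewrite !bfD bf_mull bf_mulr bfC// bf_sum.
have -> : bf X x (A *m x) + bf X x (A *m x) = \sum_l s 0 l * (2 * v l 0 * ((S *m A *m invmx S) *m v) l 0).
  rewrite -!(bf_diag _ _ XE) -big_split/=; apply: eq_bigr => l _.
  by rewrite mE -vE; ring.
under eq_bigr do rewrite mulrDr.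
rewrite big_split/=; congr (_ + _).
under eq_bigr do rewrite /QK mulr_sumr.
rewrite exchange_big/=; apply: eq_bigr => i _; rewrite bf_sum.
under eq_bigr do rewrite mulr_sumr.
rewrite exchange_big/=; apply: eq_bigr => j _; rewrite bfZ bf_mul -(bf_diag _ _ XE) mulr_sumr.
by apply: eq_bigr => l _; rewrite !mE; ring.
Qed.

Lemma balanced_weight (v : 'cV[R]_n) :
  \sum_l s 0 l * v l 0 ^+ 2 = bf X (invmx S *m v) (invmx S *m v).
Proof. by rewrite -(bf_diag _ _ XE) mulKVmx. Qed.

End Balanced.

Section BalancedInequalities.
Variables (q n m p : nat) (K : 'M[R]_q) (A : 'M[R]_n) (N : 'I_q -> 'M[R]_n)
  (B : 'M[R]_(n, m)) (C : 'M[R]_(p, n)) (S P Q Ph Qh : 'M[R]_n) (s : 'rV[R]_n).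
Hypotheses (uS : S \in unitmx) (s0 : forall k, 0 < s 0 k)
  (hSP : S *m P *m S^T = diag_mx s)
  (hSQ : (invmx S)^T *m Q *m invmx S = diag_mx s)
  (hPh : is_sqrtmx P Ph) (hQh : is_sqrtmx Q Qh).

Let beta := Num.max (specnorm (B^T *m Qh) ^+ 2) (specnorm (C *m Ph) ^+ 2).

Lemma beta_ge0 : 0 <= beta.
Proof. by rewrite le_max sqr_ge0. Qed.

Lemma Q_bal : Q = S^T *m diag_mx s *m S.
Proof.
by rewrite -hSQ !mulmxA -trmx_mul mulVmx// trmx1 mul1mx -mulmxA mulVmx// mulmx1.
Qed.

Let uD : diag_mx s \in unitmx.
Proof.
by rewrite unitmxE det_diag unitfE; apply/prodf_neq0 => k _; rewrite gt_eqF.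
Qed.

Lemma P_unit : P \in unitmx.
Proof.
have := uD; rewrite -hSP !unitmx_mul => /andP[/andP[_ ]//].
Qed.

Let sinv : 'rV[R]_n := \row_k (s 0 k)^-1.

Lemma P_bal : invmx P = S^T *m diag_mx sinv *m S.
Proof.
have DD : diag_mx s *m diag_mx sinv = 1%:M.
  rewrite mul_diag_mx; apply/matrixP => i j; rewrite !mxE.
  by case: eqVneq => [->|_]; rewrite ?mulr1n ?mulr0n ?mulr0// divff// gt_eqF.
have PE : P *m (S^T *m diag_mx sinv *m S) = 1%:M.
  have -> : P *m (S^T *m diag_mx sinv *m S) =
      invmx S *m ((S *m P *m S^T) *m diag_mx sinv) *m S.
    by rewrite !mulmxA mulVmx// mul1mx.
  by rewrite hSP DD mulmx1 mulVmx.
by rewrite -[RHS](mulKmx P_unit) PE mulmx1.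
Qed.

(** The first origin of beta: in the Riccati equation the term Q B B^T Q works against decay of the
    storage, and it is bounded by a multiple of Q. *)
Lemma input_weight x : enorm (B^T *m Q *m x) ^+ 2 <= beta * bf Q x x.
Proof.
have [[sQ _] QE] := hQh.
have -> : bf Q x x = enorm (Qh *m x) ^+ 2 by rewrite -bf_gram sQ QE.
have -> : B^T *m Q *m x = (B^T *m Qh) *m (Qh *m x) by rewrite -QE !mulmxA.
apply: le_trans (enorm_specnorm_sqr _ _) _.
by rewrite ler_wpM2r ?sqr_ge0// le_max lexx.
Qed.

(** The second origin of beta: in the inequality for P the output term C^T C works against decay,
    and it is bounded by a multiple of P^-1. *)
Lemma output_weight x : enorm (C *m x) ^+ 2 <= beta * bf (invmx P) x x.
Proof.
have [[sP _] PE] := hPh.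
have uPh : Ph \in unitmx by have := P_unit; rewrite -PE unitmx_mul => /andP[].
have -> : bf (invmx P) x x = enorm (invmx Ph *m x) ^+ 2.
  have E1 : invmx Ph *m invmx Ph *m P = 1%:M.
    by rewrite -PE mulmxA mulmxKV// mulVmx.
  by rewrite -bf_gram trmx_inv sP -[invmx P]mul1mx -E1 mulmxK ?P_unit.
have -> : C *m x = (C *m Ph) *m (invmx Ph *m x) by rewrite -mulmxA mulKVmx.
apply: le_trans (enorm_specnorm_sqr _ _) _.
by rewrite ler_wpM2r ?sqr_ge0// le_max lexx orbT.
Qed.

Lemma balanced_obs :
  A^T *m Q + Q *m A + (\sum_(i < q) \sum_(j < q) K i j *: ((N i)^T *m Q *m N j))
     + C^T *m C - Q *m B *m B^T *m Q = 0 ->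
  obs_ineq K (S *m A *m invmx S) (fun i => S *m N i *m invmx S) (C *m invmx S)
    (fun l => s 0 l) beta.
Proof.
move=> hQeq v; rewrite (balanced_form _ _ _ uS Q_bal) (balanced_weight uS Q_bal).
set x := invmx S *m v.
have := congr1 (fun M => bf M x x) hQeq; rewrite bfD bfN bfD.
have -> : bf 0 x x = 0 by rewrite /bf mulmx0 mul0mx mxE.
rewrite bf_gram; have -> : bf (Q *m B *m B^T *m Q) x x = enorm (B^T *m Q *m x) ^+ 2.
  have [[sQ _] QE] := hQh; have sQQ : Q^T = Q by rewrite -QE trmx_mul sQ.
  by rewrite -bf_gram trmx_mul trmxK sQQ !mulmxA.
rewrite -enorm_sqr -[C *m _ *m v]mulmxA -/x; have := input_weight x; lra.
Qed.

Lemma balanced_reach :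
  nsdmx (A^T *m invmx P + invmx P *m A
     + (\sum_(i < q) \sum_(j < q) K i j *: ((N i)^T *m invmx P *m N j))
     - C^T *m C + invmx P *m B *m B^T *m invmx P) ->
  reach_ineq K (S *m A *m invmx S) (fun i => S *m N i *m invmx S) (S *m B)
    (fun l => s 0 l) beta.
Proof.
move=> [_ hP] v.
have sE l : (s 0 l)^-1 = sinv 0 l by rewrite mxE.
have -> : \sum_l (s 0 l)^-1 * v l 0 ^+ 2 = bf (invmx P) (invmx S *m v) (invmx S *m v).
  by under eq_bigr do rewrite sE; exact: (balanced_weight uS P_bal).
under eq_bigr do rewrite sE.
rewrite [X in X + _](balanced_form _ _ _ uS P_bal).
set x := invmx S *m v.
have := hP x; rewrite -/(bf _ x x) bfN bfD bfD bfN bf_gram.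
have sPi : (invmx P)^T = invmx P.
  by rewrite P_bal !trmx_mul trmxK tr_diag_mx mulmxA.
have -> : bf (invmx P *m B *m B^T *m invmx P) x x = enorm (B^T *m invmx P *m x) ^+ 2.
  by rewrite -bf_gram trmx_mul trmxK sPi !mulmxA.
have -> : \sum_j (\sum_l (S *m B) l j * ((s 0 l)^-1 * v l 0)) ^+ 2 = enorm (B^T *m invmx P *m x) ^+ 2.
  rewrite enorm_sqr; apply: eq_bigr => j _; congr (_ ^+ 2).
  have -> : B^T *m invmx P *m x = (S *m B)^T *m (diag_mx sinv *m v).
    by rewrite P_bal /x trmx_mul !mulmxA -[in LHS](mulmxA _ S) mulmxV// mulmx1.
  set SB := S *m B; rewrite mxE; apply: eq_bigr => l _; rewrite mul_diag_mx.
  by rewrite [SB^T j l]mxE [X in _ = _ * X]mxE sE.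
have := output_weight x; lra.
Qed.

End BalancedInequalities.

End MatrixFacts.

(** A matrix intertwining the coefficients carries one scheme to the other, since both see the same
    increments. It is used for the balancing transformation and for the embedding of the reduced
    state space. *)
Lemma euler_morph (R : realType) d (Omega : measurableType d) (q n1 n2' : nat)
    (W : R -> Omega -> 'cV[R]_q) (h : R) (D : 'M[R]_(n2', n1))
    (A1 : 'M[R]_n1) (A2 : 'M[R]_n2') (N1 : 'I_q -> 'M[R]_n1) (N2 : 'I_q -> 'M[R]_n2')
    (G1 : nat -> Omega -> 'cV[R]_n1) (G2 : nat -> Omega -> 'cV[R]_n2') :
  D *m A1 = A2 *m D -> (forall i, D *m N1 i = N2 i *m D) ->
  (forall j w, D *m G1 j w = G2 j w) ->
  forall j w, D *m euler W h A1 N1 G1 j w = euler W h A2 N2 G2 j w.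
Proof.
move=> hA hN hG; elim=> [|j ih] w /=; first by rewrite mulmx0.
rewrite !mulmxDr hG ih -scalemxAr mulmxA hA -mulmxA ih; congr (_ + _).
rewrite mulmx_sumr; apply: eq_bigr => i _.
by rewrite -scalemxAr mulmxA hN -mulmxA ih.
Qed.

(** * Truncated coefficients through the embedding of the first r coordinates *)

Section Truncation.
Context {R : realType} (n r : nat) (h : (r <= n)%N).

Definition emb : 'M[R]_(n, r) := pid_mx r.

Lemma emb_tr_mulmx m (M : 'M[R]_(n, m)) : truncrow h M = emb^T *m M.
Proof.
rewrite /emb tr_pid_mx; apply/matrixP => i j; rewrite !mxE (bigD1 (widen_ord h i))//=.
rewrite big1 ?addr0; first by rewrite mxE /= eqxx ltn_ord mul1r.
move=> k ki; rewrite mxE (_ : (i == k :> nat) = false) ?mul0r//.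
by apply: contraNF ki => /eqP ik; apply/eqP/val_inj.
Qed.

Lemma mulmx_emb m (M : 'M[R]_(m, n)) : trunccol h M = M *m emb.
Proof.
rewrite /emb; apply/matrixP => i j; rewrite !mxE (bigD1 (widen_ord h j))//=.
rewrite big1 ?addr0; first by rewrite mxE /= eqxx ltn_ord mulr1.
move=> k kj; rewrite mxE (_ : (k == j :> nat) = false) ?mulr0//.
by apply: contraNF kj => /eqP ik; apply/eqP/val_inj.
Qed.

Lemma truncsq_emb (M : 'M[R]_n) : truncsq h M = emb^T *m M *m emb.
Proof.
by rewrite -mulmx_emb -emb_tr_mulmx; apply/matrixP => i j; rewrite !mxE.
Qed.

Lemma emb_emb_tr : emb *m emb^T = pid_mx r.
Proof. by rewrite /emb tr_pid_mx mul_pid_mx !minnn. Qed.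

Lemma pid_emb : (pid_mx r : 'M[R]_n) *m emb = emb.
Proof. by rewrite /emb mul_pid_mx minnn (minn_idPr h). Qed.

End Truncation.

(** * Passage to the limit *)

Section WeightedNorm.
Context {R : realType} {d : measure_display} {Omega : measurableType d}.
Variable Pr : probability Omega R.
Local Notation leb := (@lebesgue_measure R).
Local Notation L2p := (sqint (leb \x Pr)%E).
Local Notation n2p := (sqnorm (leb \x Pr)%E).

(** The square root of the weight, so that weighted energies become plain squared norms of products
    with [gam]. *)
Definition gam (beta : R) (z : measurableTypeR R * Omega) : R := expR (- (beta * z.1 / 2)).

Lemma gam_meas beta : measurable_fun setT (gam beta).
Proof.
rewrite /gam; apply: (@measurableT_comp _ _ _ _ _ _ (fun s : R => expR (- (beta * s / 2)))).
  apply: measurableT_comp => //; apply: measurableT_comp => //.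
  by apply: measurable_funM => //; apply: measurable_funM.
exact: measurable_fst.
Qed.

Lemma gam_sqr beta z : gam beta z ^+ 2 = expR (- (beta * z.1)).
Proof. by rewrite /gam expr2 -expRD; congr expR; field. Qed.

Lemma rI_rs_ae (T : R) f : {ae (leb \x Pr)%E, forall z, rs `[0, T] f z = rI 0 T f z}.
Proof.
exists ([set 0] `*` setT); split.
- exact: measurableX.
- rewrite product_measure1E//= lebesgue_measure_set1 mul0e//.
move=> [s w] /= hs; split => //=; apply: contrapT => s0; apply: hs.
rewrite rIE /rs indicE mem_setE in_itv/= /ioc le_eqVlt.
by case: eqP => //= /esym.
Qed.

Lemma gam_L2 beta (V : measurableTypeR R * Omega -> R) T : 0 <= beta -> L2p V ->
  tsupp 0 T V -> L2p (fun z => gam beta z * V z) /\ n2p (fun z => gam beta z * V z) <= n2p V.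
Proof.
move=> b0 LV sV; have le z : (gam beta z * V z) ^+ 2 <= V z ^+ 2.
  rewrite exprMn gam_sqr sV; have [->|[-> [z0 _]]] := ioc_cases 0 T z.1.
    by rewrite mulr0 expr0n mulr0.
  by rewrite mulr1 ler_piMl ?sqr_ge0// -expR0 ler_expR oppr_le0 mulr_ge0// ltW.
have L : L2p (fun z => gam beta z * V z).
  by apply: (L2_dom _ LV le); apply: measurable_funM; [exact: gam_meas|case: LV].
by split => //; exact: n2_le.
Qed.

(** Tonelli's theorem and the nullity of the instant 0 replace the iterated integral over the closed
    interval by squared norms of coordinates, so that a real number stands under the root. *)
Lemma weighted_norm (beta T : R) k (v : R -> Omega -> 'cV[R]_k) : 0 <= beta ->
  (forall i, measurable_fun (`[0, T] `*` [set: Omega]) (fun z : R * Omega => v z.1 z.2 i 0)) ->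
  (forall i, L2p (rs `[0, T] (fun s w => v s w i 0))) ->
  weighted_L2norm Pr beta T v =
  ((\sum_i n2p (fun z => gam beta z * rI 0 T (fun s w => v s w i 0) z))%:E `^ 2^-1)%E.
Proof.
move=> b0 mv Lv; rewrite /weighted_L2norm; congr poweR.
have mT : measurable (`[0, T] : set R) by [].
pose f s w := expR (- (beta * s / 2)) * enorm (v s w).
have mf : measurable_fun (`[0, T] `*` [set: Omega]) (fun z : R * Omega => f z.1 z.2).
  apply: measurable_funM; first by apply: measurable_funTS; exact: gam_meas.
  apply: (@measurableT_comp _ _ _ _ _ _ (@Num.sqrt R)).
    by apply: continuous_measurable_fun; exact: sqrt_continuous.
  by apply: measurable_sum => i; apply: measurable_funX; exact: mv.
transitivity (\int[(leb \x Pr)]_z (rs `[0, T] f z ^+ 2)%:E)%E.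
  rewrite rs_iter//; apply: eq_integral => w _; apply: eq_integral => s _.
  rewrite /f exprMn; congr ((_ * _)%:E).
  by have := gam_sqr beta (s, w); rewrite /gam/= => ->.
have LI i : L2p (rI 0 T (fun s w => v s w i 0)) by exact: rI_L2 (Lv i).
have Lg i := proj1 (gam_L2 b0 (LI i) (rI_supp _ (lexx 0) (lexx T))).
pose F i z := gam beta z * rI 0 T (fun s w => v s w i 0) z.
have ints : (\int[(leb \x Pr)]_z (\sum_i F i z ^+ 2)%:E = (\sum_i n2p (F i))%:E)%E.
  under eq_integral do rewrite -sumEFin.
  rewrite ge0_integral_sum//=.
  - by rewrite -sumEFin; apply: eq_bigr => i _; rewrite n2E//; exact: Lg.
  - by move=> i; apply/measurable_EFinP; apply: measurable_funX; case: (Lg i).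
  - by move=> i z _; rewrite lee_fin sqr_ge0.
rewrite -ints; apply: ge0_ae_eq_integral => //.
- by apply/measurable_EFinP; apply: measurable_funX; exact: rs_meas.
- apply/measurable_EFinP; apply: measurable_sum => i; apply: measurable_funX; by case: (Lg i).
- by move=> z _; rewrite lee_fin sqr_ge0.
- by move=> z _; rewrite lee_fin; apply: sumr_ge0 => i _; exact: sqr_ge0.
have : {ae (leb \x Pr)%E, forall z, forall i,
    rs `[0, T] (fun s w => v s w i 0) z = rI 0 T (fun s w => v s w i 0) z}.
  by apply: filter_forall => i; exact: rI_rs_ae.
apply: filterS => z hz _; congr EFin.
rewrite (eq_bigr (fun i => (gam beta z * rs `[0, T] (fun s w => v s w i 0) z) ^+ 2)); last first.
  by move=> i _; rewrite /F hz.
rewrite /rs /f /gam !exprMn enorm_sqr !mulr_sumr; apply: eq_bigr => i _; ring.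
Qed.

End WeightedNorm.

(** The step tends to 0 while [ep] is fixed, because 1 / ep multiplies the approximation error; then
    [ep] tends to 0. Only steps that divide [T] evenly are available. *)
Lemma limit_arg (R : realType) (L Y b c3 c4 T : R) :
  0 <= Y -> 0 <= b -> 0 <= c3 -> 0 <= c4 -> 0 < T ->
  (forall (ep : R) (M : nat) (dl : R), 0 < ep -> (0 < M)%N -> 0 < dl -> dl <= 1 ->
     M%:R * dl ^+ 2 = T ->
     L <= (1 + ep) * (expR (b * dl ^+ 2) * (Y + c3 * dl)) + (1 + ep^-1) * (c4 * dl ^+ 2)) ->
  L <= Y.
Proof.
move=> Y0 b0 c30 c40 T0 H.
have small (ep eta : R) : 0 < ep -> 0 < eta -> L <= (1 + ep) * Y + eta.
  move=> ep0 eta0.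
  (* Bounds the excess over (1 + ep) Y per unit of [dl], once [dl] is at most 1. *)
  pose c5 := (1 + ep) * (b * expR b * (Y + c3) + c3) + (1 + ep^-1) * c4.
  have epi : 0 <= ep^-1 by rewrite invr_ge0 ltW.
  have ep1 : 0 <= 1 + ep by rewrite addr_ge0// ltW.
  have c50 : 0 <= c5.
    apply: addr_ge0; last by rewrite mulr_ge0// addr_ge0.
    apply: mulr_ge0 => //; apply: addr_ge0 => //.
    by rewrite !mulr_ge0 ?expR_ge0// addr_ge0.
  (* From h tau <= 1 follow both h <= 1, by the first summand, and c5 dl <= eta, by the second. *)
  pose tau := 1 + (c5 / eta) ^+ 2.
  have tau0 : 0 < tau by rewrite ltr_pwDl// sqr_ge0.
  pose M := Num.bound (T * tau).
  have TM := archi_boundP (mulr_ge0 (ltW T0) (ltW tau0)); rewrite -/M in TM.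
  have M0 : 0 < M%:R :> R by apply: le_lt_trans TM; rewrite mulr_ge0// ltW.
  pose h := T / M%:R.
  have h0 : 0 < h by rewrite divr_gt0.
  pose dl := Num.sqrt h.
  have dl0 : 0 < dl by rewrite sqrtr_gt0.
  have dlh : dl ^+ 2 = h by rewrite sqr_sqrtr// ltW.
  have htau : h * tau <= 1 by rewrite /h mulrAC ler_pdivrMr// mul1r ltW.
  have h1 : h <= 1.
    apply: le_trans htau; have : 1 <= tau by rewrite /tau lerDl sqr_ge0.
    by move=> tau1; rewrite ler_peMr// ltW.
  have dl1 : dl <= 1 by rewrite -sqrtr1 ler_wsqrtr.
  have c5dl : c5 * dl <= eta.
    have cd0 : 0 <= c5 * dl by rewrite mulr_ge0// ltW.
    rewrite -(ler_pXn2r (ltn0Sn 1))//; last by rewrite nnegrE ltW.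
    rewrite exprMn dlh.
    have e2 : 0 < eta ^+ 2 by rewrite exprn_gt0.
    have : h * ((c5 / eta) ^+ 2) * eta ^+ 2 <= 1 * eta ^+ 2.
      apply: ler_wpM2r; first exact: ltW.
      by apply: le_trans htau; rewrite ler_pM2l// lerDr.
    have -> : h * (c5 / eta) ^+ 2 * eta ^+ 2 = c5 ^+ 2 * h by field; rewrite gt_eqF.
    by rewrite mul1r.
  have MT : M%:R * dl ^+ 2 = T by rewrite dlh /h mulrCA divff ?mulr1// gt_eqF.
  have M0' : (0 < M)%N by rewrite -(ltr_nat R).
  apply: le_trans (H ep M dl ep0 M0' dl0 dl1 MT) _.
  have dd : dl ^+ 2 <= dl by rewrite expr2 ler_piMl// ltW.
  (* From e^(-z) >= 1 - z one gets e^z <= 1 + z e^z, and here z is at most b dl. *)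
  have ex : expR (b * dl ^+ 2) <= 1 + b * expR b * dl.
    set z := b * dl ^+ 2.
    have z0 : 0 <= z by rewrite mulr_ge0 ?sqr_ge0.
    have zb : z <= b by rewrite /z ler_piMr// (le_trans dd).
    have e1 : expR z * (1 - z) <= 1.
      have := ler_wpM2l (expR_ge0 z) (expR_ge1Dx (- z)).
      by rewrite -expRD subrr expR0.
    have : expR z * z <= expR b * (b * dl).
      apply: ler_pM; rewrite ?expR_ge0// ?ler_expR//.
      by rewrite /z ler_wpM2l.
    nra.
  apply: le_trans (_ : _ <= (1 + ep) * Y + c5 * dl) _; last by rewrite lerD2l.
  have Yc : 0 <= Y + c3 * dl by rewrite addr_ge0// mulr_ge0// ltW.
  have := ler_wpM2r Yc ex.
  have t1 : (b * expR b * dl) * (Y + c3 * dl) <= (b * expR b * dl) * (Y + c3).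
    by apply: ler_wpM2l; [rewrite !mulr_ge0 ?expR_ge0// ltW|rewrite lerD2l ler_piMr].
  have t2 : c4 * dl ^+ 2 <= c4 * dl by rewrite ler_wpM2l.
  have {}t2 := ler_wpM2l (addr_ge0 ler01 epi) t2.
  move=> t3; have {}t3 : (1 + ep) * (expR (b * dl ^+ 2) * (Y + c3 * dl)) <=
     (1 + ep) * (Y + c3 * dl + (b * expR b * dl) * (Y + c3)).
    by apply: ler_wpM2l => //; lra.
  apply: le_trans (lerD t3 t2) _; rewrite le_eqVlt; apply/orP; left; apply/eqP.
  rewrite /c5; ring.
apply/ler_addgt0Pl => e e0.
have Y1 : 0 < 2 * (Y + 1) by rewrite mulr_gt0// ltr_wpDl.
(* Either source of error costs at most e / 2; Y + 1 in place of Y avoids dividing by zero. *)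
have := small (e / (2 * (Y + 1))) (e / 2) (divr_gt0 e0 Y1) (divr_gt0 e0 (ltr0n _ 2)).
have : e / (2 * (Y + 1)) * Y <= e / 2.
  rewrite mulrAC ler_pdivrMr//.
  have -> : e / 2 * (2 * (Y + 1)) = e * Y + e by field.
  by rewrite lerDl ltW.
lra.
Qed.

(** * Integrals of the control over the cells *)

Section Driver.
Context {R : realType} {d : measure_display} {Omega : measurableType d}.
Variables (Pr : probability Omega R) (Ft : R -> set_system Omega) (q : nat)
  (K : 'M[R]_q) (W : R -> Omega -> 'cV[R]_q).
Hypotheses (hF : usual_filtration Pr Ft) (hW : wiener Pr Ft K W).
Local Notation leb := (@lebesgue_measure R).
Local Notation L2 := (sqint Pr).
Local Notation n2 := (sqnorm Pr).
Local Notation L2p := (sqint (leb \x Pr)%E).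
Local Notation n2p := (sqnorm (leb \x Pr)%E).
Variables (T h : R) (M m : nat) (u : R -> Omega -> 'cV[R]_m).
Hypotheses (T0 : 0 < T) (h0 : 0 < h) (MT : M%:R * h = T)
  (Lu : forall i, L2p (rs `[0, T] (fun s w => u s w i 0))).

Definition cellint (j : nat) (w : Omega) : 'cV[R]_m :=
  \col_i tint (rC h j (fun s w => u s w i 0)) w.

Definition cellnrm (j : nat) : R := \sum_i n2p (rC h j (fun s w => u s w i 0)).

Let MT' : M%:R * h <= T. Proof. by rewrite MT. Qed.

Let LC j i : (j < M)%N -> L2p (rC h j (fun s w => u s w i 0)).
Proof. by move=> jM; exact: (rC_L2 (ltW h0) MT' jM (Lu i)). Qed.

Let tkT (j : nat) : (j <= M)%N -> j%:R * h <= T.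
Proof. by move=> jM; rewrite -MT cell_le// ltW. Qed.

Let sC j i : (j < M)%N -> tsupp 0 T (rC h j (fun s w => u s w i 0)).
Proof.
by move=> jM; apply: rI_supp; [rewrite mulr_ge0// ltW|exact: tkT].
Qed.

Lemma cellint_L2 j i : (j < M)%N ->
  L2 (fun w => cellint j w i 0) /\
  n2 (fun w => cellint j w i 0) <= h * n2p (rC h j (fun s w => u s w i 0)).
Proof.
move=> jM; have jj : j%:R * h < j.+1%:R * h by rewrite ltr_pM2r// ltr_nat.
have := tint_L2 jj (LC i jM) (rI_supp _ (lexx _) (lexx _)).
have -> : (fun w => cellint j w i 0) = tint (rC h j (fun s w => u s w i 0)).
  by apply/funext => w; rewrite mxE.
by rewrite (_ : j.+1%:R * h - j%:R * h = h)//; rewrite -natr1; ring.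
Qed.

Lemma cellint_mulmx j n (Q : 'M[R]_(n, m)) l : (j < M)%N ->
  {ae Pr, forall w, (Q *m cellint j w) l 0 = tint (rC h j (fun s w => (Q *m u s w) l 0)) w}.
Proof.
move=> jM; rewrite /rC rI_mulmx.
have LQ k : L2p (fun z => Q l k * rC h j (fun s w => u s w k 0) z) by apply: L2Z; exact: LC.
have sQ k : tsupp 0 T (fun z => Q l k * rC h j (fun s w => u s w k 0) z).
  by apply: tsuppZ; exact: sC.
have h2 : {ae Pr, forall w, forall k, tint (fun z => Q l k * rC h j (fun s w => u s w k 0) z) w =
    Q l k * tint (rC h j (fun s w => u s w k 0)) w}.
  by apply: filter_forall => k; have := tintZ (Q l k) (LC k jM) (sC k jM); exact.
move: (tint_sum (index_enum _) LQ sQ) h2; apply: filterS2 => w -> h2.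
by rewrite mxE; apply: eq_bigr => k _; rewrite h2 mxE.
Qed.

Lemma cellint_mulmx_L2 j n (Q : 'M[R]_(n, m)) l : (j < M)%N ->
  L2 (fun w => (Q *m cellint j w) l 0).
Proof. by move=> jM; apply: L2_mulmx => k; case: (cellint_L2 k jM). Qed.

(** A difference of two integrals handled by [tint_f_Ft]; the solution [x] acts as the witness that
    the integrated input is adapted. *)
Lemma cellint_Ft n (A : 'M[R]_n) (N : 'I_q -> 'M[R]_n) (B : 'M[R]_(n, m)) x j l :
  state Pr Ft W T A B N 0 u x -> (j < M)%N ->
  measurable_wrt (Ft (j.+1%:R * h)) (fun w => (B *m cellint j w) l 0).
Proof.
move=> hx jM; set f := fun t w => B *m u t w.
have Lf i : L2p (rs `[0, T] (fun s w => f s w i 0)).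
  by rewrite rs_mulmx; apply: L2_sum => k; exact: L2Z.
have kh0 (k : nat) : 0 <= k%:R * h by rewrite mulr_ge0// ltW.
have F1 := tint_f_Ft hF hW T0 hx Lf l (kh0 j.+1) (tkT jM).
have F0 := tint_f_Ft hF hW T0 hx Lf l (kh0 j) (tkT (ltnW jM)).
have jj := cell_le (ltW h0) (leqnSn j).
have sF := Ft_sigma hF (kh0 j.+1).
apply: (mwrt_ae hF (kh0 j.+1) (X := fun w =>
   tint (rI 0 (j.+1%:R * h) (fun s w => f s w l 0)) w -
   tint (rI 0 (j%:R * h) (fun s w => f s w l 0)) w)); last first.
  by apply: mwrtB => //; exact: (Ft_mono hF (kh0 j) jj).
have hQ := cellint_mulmx B l jM.
have LI : L2p (rI 0 (j%:R * h) (fun s w => f s w l 0)).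
  exact: (rI_L2 (lexx 0) (tkT (ltnW jM)) (Lf l)).
have LCf : L2p (rC h j (fun s w => f s w l 0)).
  exact: (rC_L2 (ltW h0) MT' jM (Lf l)).
have sI : tsupp 0 T (rI 0 (j%:R * h) (fun s w => f s w l 0)).
  by apply: rI_supp => //; exact: tkT (ltnW jM).
have sCf : tsupp 0 T (rC h j (fun s w => f s w l 0)).
  by apply: rI_supp => //; exact: tkT.
have := tintD LI sI LCf sCf.
rewrite (_ : (fun z => rI 0 _ _ z + _) = rI 0 (j.+1%:R * h) (fun s w => f s w l 0)); last first.
  by apply/funext => z; rewrite (rI_split _ _ (kh0 j) jj).
by move: hQ; apply: filterS2 => w -> ->; rewrite addrAC subrr add0r.
Qed.

Lemma cellnrm_sum : \sum_(j < M) cellnrm j = \sum_i n2p (rI 0 T (fun s w => u s w i 0)).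
Proof.
rewrite exchange_big/=; apply: eq_bigr => i _.
by rewrite (n2p_rC_sum (ltW h0) MT' (Lu i)) MT.
Qed.

(** The discrete weight is taken at the right end of a cell, where the decreasing exponential is
    smallest, so the control side loses nothing. *)
Lemma cellnrm_weighted (beta : R) : 0 <= beta ->
  \sum_(j < M) expR (- (beta * (j.+1%:R * h))) * cellnrm j <=
  \sum_i n2p (fun z => gam beta z * rI 0 T (fun s w => u s w i 0) z).
Proof.
move=> b0; under eq_bigr do rewrite mulr_sumr.
rewrite exchange_big/=; apply: ler_sum => i _.
pose F (j : 'I_M) z := gam beta z * rC h j (fun s w => u s w i 0) z.
have LF j : L2p (F j) := proj1 (gam_L2 b0 (LC i (ltn_ord j)) (sC i (ltn_ord j))).
rewrite (_ : (fun z => _) = fun z => \sum_j F j z); last first.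
  by apply/funext => z; rewrite -MT (rC_sum _ _ _ (ltW h0)) mulr_sumr.
rewrite n2_disjoint//; last first.
  by move=> k k' z kk; rewrite /F !rC_E mulrACA [X in _ * X]mulrACA (cell_disj _ (ltW h0) kk) mul0r mulr0.
apply: ler_sum => j _.
pose c := expR (- (beta * (j.+1%:R * h) / 2)).
have -> : expR (- (beta * (j.+1%:R * h))) = c ^+ 2 by rewrite expr2 -expRD; congr expR; field.
rewrite -n2Z; last exact: LC.
apply: n2_le => //; first by apply: L2Z; exact: LC.
move=> z; rewrite /F rC_E !exprMn.
have [c0|[c1 [z0 z1]]] := ioc_cases (j%:R * h) (j.+1%:R * h) z.1.
  by rewrite /cell c0 expr0n !mul0r !mulr0.
apply: ler_wpM2r; first by rewrite mulr_ge0// sqr_ge0.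
rewrite ler_pXn2r ?nnegrE ?expR_ge0// ler_expR lerN2.
by rewrite ler_pM2r// ler_wpM2l.
Qed.

End Driver.

Section OutputApprox.
Context {R : realType} {d : measure_display} {Omega : measurableType d}.
Variables (Pr : probability Omega R) (Ft : R -> set_system Omega) (q : nat)
  (K : 'M[R]_q) (W : R -> Omega -> 'cV[R]_q).
Hypotheses (hF : usual_filtration Pr Ft) (hW : wiener Pr Ft K W).
Local Notation leb := (@lebesgue_measure R).
Local Notation L2 := (sqint Pr).
Local Notation n2 := (sqnorm Pr).
Local Notation L2p := (sqint (leb \x Pr)%E).
Local Notation n2p := (sqnorm (leb \x Pr)%E).
Variables (T : R) (m : nat) (u : R -> Omega -> 'cV[R]_m).
Hypotheses (T0 : 0 < T) (Lu : forall i, L2p (rs `[0, T] (fun s w => u s w i 0))).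

(** Stated for arbitrary coefficients, because both the full and the reduced system are approximated
    with the same cell integrals. *)
Lemma output_euler n p (A : 'M[R]_n) (N : 'I_q -> 'M[R]_n) (B : 'M[R]_(n, m))
    (C : 'M[R]_(p, n)) x :
  state Pr Ft W T A B N 0 u x -> exists Cst : R, 0 <= Cst /\
  forall (h : R) (M : nat) (xi : nat -> Omega -> 'cV[R]_n),
  0 < h -> (0 < M)%N -> M%:R * h = T ->
  xi = euler W h A N (fun j w => B *m cellint h u j w) ->
  let D c z := rI 0 T (fun s w => (C *m x s w) c 0) z -
               \sum_(j < M) cell h j z.1 * (C *m xi j z.2) c 0 in
  [/\ forall j c, (j < M)%N -> L2 (fun w => (C *m xi j w) c 0),
      forall c, L2p (D c), forall c, tsupp 0 T (D c) & \sum_c n2p (D c) <= Cst * h].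
Proof.
move=> hx; set f := fun t w => B *m u t w.
have Lf i : L2p (rs `[0, T] (fun s w => f s w i 0)).
  by rewrite rs_mulmx; apply: L2_sum => k; exact: L2Z.
have [hL _ _] := hx.
have Lx l := L2process_coord l (measurable_itv _) hL.
have [Cst [C0 H]] := euler_conv hF hW T0 hx Lf.
exists (\sum_c n%:R * rowsq C c * Cst); split.
  by apply: sumr_ge0 => c _; rewrite !mulr_ge0// rowsq_ge0.
move=> h M xi h0 M0 MT xiE D.
have kh0 (k : nat) : 0 <= k%:R * h by rewrite mulr_ge0// ltW.
have MT' : M%:R * h <= T by rewrite MT.
pose G := fun j w => B *m cellint h u j w.
have FG k l : (k < M)%N -> measurable_wrt (Ft (k.+1%:R * h)) (fun w => G k w l 0).
  by move=> kM; exact: (cellint_Ft hF hW T0 h0 MT Lu l hx kM).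
have LG k l : (k < M)%N -> L2 (fun w => G k w l 0).
  by move=> kM; exact: (cellint_mulmx_L2 h0 MT Lu B l kM).
have gd : good_driver Pr Ft f h M G.
  move=> k l kM; split; [exact: FG|exact: LG|].
  exact: (cellint_mulmx h0 MT Lu B l kM).
have Lxi k l : (k < M)%N -> L2 (fun w => xi k w l 0).
  move=> kM; rewrite xiE; case: (euler_Ft hF hW A N (ltW h0) FG LG l (ltnW kM)) => _; exact.
pose D0 l z := rI 0 T (fun s w => x s w l 0) z - \sum_(k < M) cell h k z.1 * xi k z.2 l 0.
have LD0 l : L2p (D0 l).
  apply: L2B; first exact: (rI_L2 (lexx 0) (lexx T) (Lx l)).
  by apply: L2_sum => k; case: (cell_tensor k (ltW h0) (Lxi k l (ltn_ord k))).
have DE c : D c = fun z => \sum_l C c l * D0 l z.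
  apply/funext => z; rewrite /D rI_mulmx.
  under [RHS]eq_bigr do rewrite mulrBr; rewrite sumrB; congr (_ - _).
  under [RHS]eq_bigr do rewrite mulr_sumr; rewrite exchange_big/=.
  apply: eq_bigr => j _; rewrite mxE mulr_sumr; apply: eq_bigr => l _.
  by rewrite mulrCA.
split.
- by move=> j c jM; apply: L2_mulmx => k; exact: Lxi.
- by move=> c; rewrite DE; apply: L2_sum => l; exact: L2Z.
- move=> c z; rewrite /D mulrBl; congr (_ - _); first exact: (rI_supp _ (lexx 0) (lexx T)).
  have sF (j : 'I_M) : tsupp 0 T (fun z : measurableTypeR R * Omega =>
      cell h j z.1 * (C *m xi j z.2) c 0).
    apply: (@cell_supp _ _ _ h T j (fun w => (C *m xi j w) c 0)); first exact: ltW.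
    by rewrite -MT; apply: cell_le; first exact: ltW.
  exact: (tsupp_sum (index_enum _) sF).
rewrite mulr_suml; apply: ler_sum => c _; rewrite DE.
apply: le_trans (n2_lincomb _ _ LD0) _; rewrite -[leRHS]mulrA.
apply: ler_wpM2l; first by rewrite mulr_ge0// rowsq_ge0.
by have := H M h G M0 h0 MT gd; rewrite -xiE.
Qed.

(** On the output side the weight at the right end is too small. Replacing it by the one at the left
    end costs the factor e^(beta h), which tends to 1 with the step. *)
Lemma gam_cells (beta h : R) (M : nat) (g : nat -> Omega -> R) : 0 <= beta -> 0 < h ->
  (forall j, (j < M)%N -> L2 (g j)) ->
  L2p (fun z => gam beta z * \sum_(j < M) cell h j z.1 * g j z.2) /\
  n2p (fun z => gam beta z * \sum_(j < M) cell h j z.1 * g j z.2) <=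
  expR (beta * h) * \sum_(j < M) expR (- (beta * (j.+1%:R * h))) * (h * n2 (g j)).
Proof.
move=> b0 h0 Lg; pose F (j : 'I_M) z := gam beta z * (cell h j z.1 * g j z.2).
have LC (j : 'I_M) := cell_tensor j (ltW h0) (Lg j (ltn_ord j)).
have LF j : L2p (F j).
  apply: (proj1 (gam_L2 (T := M%:R * h) b0 (proj1 (LC j)) _)).
  apply: (@cell_supp _ _ _ h _ j) => //; first exact: ltW.
  by apply: cell_le; first exact: ltW.
rewrite (_ : (fun z => _) = fun z => \sum_j F j z); last first.
  by apply/funext => z; rewrite mulr_sumr.
split; first exact: L2_sum.
rewrite n2_disjoint//; last first.
  by move=> k k' z kk; rewrite /F mulrACA [X in _ * X]mulrACA (cell_disj _ (ltW h0) kk) mul0r mulr0.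
rewrite mulr_sumr; apply: ler_sum => j _.
pose c := expR (- (beta * (j%:R * h) / 2)).
have -> : expR (beta * h) * (expR (- (beta * (j.+1%:R * h))) * (h * n2 (g j))) =
    c ^+ 2 * (h * n2 (g j)).
  by rewrite mulrA -expRD expr2 -expRD; congr (expR _ * _); rewrite -natr1; field.
have [LCj <-] := LC j; rewrite -n2Z//.
apply: n2_le => //; first exact: L2Z.
move=> z; rewrite /F !exprMn.
have [c0|[c1 [z0 z1]]] := ioc_cases (j%:R * h) (j.+1%:R * h) z.1.
  by rewrite /cell c0 expr0n !mul0r !mulr0.
apply: ler_wpM2r; first by rewrite mulr_ge0// sqr_ge0.
rewrite ler_pXn2r ?nnegrE ?expR_ge0// ler_expR lerN2.
by rewrite ler_pM2r// ler_wpM2l// ltW.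
Qed.

End OutputApprox.

Section Truncation.
Context {R : realType} {d : measure_display} {Omega : measurableType d}.
Variables (Pr : probability Omega R) (Ft : R -> set_system Omega) (q : nat)
  (K : 'M[R]_q) (W : R -> Omega -> 'cV[R]_q).
Hypotheses (hF : usual_filtration Pr Ft) (hW : wiener Pr Ft K W).
Local Notation leb := (@lebesgue_measure R).
Local Notation L2 := (sqint Pr).
Local Notation n2 := (sqnorm Pr).
Local Notation L2p := (sqint (leb \x Pr)%E).
Local Notation n2p := (sqnorm (leb \x Pr)%E).

(** The output error is the difference of the two scheme outputs plus two approximation errors whose
    squared norms are O(h). Young's inequality with weights 1 + ep and 1 + 1 / ep keeps the constant
    of the first part sharp in the limit. *)
Lemma truncation_bound (n m p r : nat) (rn : (r <= n)%N) (A : 'M[R]_n) (N : 'I_q -> 'M[R]_n)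
    (B : 'M[R]_(n, m)) (C : 'M[R]_(p, n)) (S : 'M[R]_n) (sg : 'I_n -> R) (beta T : R)
    (u : R -> Omega -> 'cV[R]_m) (x : R -> Omega -> 'cV[R]_n) (xr : R -> Omega -> 'cV[R]_r) :
  let A' := S *m A *m invmx S in let N' := fun i => S *m N i *m invmx S in
  let B' := S *m B in let C' := C *m invmx S in
  S \in unitmx -> (forall l, 0 < sg l) -> 0 <= beta ->
  obs_ineq K A' N' C' sg beta -> reach_ineq K A' N' B' sg beta -> 0 < T ->
  (forall i, L2p (rs `[0, T] (fun s w => u s w i 0))) ->
  state Pr Ft W T A B N 0 u x ->
  state Pr Ft W T (truncsq rn A') (truncrow rn B') (fun i => truncsq rn (N' i)) 0 u xr ->
  \sum_c n2p (fun z => gam beta z *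
    rI 0 T (fun s w => (C *m x s w - trunccol rn C' *m xr s w) c 0) z) <=
  (2 * \sum_(k < n | (r <= k)%N) sg k) ^+ 2 *
  \sum_i n2p (fun z => gam beta z * rI 0 T (fun s w => u s w i 0) z).
Proof.
move=> A' N' B' C' uS sg0 beta0 hO hR T0 Lu hx hxr.
pose U2 := \sum_i n2p (fun z => gam beta z * rI 0 T (fun s w => u s w i 0) z).
pose U0 := \sum_i n2p (rI 0 T (fun s w => u s w i 0)).
have [C1 [C10 H1]] := output_euler hF hW T0 Lu C hx.
have [C2 [C20 H2]] := output_euler hF hW T0 Lu (trunccol rn C') hxr.
have [C3 [C30 H3]] := chain_bound hF hW sg0 hO hR (ltW T0) beta0 rn.
have U20 : 0 <= U2 by apply: sumr_ge0 => i _; exact: n2_ge0.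
have U00 : 0 <= U0 by apply: sumr_ge0 => i _; exact: n2_ge0.
apply: (@limit_arg R _ _ beta (C3 * U0) (2 * C1 + 2 * C2) T) => //.
- by rewrite mulr_ge0// sqr_ge0.
- by rewrite mulr_ge0.
- by rewrite addr_ge0// mulr_ge0.
move=> ep M dl ep0 M0 dl0 dl1 MT; pose h := dl ^+ 2; rewrite -/h in MT *.
have h0 : 0 < h by rewrite exprn_gt0.
pose U := cellint h u.
pose xi := euler W h A N (fun j w => B *m U j w).
pose xir := euler W h (truncsq rn A') (fun i => truncsq rn (N' i))
  (fun j w => truncrow rn B' *m U j w).
have {H1}[L1 LD1 sD1 nD1] := H1 h M xi h0 M0 MT erefl.
have {H2}[L2' LD2 sD2 nD2] := H2 h M xir h0 M0 MT erefl.
(* In balanced coordinates the scheme of the full system is the one that keeps all n coordinates. *)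
have xiE j w : S *m xi j w = txi W A' N' B' h U n j w.
  have A'E (X : 'M[R]_n) : S *m X = trunc n (S *m X *m invmx S) *m S.
    by rewrite /trunc pid_mx_1 mul1mx mulmx1 mulmxKV.
  apply: euler_morph => [|i|{}j {}w]; [exact: A'E|exact: A'E|].
  by rewrite pid_mx_1 mul1mx mulmxA.
(* Padded with zeros, the scheme of the reduced system is the one that keeps r coordinates. *)
have xirE j w : @emb R n r *m xir j w = txi W A' N' B' h U r j w.
  have tE (X : 'M[R]_n) : @emb R n r *m truncsq rn X = trunc r X *m @emb R n r.
    by rewrite truncsq_emb /trunc !mulmxA emb_emb_tr -[RHS]mulmxA pid_emb.
  apply: euler_morph => [|i|{}j {}w]; [exact: tE|exact: tE|].
  by rewrite emb_tr_mulmx !mulmxA emb_emb_tr.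
have outE j w : C' *m (txi W A' N' B' h U n j w - txi W A' N' B' h U r j w) =
    C *m xi j w - trunccol rn C' *m xir j w.
  by rewrite -xiE -xirE mulmxBr mulmxA mulmxKV// mulmx_emb mulmxA.
pose g c (j : nat) w := (C *m xi j w - trunccol rn C' *m xir j w) c 0.
have Lg c j : (j < M)%N -> L2 (g c j).
  move=> jM; rewrite /g; under eq_fun do rewrite mxE [X in _ + X]mxE.
  by apply: L2B; [exact: L1|exact: L2'].
have GP c := gam_cells beta0 h0 (@Lg c).
pose D1 c (z : measurableTypeR R * Omega) := rI 0 T (fun s w => (C *m x s w) c 0) z -
  \sum_(j < M) cell h j z.1 * (C *m xi j z.2) c 0.
pose D2 c (z : measurableTypeR R * Omega) := rI 0 T (fun s w => (trunccol rn C' *m xr s w) c 0) z -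
  \sum_(j < M) cell h j z.1 * (trunccol rn C' *m xir j z.2) c 0.
have LQ c : L2p (fun z => D1 c z - D2 c z) := L2B (LD1 c) (LD2 c).
have sQ c : tsupp 0 T (fun z => D1 c z - D2 c z).
  by move=> z; rewrite mulrBl; congr (_ - _); [exact: sD1|exact: sD2].
have GQ c := gam_L2 beta0 (LQ c) (sQ c).
have split c : (fun z => gam beta z *
    rI 0 T (fun s w => (C *m x s w - trunccol rn C' *m xr s w) c 0) z) =
  fun z => gam beta z * (\sum_(j < M) cell h j z.1 * g c j z.2) +
           gam beta z * (D1 c z - D2 c z).
  apply/funext => z; rewrite -mulrDr; congr (_ * _).
  rewrite rIE mxE [X in _ * (_ + X)]mxE mulrBr /D1 /D2 !rIE /g.
  under eq_bigr do rewrite mxE [X in _ * (_ + X)]mxE mulrBr.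
  by rewrite sumrB; ring.
pose P c := n2p (fun z => gam beta z * \sum_(j < M) cell h j z.1 * g c j z.2).
pose Q c := n2p (fun z => D1 c z - D2 c z).
have ei0 : 0 <= 1 + ep^-1 by rewrite addr_ge0// invr_ge0 ltW.
have e10 : 0 <= 1 + ep by rewrite addr_ge0// ltW.
apply: le_trans (_ : _ <= (1 + ep) * (\sum_c P c) + (1 + ep^-1) * (\sum_c Q c)) _.
  rewrite !mulr_sumr -big_split/=; apply: ler_sum => c _; rewrite split.
  apply: le_trans (n2D_eps ep0 (proj1 (GP c)) (proj1 (GQ c))) _.
  by rewrite lerD2l ler_wpM2l//; exact: (proj2 (GQ c)).
apply: lerD; apply: ler_wpM2l => //; last first.
  apply: le_trans (_ : _ <= \sum_c (2 * n2p (D1 c) + 2 * n2p (D2 c))) _.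
    by apply: ler_sum => c _; exact: (n2B_le (LD1 c) (LD2 c)).
  by rewrite big_split/= -!mulr_sumr; lra.
(* The energy of the control on a cell serves as [e j]; measurability for S B follows from that for
   B by linear combination. *)
have ib : input_bound Pr Ft B' h M (cellnrm Pr h u) U.
  move=> j jM; split.
  - by apply: sumr_ge0 => i _; exact: n2_ge0.
  - move=> l; have kh0 : 0 <= j.+1%:R * h by rewrite mulr_ge0// ltW.
    rewrite /B'; under eq_fun do rewrite -mulmxA mxE.
    apply: mwrt_sum; first exact: (Ft_sigma hF kh0).
    move=> k; apply: mwrtZ; first exact: (Ft_sigma hF kh0).
    exact: (cellint_Ft hF hW T0 h0 MT Lu k hx jM).
  - by move=> i; case: (cellint_L2 h0 MT Lu i jM).
  - by rewrite mulr_sumr; apply: ler_sum => i _; case: (cellint_L2 h0 MT Lu i jM).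
have MT' : M%:R * h <= T by rewrite MT.
have := H3 h dl M U _ dl0 dl1 erefl MT' ib.
rewrite (cellnrm_sum h0 MT Lu) -/U0 => {}H3.
apply: le_trans (_ : _ <= expR (beta * h) * \sum_(j < M) expR (- (beta * (j.+1%:R * h))) *
    (h * \sum_c n2 (g c j))) _.
  under [X in _ <= _ * X]eq_bigr do rewrite !mulr_sumr.
  rewrite exchange_big/= mulr_sumr; apply: ler_sum => c _; exact: (proj2 (GP c)).
rewrite ler_wpM2l ?expR_ge0//.
have gE c j : g c j =
    fun w => (C' *m (txi W A' N' B' h U n j w - txi W A' N' B' h U r j w)) c 0.
  by apply/funext => w; rewrite outE.
under eq_bigr => j _ do under eq_bigr => c _ do rewrite gE.
apply: le_trans H3 _; apply: lerD.
  by apply: ler_wpM2l; [exact: sqr_ge0|exact: (cellnrm_weighted h0 MT Lu)].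
by rewrite mulrA mulrAC.
Qed.

End Truncation.

Theorem theorem5p5 (R : realType) (d : measure_display)
  (Omega : measurableType d) (Pr : probability Omega R)
  (Ft : R -> set_system Omega) (q n m p r : nat)
  (K : 'M[R]_q) (W : R -> Omega -> 'cV[R]_q)
  (A : 'M[R]_n) (N : 'I_q -> 'M[R]_n) (B : 'M[R]_(n, m)) (C : 'M[R]_(p, n))
  (P Q Phalf Qhalf Sb : 'M[R]_n) (sigma : 'rV[R]_n)
  (hFt : usual_filtration Pr Ft) (hW : wiener Pr Ft K W)
  (hstab : stabilizable Pr Ft W A B N)
  (hobs : observable Pr Ft W A C N)
  (hP : posdefmx P)
  (hPineq : nsdmx (A^T *m invmx P + invmx P *m A
     + (\sum_(i < q) \sum_(j < q) K i j *: ((N i)^T *m invmx P *m N j))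
     - C^T *m C + invmx P *m B *m B^T *m invmx P))
  (hQ : posdefmx Q)
  (hQeq : A^T *m Q + Q *m A
     + (\sum_(i < q) \sum_(j < q) K i j *: ((N i)^T *m Q *m N j))
     + C^T *m C - Q *m B *m B^T *m Q = 0)
  (hQstab : ms_stable Pr Ft W (A - B *m B^T *m Q) N)
  (hPhalf : is_sqrtmx P Phalf) (hQhalf : is_sqrtmx Q Qhalf)
  (hr : (1 <= r)%N) (hrn : (r < n)%N)
  (hsigma_pos : forall k, 0 < sigma 0 k)
  (hsigma_dec : forall k l : 'I_n, (k <= l)%N -> sigma 0 l <= sigma 0 k)
  (hsigma_eig : char_poly (P *m Q) =
     \prod_(k < n) ('X - (sigma 0 k ^+ 2)%:P))
  (hS : Sb \in unitmx)
  (hSP : Sb *m P *m Sb^T = diag_mx sigma)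
  (hSQ : (invmx Sb)^T *m Q *m invmx Sb = diag_mx sigma)
  (T : R) (hT : 0 < T)
  (u : R -> Omega -> 'cV[R]_m) (hu : L2process Pr Ft `[0, T] u)
  (x : R -> Omega -> 'cV[R]_n) (hx : state Pr Ft W T A B N 0 u x)
  (xr : R -> Omega -> 'cV[R]_r)
  (hxr : state Pr Ft W T
     (truncsq (ltnW hrn) (Sb *m A *m invmx Sb))
     (truncrow (ltnW hrn) (Sb *m B))
     (fun i => truncsq (ltnW hrn) (Sb *m N i *m invmx Sb)) 0 u xr) :
  let y := fun t w => C *m x t w in
  let yr := fun t w => trunccol (ltnW hrn) (C *m invmx Sb) *m xr t w in
  let beta := Num.max (specnorm (B^T *m Qhalf) ^+ 2)
                      (specnorm (C *m Phalf) ^+ 2) in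
  (weighted_L2norm Pr beta T (fun t w => (y t w - yr t w)%R) <=
   (2 * \sum_(k < n | (r <= k)%N) sigma 0 k)%:E * weighted_L2norm Pr beta T u)%E.
Proof.
cbv zeta; set beta := Num.max _ _.
pose y t w := C *m x t w; pose yr t w := trunccol (ltnW hrn) (C *m invmx Sb) *m xr t w.
have b0 : 0 <= beta by exact: beta_ge0.
have hO : obs_ineq K _ _ _ _ beta := balanced_obs Phalf hS hSQ hQhalf hQeq.
have hR : reach_ineq K _ _ _ _ beta := balanced_reach Qhalf hS hsigma_pos hSP hPhalf hPineq.
have [hLx _ _] := hx; have [hLxr _ _] := hxr.
have Lu i := L2process_coord i (measurable_itv _) hu.
have Lx i := L2process_coord i (measurable_itv _) hLx.
have Lxr i := L2process_coord i (measurable_itv _) hLxr.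
have [_ mu _] := hu; have [_ mx _] := hLx; have [_ mxr _] := hLxr.
(* Both sides become roots of finite squared norms, the form in which [truncation_bound] compares
   them. *)
rewrite (weighted_norm b0 mu Lu) weighted_norm//; first last.
- move=> c.
  rewrite (_ : rs _ _ = fun z => rs `[0, T] (fun s w => y s w c 0) z -
      rs `[0, T] (fun s w => yr s w c 0) z); last first.
    by apply/funext => z; rewrite /rs !mxE mulrBr.
  by apply: L2B; rewrite rs_mulmx; apply: L2_sum => k; exact: L2Z.
- move=> c; rewrite (_ : (fun z : R * Omega => _) = fun z : R * Omega =>
    \sum_k C c k * x z.1 z.2 k 0 -
    \sum_k trunccol (ltnW hrn) (C *m invmx Sb) c k * xr z.1 z.2 k 0); last first.
    by apply/funext => z; rewrite mxE [X in _ + X]mxE !mxE.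
  by apply: measurable_funB; apply: measurable_sum => k; apply: measurable_funM.
have H := truncation_bound hFt hW hS hsigma_pos b0 hO hR hT Lu hx hxr.
have S0 : 0 <= 2 * \sum_(k < n | (r <= k)%N) sigma 0 k.
  by rewrite mulr_ge0// sumr_ge0// => k _; exact: ltW.
set L := \sum_c _ in H *; set U := \sum_i _ in H *.
have L0 : 0 <= L by apply: sumr_ge0 => i _; exact: n2_ge0.
have U0 : 0 <= U by apply: sumr_ge0 => i _; exact: n2_ge0.
rewrite !poweR_EFin !powR12_sqrt ?L0// -EFinM lee_fin -{1}(ger0_norm S0) -sqrtr_sqr -sqrtrM ?sqr_ge0//.
by rewrite ler_wsqrtr.
Qed.
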